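(* For real $t$ let $f_t(x)=-t\tanh(t\tan x)$, and let $F_w(z)=iw\tan(iw\tan z)$ be its complex extension, $F_t=f_t$ on the reals. Let $t_0\in(0,\pi)$ be a virtual cycle parameter of order $m\ge1$, i.e. there is $c_0\in\{\pi/2,-\pi/2\}$ with $f_{t_0}^{m-1}(t_0)=c_0$, and put $c_1=t_0$ and $\Phi(t)=f_t^{m-1}(t)-c_0$ for $t$ real in a neighborhood of $t_0$. Then $$\frac{\Phi'(t_0)}{(F_{t_0}^{m-1})'(c_1)}>0.$$
   Context: $f_t=T_t^2$ restricted to $\mathbb{R}$, where $T_t(z)=it\tan z$; its poles are the points $k\pi+\pi/2$, $k\in\mathbb{Z}$. ``Virtual cycle parameter of order $m$'' means that $f_{t_0}^{m-1}(t_0)=c_0$ and none of the points $f_{t_0}^i(t_0)$, $0\le i<m-1$, is a pole. $(F_{t_0}^{m-1})'$ denotes the derivative in $z$ of the $(m-1)$-st iterate of $F_{t_0}$. *)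

(* Defs.v *)
From Stdlib Require Import Reals.
From Coquelicot Require Import Coquelicot.
Open Scope R_scope.

Definition Cexp (z : C) : C := (exp (Re z) * cos (Im z), exp (Re z) * sin (Im z)).

Definition Csin (z : C) : C :=
  ((Cexp (Ci * z) - Cexp (- (Ci * z))) / (RtoC 2 * Ci))%C.

Definition Ccos (z : C) : C :=
  ((Cexp (Ci * z) + Cexp (- (Ci * z))) / RtoC 2)%C.

Definition Ctan (z : C) : C := (Csin z / Ccos z)%C.

(* [f_t] and [F_w] are total: where [tan] (resp. [Ctan]) has a pole they take
   the arbitrary value given by division by zero. *)
Definition f_t (t x : R) : R := - t * tanh (t * tan x).

Definition T_w (w z : C) : C := (Ci * w * Ctan z)%C.

Definition F_w (w z : C) : C := T_w w (T_w w z).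

Definition is_tan_pole (x : R) : Prop :=
  exists k : Z, x = IZR k * PI + PI / 2.

(* [t0] is both the parameter and the starting point of the orbit. The last
   conjunct keeps the arbitrary values of [f_t] at poles out of the orbit. *)
Definition virtual_cycle_parameter (m : nat) (t0 c0 : R) : Prop :=
  (1 <= m)%nat /\
  (c0 = PI / 2 \/ c0 = - (PI / 2)) /\
  Nat.iter (m - 1) (f_t t0) t0 = c0 /\
  forall i : nat, (i < m - 1)%nat -> ~ is_tan_pole (Nat.iter i (f_t t0) t0).

Definition Phi (m : nat) (c0 t : R) : R := Nat.iter (m - 1) (f_t t) t - c0.

(* Main.v *)
Require Import Defs.
From Stdlib Require Import Reals.
From Coquelicot Require Import Coquelicot.
From Stdlib Require Import Arith Lra Lia Classical IndefiniteDescription.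
Open Scope R_scope.

(* Write T = T_{t0}, so that F = T o T, and let z_i = T^i(t0), 0 <= i <= K = 2(m-1),
   so that z_K = c0 is a pole of T. The quotient of the theorem is D(1), where
   D(rho) = sum_i rho^i z_i / (t0 (T^i)'(t0)) is a polynomial with real coefficients
   and D(0) = 1; hence, if D(1) <= 0, D has a root rho in (0,1].

   To exclude this we use the lifting argument of Levin, van Strien and Shen. A
   holomorphic motion of the points z_i over a disc, fixing z_K = c0, can be lifted
   through T (whose only singular values are the asymptotic values t0 and -t0) to a
   motion over the same disc, and this can be repeated for ever. The moving points
   omit 0 and c0, so by a Landau type theorem (proved by Ahlfors' method) all the
   lifts are uniformly bounded on a smaller disc. On the other hand, start with the
   motion l |-> T_{t0+l}^i(t0+l), i < K, and let p be the order of the zero of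
   T_{t0+l}^K(t0+l) - c0 at l = 0: a root rho in (0,1] of D makes the p-th Taylor
   coefficients of the successive lifts unbounded, against the Schwarz lemma.

   It remains to see that T_{t0+l}^K(t0+l) is not identically c0, which follows from
   the flatness of f_t at its poles. *)

(** The argument runs with [T] rather than [F] because [T] has no critical point and only the
    asymptotic values [t0] and [-t0], both tied to the first point of the orbit by oddness. This is
    why moving points have to stay distinct up to sign. The points [z_i] and the derivatives
    [(T^i)'(t0)] are real or imaginary in step with each other, which makes [D] real.

    Let [s_i] be the p-th coefficients of a motion measured from the true orbit. Its lift has
    coefficients [(s_(i+1) - z_(i+1)/z_0 s_0) / T'(z_i)]. If [D(rho) = 0], the weights
    [rho^i / (T^i)'(t0)] collapse this to a scalar recursion [L' = (L - w c) / rho], whose source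
    term comes from holding [c0] fixed while the true [z_K] moves. For [rho <= 1] the growth is at
    least linear, the borderline [rho = 1] included, so [D(1) = 0] falls together with [D(1) < 0].

    Holomorphy means infinite differentiability on a disc; the Schwarz lemma and the Landau bound
    come from evaluating Laplacians at a maximum, and orders of vanishing are read off limits of
    [g(l)/l^p]. *)

Ltac Rmin_bounds := repeat match goal with
  | H : context [Rmin ?a ?b] |- _ => lazymatch goal with
      | _ : Rmin a b <= a |- _ => fail
      | _ => pose proof (Rmin_l a b); pose proof (Rmin_r a b) end
  | |- context [Rmin ?a ?b] => lazymatch goal with
      | _ : Rmin a b <= a |- _ => fail
      | _ => pose proof (Rmin_l a b); pose proof (Rmin_r a b) end
  end.

(** * Limits and continuity of complex functions *)

Definition clim (f : C -> C) (z l : C) : Prop :=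
  forall e, 0 < e -> exists d, 0 < d /\
    forall w, w <> z -> Cmod (w - z) < d -> Cmod (f w - l) < e.

Definition ccont (f : C -> C) (z : C) : Prop := clim f z (f z).

(** The limit is punctured, so the arbitrary value of the quotient at [z] itself never matters. *)
Definition cderiv (f : C -> C) (z l : C) : Prop :=
  clim (fun w => (f w - f z) / (w - z))%C z l.

Lemma Cmod_minus_sym (a b : C) : Cmod (a - b) = Cmod (b - a).
Proof. rewrite <- Cmod_opp. f_equal. ring. Qed.

Lemma Cminus_neq_0 (a b : C) : a <> b -> (a - b)%C <> 0%C.
Proof. intros H E. apply H. replace a with (a - b + b)%C by ring. rewrite E. ring. Qed.

Lemma Cminus_eq_0 (a b : C) : (a - b)%C = 0%C -> a = b.
Proof. intros E. replace a with (a - b + b)%C by ring. rewrite E. ring. Qed.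

Lemma Cmod_triangle_minus (a b c : C) : Cmod (a - c) <= Cmod (a - b) + Cmod (b - c).
Proof. replace (a - c)%C with ((a - b) + (b - c))%C by ring. apply Cmod_triangle. Qed.

Lemma Cmod_bound_near (a b : C) : Cmod a <= Cmod b + Cmod (a - b).
Proof. replace a with (b + (a - b))%C at 1 by ring. apply Cmod_triangle. Qed.

Lemma clim_ext_loc (f g : C -> C) (z l : C) (d0 : R) :
  0 < d0 -> (forall w, w <> z -> Cmod (w - z) < d0 -> f w = g w) ->
  clim f z l -> clim g z l.
Proof.
  intros Hd H Hf e He. destruct (Hf e He) as [d [Hd1 Hd2]].
  exists (Rmin d0 d). split; [now apply Rmin_pos|].
  intros w Hw Hwd. rewrite <- H; auto.
  - apply Hd2; auto. Rmin_bounds. lra.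
  - Rmin_bounds; lra.
Qed.

Lemma clim_ext (f g : C -> C) (z l : C) :
  (forall w, w <> z -> f w = g w) -> clim f z l -> clim g z l.
Proof. intros H. apply (clim_ext_loc _ _ _ _ 1); auto; lra. Qed.

Lemma clim_const (c z : C) : clim (fun _ => c) z c.
Proof.
  intros e He. exists 1. split; [lra|]. intros w _ _.
  replace (c - c)%C with (RtoC 0) by ring. now rewrite Cmod_0.
Qed.

Lemma clim_id (z : C) : clim (fun w => w) z z.
Proof. intros e He. exists e. split; auto. Qed.

Lemma clim_plus (f g : C -> C) (z a b : C) :
  clim f z a -> clim g z b -> clim (fun w => f w + g w)%C z (a + b)%C.
Proof.
  intros Hf Hg e He.
  destruct (Hf (e/2) ltac:(lra)) as [d1 [P1 H1]].
  destruct (Hg (e/2) ltac:(lra)) as [d2 [P2 H2]].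
  exists (Rmin d1 d2). split; [now apply Rmin_pos|].
  intros w Hw Hd.
  assert (Cmod (f w - a) < e/2) by (apply H1; auto; Rmin_bounds; lra).
  assert (Cmod (g w - b) < e/2) by (apply H2; auto; Rmin_bounds; lra).
  replace (f w + g w - (a + b))%C with ((f w - a) + (g w - b))%C by ring.
  eapply Rle_lt_trans; [apply Cmod_triangle|lra].
Qed.

Lemma clim_mult (f g : C -> C) (z a b : C) :
  clim f z a -> clim g z b -> clim (fun w => f w * g w)%C z (a * b)%C.
Proof.
  intros Hf Hg e He.
  set (M := 1 + Cmod a + Cmod b).
  assert (HM : 1 <= M) by (unfold M; pose proof (Cmod_ge_0 a); pose proof (Cmod_ge_0 b); lra).
  assert (He2 : 0 < e / (2 * M)) by (apply Rdiv_lt_0_compat; lra).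
  destruct (Hf (e/(2*M)) He2) as [d1 [P1 H1]].
  destruct (Hg (Rmin 1 (e/(2*M)))) as [d2 [P2 H2]]; [apply Rmin_pos; lra|].
  exists (Rmin d1 d2). split; [now apply Rmin_pos|].
  intros w Hw Hd.
  assert (A1 : Cmod (f w - a) < e/(2*M)) by (apply H1; auto; Rmin_bounds; lra).
  assert (A2 : Cmod (g w - b) < Rmin 1 (e/(2*M))) by (apply H2; auto; Rmin_bounds; lra).
  assert (A3 : Cmod (g w - b) < 1) by (Rmin_bounds; lra).
  assert (A4 : Cmod (g w - b) < e/(2*M)) by (Rmin_bounds; lra).
  replace (f w * g w - a * b)%C with ((f w - a) * g w + a * (g w - b))%C by ring.
  eapply Rle_lt_trans; [apply Cmod_triangle|]. rewrite !Cmod_mult.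
  assert (Cmod (g w) <= M).
  { eapply Rle_trans; [apply (Cmod_bound_near _ b)|]. unfold M. pose proof (Cmod_ge_0 a). lra. }
  assert (Cmod a <= M) by (unfold M; pose proof (Cmod_ge_0 b); lra).
  assert (E : e = e/(2*M) * M + M * (e/(2*M))) by (field; lra).
  rewrite E. pose proof (Cmod_ge_0 (f w - a)). pose proof (Cmod_ge_0 (g w - b)).
  pose proof (Cmod_ge_0 (g w)). pose proof (Cmod_ge_0 a).
  apply Rplus_lt_le_compat.
  - apply Rle_lt_trans with (Cmod (f w - a) * M); [apply Rmult_le_compat_l; lra|].
    apply Rmult_lt_compat_r; lra.
  - apply Rmult_le_compat; lra.
Qed.

Lemma clim_opp (f : C -> C) (z a : C) : clim f z a -> clim (fun w => - f w)%C z (- a)%C.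
Proof.
  intros H e He. destruct (H e He) as [d [P Q]]. exists d. split; auto. intros w Hw Hd.
  replace (- f w - - a)%C with (- (f w - a))%C by ring. rewrite Cmod_opp. auto.
Qed.

Lemma clim_minus (f g : C -> C) (z a b : C) :
  clim f z a -> clim g z b -> clim (fun w => f w - g w)%C z (a - b)%C.
Proof. intros Hf Hg. apply clim_plus; auto. now apply clim_opp. Qed.

Lemma clim_inv (f : C -> C) (z a : C) :
  a <> 0%C -> clim f z a -> clim (fun w => / f w)%C z (/ a)%C.
Proof.
  intros Ha Hf e He.
  assert (Pa : 0 < Cmod a) by now apply Cmod_gt_0.
  set (m := Cmod a) in *.
  destruct (Hf (Rmin (m/2) (e * (m * m / 2)))) as [d [P H]].
  { apply Rmin_pos; [lra|]. apply Rmult_lt_0_compat; auto. apply Rdiv_lt_0_compat; nra. }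
  exists d. split; auto. intros w Hw Hd. specialize (H w Hw Hd).
  assert (H1 : Cmod (f w - a) < m/2) by (Rmin_bounds; lra).
  assert (H2 : Cmod (f w - a) < e * (m * m / 2)) by (Rmin_bounds; lra).
  assert (H3 : m / 2 < Cmod (f w)).
  { pose proof (Cmod_bound_near a (f w)). rewrite Cmod_minus_sym in H0. fold m in H0. lra. }
  assert (Hfw : f w <> 0%C) by (apply Cmod_gt_0; lra).
  replace (/ f w - / a)%C with ((a - f w) / (f w * a))%C by (field; auto).
  rewrite Cmod_div by (apply Cmult_neq_0; auto).
  rewrite Cmod_mult, Cmod_minus_sym. fold m.
  apply Rmult_lt_reg_r with (Cmod (f w) * m); [nra|].
  unfold Rdiv. rewrite Rmult_assoc, Rinv_l by (apply Rmult_integral_contrapositive; lra).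
  rewrite Rmult_1_r. eapply Rlt_le_trans; [exact H2|]. apply Rmult_le_compat_l; [lra|]. nra.
Qed.

Lemma clim_div (f g : C -> C) (z a b : C) :
  b <> 0%C -> clim f z a -> clim g z b -> clim (fun w => f w / g w)%C z (a / b)%C.
Proof. intros Hb Hf Hg. apply clim_mult; auto. now apply clim_inv. Qed.

Lemma clim_comp (f g : C -> C) (z l : C) :
  clim f z l -> ccont g l -> clim (fun w => g (f w)) z (g l).
Proof.
  intros Hf Hg e He. destruct (Hg e He) as [d [P H]].
  destruct (Hf d P) as [d' [P' H']]. exists d'. split; auto. intros w Hw Hd.
  destruct (classic (f w = l)) as [E|E].
  - rewrite E. replace (g l - g l)%C with (RtoC 0) by ring. now rewrite Cmod_0.
  - apply H; auto.
Qed.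

Lemma ccont_all (f : C -> C) (z : C) : ccont f z ->
  forall e, 0 < e -> exists d, 0 < d /\ forall w, Cmod (w - z) < d -> Cmod (f w - f z) < e.
Proof.
  intros H e He. destruct (H e He) as [d [P Q]]. exists d. split; auto. intros w Hw.
  destruct (classic (w = z)) as [->|E]; auto.
  replace (f z - f z)%C with (RtoC 0) by ring. now rewrite Cmod_0.
Qed.

Lemma exists_near (z : C) (d : R) : 0 < d -> exists w, w <> z /\ Cmod (w - z) < d.
Proof.
  intros Hd. exists (z + RtoC (d/2))%C.
  assert (E : (z + RtoC (d/2) - z)%C = RtoC (d/2)) by ring. split.
  - intros F. rewrite F in E. replace (z - z)%C with (RtoC 0) in E by ring.
    apply RtoC_inj in E. lra.
  - rewrite E, Cmod_R, Rabs_pos_eq; lra.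
Qed.

Lemma clim_unique (f : C -> C) (z a b : C) : clim f z a -> clim f z b -> a = b.
Proof.
  intros Ha Hb. apply Cminus_eq_0, Cmod_eq_0. apply Rle_antisym; [|apply Cmod_ge_0].
  apply le_epsilon. intros e He. rewrite Rplus_0_l.
  destruct (Ha (e/2) ltac:(lra)) as [d1 [P1 H1]].
  destruct (Hb (e/2) ltac:(lra)) as [d2 [P2 H2]].
  destruct (exists_near z (Rmin d1 d2)) as [w [Hw Hd]]; [now apply Rmin_pos|].
  specialize (H1 w Hw). specialize (H2 w Hw).
  Rmin_bounds.
  specialize (H1 ltac:(lra)). specialize (H2 ltac:(lra)).
  pose proof (Cmod_triangle_minus a (f w) b). rewrite (Cmod_minus_sym a (f w)) in H3. lra.
Qed.

Lemma clim_neq_0_loc (f : C -> C) (z a : C) : clim f z a -> a <> 0%C ->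
  exists d, 0 < d /\ forall w, w <> z -> Cmod (w - z) < d -> f w <> 0%C.
Proof.
  intros H Ha. destruct (H (Cmod a)) as [d [P Q]]; [now apply Cmod_gt_0|].
  exists d. split; auto. intros w Hw Hd E. specialize (Q w Hw Hd). rewrite E in Q.
  replace (0 - a)%C with (- a)%C in Q by ring. rewrite Cmod_opp in Q. lra.
Qed.

Lemma ccont_neq_0_loc (f : C -> C) (z : C) : ccont f z -> f z <> 0%C ->
  exists d, 0 < d /\ forall w, Cmod (w - z) < d -> f w <> 0%C.
Proof.
  intros H Ha. destruct (clim_neq_0_loc _ _ _ H Ha) as [d [P Q]]. exists d; split; auto.
  intros w Hw. destruct (classic (w = z)) as [->|E]; auto.
Qed.

Lemma ccont_ext_loc (f g : C -> C) (z : C) (d0 : R) :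
  0 < d0 -> (forall w, Cmod (w - z) < d0 -> f w = g w) -> ccont f z -> ccont g z.
Proof.
  intros Hd H Hf. unfold ccont. rewrite <- H.
  - apply (clim_ext_loc f _ _ _ d0); auto.
  - replace (z - z)%C with (RtoC 0) by ring. now rewrite Cmod_0.
Qed.

(** * Complex derivative *)

Lemma cderiv_ext_loc (f g : C -> C) (z l : C) (d0 : R) :
  0 < d0 -> (forall w, Cmod (w - z) < d0 -> f w = g w) -> cderiv f z l -> cderiv g z l.
Proof.
  intros Hd H Hf. unfold cderiv. apply clim_ext_loc with (2 := fun w _ Hw => eq_trans
    (f_equal (fun x => (x - f z) / (w - z))%C (H w Hw)) (f_equal (fun x => (g w - x) / (w - z))%C
    (H z (Rle_lt_trans _ _ _ (Req_le _ _ (eq_trans (f_equal Cmod (Cplus_opp_r z)) Cmod_0)) Hd)))); auto.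
Qed.

Lemma cderiv_unique (f : C -> C) (z a b : C) : cderiv f z a -> cderiv f z b -> a = b.
Proof. apply clim_unique. Qed.

Lemma cderiv_cont (f : C -> C) (z l : C) : cderiv f z l -> ccont f z.
Proof.
  intros H. unfold ccont.
  apply clim_ext with (fun w => f z + (f w - f z) / (w - z) * (w - z))%C.
  - intros w Hw. field. now apply Cminus_neq_0.
  - replace (clim _ z (f z)) with (clim (fun w => f z + (f w - f z) / (w - z) * (w - z))%C z
      (f z + l * (z - z))%C) by (f_equal; ring).
    apply clim_plus; [apply clim_const|]. apply clim_mult; auto.
    apply clim_minus; [apply clim_id|apply clim_const].
Qed.

Lemma cderiv_const (c z : C) : cderiv (fun _ => c) z 0%C.
Proof.
  apply clim_ext with (fun _ => RtoC 0); [|apply clim_const].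
  intros w Hw. field. now apply Cminus_neq_0.
Qed.

Lemma cderiv_id (z : C) : cderiv (fun w => w) z 1%C.
Proof.
  apply clim_ext with (fun _ => RtoC 1); [|apply clim_const].
  intros w Hw. field. now apply Cminus_neq_0.
Qed.

Lemma cderiv_plus (f g : C -> C) (z a b : C) :
  cderiv f z a -> cderiv g z b -> cderiv (fun w => f w + g w)%C z (a + b)%C.
Proof.
  intros Hf Hg. eapply clim_ext; [|apply (clim_plus _ _ _ _ _ Hf Hg)].
  intros w Hw. cbv beta. field. now apply Cminus_neq_0.
Qed.

Lemma cderiv_opp (f : C -> C) (z a : C) : cderiv f z a -> cderiv (fun w => - f w)%C z (- a)%C.
Proof.
  intros Hf. eapply clim_ext; [|apply (clim_opp _ _ _ Hf)].
  intros w Hw. cbv beta. field. now apply Cminus_neq_0.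
Qed.

Lemma cderiv_minus (f g : C -> C) (z a b : C) :
  cderiv f z a -> cderiv g z b -> cderiv (fun w => f w - g w)%C z (a - b)%C.
Proof. intros Hf Hg. apply cderiv_plus; auto. now apply cderiv_opp. Qed.

Lemma cderiv_mult (f g : C -> C) (z a b : C) :
  cderiv f z a -> cderiv g z b -> cderiv (fun w => f w * g w)%C z (a * g z + f z * b)%C.
Proof.
  intros Hf Hg. pose proof (cderiv_cont _ _ _ Hg) as Cg.
  eapply clim_ext; [|apply clim_plus;
    [apply (clim_mult _ _ _ _ _ Hf Cg)|apply (clim_mult _ _ _ _ _ (clim_const (f z) z) Hg)]].
  intros w Hw. cbv beta. field. now apply Cminus_neq_0.
Qed.

Lemma cderiv_scal (c : C) (f : C -> C) (z a : C) :
  cderiv f z a -> cderiv (fun w => c * f w)%C z (c * a)%C.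
Proof.
  intros Hf. replace (c * a)%C with (0 * f z + c * a)%C by ring.
  apply (cderiv_mult (fun _ => c)); auto. apply cderiv_const.
Qed.

Lemma cderiv_inv (f : C -> C) (z a : C) :
  f z <> 0%C -> cderiv f z a -> cderiv (fun w => / f w)%C z (- a * (/ f z * / f z))%C.
Proof.
  intros H0 Hf. pose proof (cderiv_cont _ _ _ Hf) as Cf.
  destruct (ccont_neq_0_loc _ _ Cf H0) as [d [P Hd]].
  apply clim_ext_loc with (fun w => - ((f w - f z) / (w - z)) * (/ f w * / f z))%C d; auto.
  - intros w Hw Hwd. specialize (Hd w Hwd). field. repeat split; auto. now apply Cminus_neq_0.
  - apply clim_mult; [now apply clim_opp|]. apply clim_mult; [|apply clim_const].
    now apply clim_inv.
Qed.

Lemma cderiv_comp (f g : C -> C) (z a b : C) :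
  cderiv f z a -> cderiv g (f z) b -> cderiv (fun w => g (f w)) z (b * a)%C.
Proof.
  intros Hf Hg. pose proof (cderiv_cont _ _ _ Hf) as Cf.
  intros e He.
  (* The difference quotient of [g], completed by [b] at [f z], is continuous there; it covers the
     points [w] with [f w = f z], where the usual quotient would divide by zero. *)
  set (q := fun y => if Ceq_dec y (f z) then b
                     else ((g y - g (f z)) / (y - f z))%C).
  assert (Q : ccont q (f z)).
  { unfold ccont. replace (q (f z)) with b.
    - apply clim_ext with (2 := Hg). intros w Hw. unfold q.
      destruct Ceq_dec; [contradiction|reflexivity].
    - unfold q. destruct Ceq_dec; [reflexivity|contradiction]. }
  assert (L : clim (fun w => q (f w) * ((f w - f z) / (w - z)))%C z (b * a)%C).
  { apply clim_mult; auto. replace b with (q (f z)).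
    - apply clim_comp; auto.
    - unfold q. destruct Ceq_dec; [reflexivity|contradiction]. }
  revert e He. change (cderiv (fun w => g (f w)) z (b * a)%C).
  apply clim_ext with (2 := L). intros w Hw. unfold q.
  destruct Ceq_dec as [E|E].
  - rewrite E. field. now apply Cminus_neq_0.
  - field. split; now apply Cminus_neq_0.
Qed.

(** * The complex exponential *)

Lemma Cexp_plus (a b : C) : Cexp (a + b) = (Cexp a * Cexp b)%C.
Proof.
  destruct a as [a1 a2], b as [b1 b2]. unfold Cexp, Cmult; simpl.
  rewrite exp_plus, cos_plus, sin_plus. f_equal; ring.
Qed.

Lemma Cexp_0 : Cexp 0 = 1%C.
Proof. unfold Cexp; simpl. rewrite exp_0, cos_0, sin_0. unfold RtoC; f_equal; ring. Qed.

Lemma Cexp_opp_mult (a : C) : (Cexp a * Cexp (- a))%C = 1%C.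
Proof. rewrite <- Cexp_plus. replace (a + - a)%C with (RtoC 0) by ring. apply Cexp_0. Qed.

Lemma Cexp_neq_0 (a : C) : Cexp a <> 0%C.
Proof.
  intros H. pose proof (Cexp_opp_mult a) as E. rewrite H in E.
  replace (0 * Cexp (- a))%C with (RtoC 0) in E by ring. apply RtoC_inj in E. lra.
Qed.

Lemma Cexp_opp (a : C) : Cexp (- a) = (/ Cexp a)%C.
Proof.
  pose proof (Cexp_opp_mult a). pose proof (Cexp_neq_0 a).
  replace (Cexp (- a)) with (/ Cexp a * (Cexp a * Cexp (- a)))%C by (field; auto).
  rewrite H. ring.
Qed.

Lemma derivable_lin_bound (f : R -> R) (l e : R) : derivable_pt_lim f 0 l -> 0 < e ->
  exists d, 0 < d /\ forall h, Rabs h < d -> Rabs (f h - f 0 - l * h) <= e * Rabs h.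
Proof.
  intros H He. destruct (H e He) as [d Hd]. exists d. split; [apply cond_pos|].
  intros h Hh. destruct (Req_dec h 0) as [->|E].
  - replace (f 0 - f 0 - l * 0) with 0 by ring. rewrite Rabs_R0. lra.
  - specialize (Hd h E Hh). rewrite Rplus_0_l in Hd.
    replace (f h - f 0 - l * h) with (((f h - f 0) / h - l) * h) by (field; auto).
    rewrite Rabs_mult. apply Rmult_le_compat_r; [apply Rabs_pos|lra].
Qed.

Lemma Cmod_le_abs (z : C) : Cmod z <= Rabs (Re z) + Rabs (Im z).
Proof.
  replace z with (RtoC (Re z) + Ci * RtoC (Im z))%C at 1.
  - eapply Rle_trans; [apply Cmod_triangle|]. rewrite Cmod_mult, Cmod_Ci, !Cmod_R. lra.
  - destruct z; unfold Ci, RtoC, Cplus, Cmult; simpl. f_equal; ring.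
Qed.

Lemma im_le_Cmod (z : C) : Rabs (Im z) <= Cmod z.
Proof. eapply Rle_trans; [apply Rmax_r|apply Rmax_Cmod]. Qed.

Lemma cderiv_Cexp_0 : cderiv Cexp 0 1.
Proof.
  intros e He.
  (* Each of the two components will have error at most [3 * k * W], so the sum [6 * k * W] stays
     below [e * W]. *)
  set (k := Rmin 1 (e / 8)).
  assert (Hk : 0 < k) by (apply Rmin_pos; lra).
  assert (Hk1 : k <= 1) by apply Rmin_l. assert (Hk2 : k <= e / 8) by apply Rmin_r.
  destruct (derivable_lin_bound exp 1 k) as [d1 [P1 H1]]; auto.
  { rewrite <- exp_0. apply derivable_pt_lim_exp. }
  destruct (derivable_lin_bound cos 0 k) as [d2 [P2 H2]]; auto.
  { replace 0 with (- sin 0) at 2 by (rewrite sin_0; ring). apply derivable_pt_lim_cos. }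
  destruct (derivable_lin_bound sin 1 k) as [d3 [P3 H3]]; auto.
  { rewrite <- cos_0. apply derivable_pt_lim_sin. }
  rewrite exp_0 in H1. rewrite cos_0 in H2. rewrite sin_0 in H3.
  (* The bound [k / 2] absorbs the quadratic cross term [(exp x - 1) * sin y] into [2 * k * W]. *)
  set (d := Rmin (Rmin d1 d2) (Rmin d3 (k / 2))).
  assert (Hd : 0 < d) by (repeat apply Rmin_pos; lra).
  assert (L : d <= d1 /\ d <= d2 /\ d <= d3 /\ d <= k / 2) by (unfold d; Rmin_bounds; lra).
  exists d. split; auto. intros w Hw Hwd.
  rewrite Cexp_0. replace (w - 0)%C with w in * by ring.
  replace ((Cexp w - 1) / w - 1)%C with ((Cexp w - 1 - w) / w)%C by (field; auto).
  rewrite Cmod_div by auto.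
  assert (Pw : 0 < Cmod w) by now apply Cmod_gt_0.
  apply Rmult_lt_reg_r with (Cmod w); auto. unfold Rdiv.
  rewrite Rmult_assoc, Rinv_l, Rmult_1_r by lra.
  eapply Rle_lt_trans; [apply Cmod_le_abs|].
  pose proof (re_le_Cmod w) as Bx. pose proof (im_le_Cmod w) as By.
  destruct w as [x y]. unfold Cexp, Cminus, Cplus, Copp, RtoC in *. simpl in *.
  specialize (H1 x ltac:(lra)). specialize (H2 y ltac:(lra)). specialize (H3 y ltac:(lra)).
  set (W := Cmod (x, y)) in *.
  assert (E1 : Rabs (exp x - 1) <= 2 * W).
  { replace (exp x - 1) with ((exp x - 1 - 1 * x) + x) by ring.
    eapply Rle_trans; [apply Rabs_triang|]. pose proof (Rabs_pos x). nra. }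
  assert (E2 : exp x <= 2).
  { assert (exp x - 1 <= 2 * W) by (eapply Rle_trans; [apply Rle_abs|exact E1]). lra. }
  pose proof (exp_pos x) as E3.
  assert (F1 : Rabs (exp x * cos y + -(1) + - x) <= 3 * k * W).
  { replace (exp x * cos y + -(1) + - x) with (exp x * (cos y - 1 - 0 * y) + (exp x - 1 - 1 * x)) by ring.
    eapply Rle_trans; [apply Rabs_triang|]. rewrite Rabs_mult, (Rabs_pos_eq (exp x)) by lra.
    pose proof (Rabs_pos (cos y - 1 - 0 * y)). pose proof (Rabs_pos x). pose proof (Rabs_pos y).
    assert (exp x * Rabs (cos y - 1 - 0 * y) <= 2 * (k * W)).
    { apply Rmult_le_compat; try lra. eapply Rle_trans; [exact H2|]. apply Rmult_le_compat_l; lra. }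
    assert (k * Rabs x <= k * W) by (apply Rmult_le_compat_l; lra). lra. }
  assert (F2 : Rabs (exp x * sin y + - 0 + - y) <= 3 * k * W).
  { replace (exp x * sin y + - 0 + - y) with ((exp x - 1) * sin y + (sin y - 0 - 1 * y)) by ring.
    eapply Rle_trans; [apply Rabs_triang|]. rewrite Rabs_mult.
    assert (S : Rabs (sin y) <= 2 * W).
    { replace (sin y) with ((sin y - 0 - 1 * y) + y) by ring.
      eapply Rle_trans; [apply Rabs_triang|]. pose proof (Rabs_pos y). nra. }
    assert (Rabs (exp x - 1) * Rabs (sin y) <= (2 * W) * (2 * W)).
    { apply Rmult_le_compat; auto using Rabs_pos. }
    assert ((2 * W) * (2 * W) <= 2 * k * W) by nra.
    assert (k * Rabs y <= k * W) by (apply Rmult_le_compat_l; lra). lra. }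
  nra.
Qed.

Lemma cderiv_Cexp (z : C) : cderiv Cexp z (Cexp z).
Proof.
  assert (L : clim (fun w => Cexp z * ((Cexp (w - z) - Cexp (z - z)) / (w - z)))%C z
    (Cexp z * (1 * (1 - 0)))%C).
  2: replace (Cexp z * (1 * (1 - 0)))%C with (Cexp z) in L by ring;
    apply clim_ext with (2 := L).
  - apply clim_mult; [apply clim_const|].
    refine (cderiv_comp (fun w => w - z)%C Cexp z (1 - 0) 1 _ _).
    + apply cderiv_minus; [apply cderiv_id|apply cderiv_const].
    + replace (z - z)%C with (RtoC 0) by ring. apply cderiv_Cexp_0.
  - intros w Hw. replace (Cexp w) with (Cexp z * Cexp (w - z))%C by
      (rewrite <- Cexp_plus; f_equal; ring).
    replace (z - z)%C with (RtoC 0) by ring. rewrite Cexp_0. field. now apply Cminus_neq_0.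
Qed.

(** * Functions differentiable n times on a disc *)

(** Counting derivatives makes stability under sums, products, quotients and [Cexp] an induction on
    [n]. Higher differentiability is thus carried along, never derived: every function of the proof
    is built by operations that preserve it. *)
Fixpoint holo (n : nat) (rad : R) (f : C -> C) : Prop :=
  match n with
  | O => forall z, Cmod z < rad -> ccont f z
  | S n => exists f', (forall z, Cmod z < rad -> cderiv f z (f' z)) /\ holo n rad f'
  end.

Lemma disc_open (rad : R) (z w : C) : Cmod (w - z) < rad - Cmod z -> Cmod w < rad.
Proof. intros H. pose proof (Cmod_bound_near w z). lra. Qed.

Lemma holo_ext (n : nat) (rad : R) (f g : C -> C) :
  (forall z, Cmod z < rad -> f z = g z) -> holo n rad f -> holo n rad g.
Proof.
  intros H. destruct n; simpl.
  - intros Hf z Hz. apply (ccont_ext_loc f g z (rad - Cmod z)); auto; [lra|].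
    intros w Hw. apply H. now apply (disc_open rad z).
  - intros [f' [Hf Hf']]. exists f'. split; auto. intros z Hz.
    apply (cderiv_ext_loc f g z _ (rad - Cmod z)); auto; [lra|].
    intros w Hw. apply H. now apply (disc_open rad z).
Qed.

Lemma holo_S (n : nat) (rad : R) (f : C -> C) : holo (S n) rad f -> holo n rad f.
Proof.
  revert f. induction n; intros f [f' [Hf Hf']].
  - intros z Hz. eapply cderiv_cont; eauto.
  - exists f'. split; auto.
Qed.

Lemma holo_mono (n : nat) (r rad : R) (f : C -> C) : r <= rad -> holo n rad f -> holo n r f.
Proof.
  intros Hr. revert f. induction n; intros f; simpl.
  - intros H z Hz. apply H. lra.
  - intros [f' [H1 H2]]. exists f'. split; auto. intros z Hz. apply H1. lra.
Qed.

Lemma holo_const (n : nat) (rad : R) (c : C) : holo n rad (fun _ => c).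
Proof.
  revert c. induction n; intros c.
  - intros z _. apply clim_const.
  - exists (fun _ => RtoC 0). split; auto. intros z _. apply cderiv_const.
Qed.

Lemma holo_id (n : nat) (rad : R) : holo n rad (fun z => z).
Proof.
  destruct n.
  - intros z _. apply clim_id.
  - exists (fun _ => RtoC 1). split; [intros z _; apply cderiv_id|apply holo_const].
Qed.

Lemma holo_plus (n : nat) (rad : R) (f g : C -> C) :
  holo n rad f -> holo n rad g -> holo n rad (fun z => f z + g z)%C.
Proof.
  revert f g. induction n; intros f g.
  - intros Hf Hg z Hz. apply clim_plus; [now apply Hf|now apply Hg].
  - intros [f' [Hf Hf']] [g' [Hg Hg']]. exists (fun z => f' z + g' z)%C. split; auto.
    intros z Hz. apply cderiv_plus; auto.
Qed.

Lemma holo_mult (n : nat) (rad : R) (f g : C -> C) :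
  holo n rad f -> holo n rad g -> holo n rad (fun z => f z * g z)%C.
Proof.
  revert f g. induction n; intros f g.
  - intros Hf Hg z Hz. apply clim_mult; [now apply Hf|now apply Hg].
  - intros Hf0 Hg0. pose proof (holo_S _ _ _ Hf0) as Hf1. pose proof (holo_S _ _ _ Hg0) as Hg1.
    destruct Hf0 as [f' [Hf Hf']], Hg0 as [g' [Hg Hg']].
    exists (fun z => f' z * g z + f z * g' z)%C. split.
    + intros z Hz. apply cderiv_mult; auto.
    + apply holo_plus; auto.
Qed.

Lemma holo_opp (n : nat) (rad : R) (f : C -> C) : holo n rad f -> holo n rad (fun z => - f z)%C.
Proof.
  intros H. apply holo_ext with (fun z => (-1) * f z)%C; [intros; ring|].
  apply holo_mult; auto. apply holo_const.
Qed.

Lemma holo_minus (n : nat) (rad : R) (f g : C -> C) :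
  holo n rad f -> holo n rad g -> holo n rad (fun z => f z - g z)%C.
Proof. intros Hf Hg. apply holo_plus; auto. now apply holo_opp. Qed.

Lemma holo_inv (n : nat) (rad : R) (f : C -> C) :
  (forall z, Cmod z < rad -> f z <> 0%C) -> holo n rad f -> holo n rad (fun z => / f z)%C.
Proof.
  intros H0. induction n.
  - intros Hf z Hz. apply clim_inv; auto. now apply Hf.
  - intros Hf0. pose proof (holo_S _ _ _ Hf0) as Hf1. destruct Hf0 as [f' [Hf Hf']].
    exists (fun z => - f' z * (/ f z * / f z))%C. split.
    + intros z Hz. apply cderiv_inv; auto.
    + apply holo_mult; [now apply holo_opp|]. apply holo_mult; auto.
Qed.

Lemma holo_div (n : nat) (rad : R) (f g : C -> C) :
  (forall z, Cmod z < rad -> g z <> 0%C) ->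
  holo n rad f -> holo n rad g -> holo n rad (fun z => f z / g z)%C.
Proof. intros H0 Hf Hg. apply holo_mult; auto. now apply holo_inv. Qed.

Lemma holo_Cexp (n : nat) (rad : R) (f : C -> C) : holo n rad f -> holo n rad (fun z => Cexp (f z)).
Proof.
  revert f. induction n; intros f.
  - intros Hf z Hz. apply (clim_comp f Cexp); [now apply Hf|]. eapply cderiv_cont, cderiv_Cexp.
  - intros Hf0. pose proof (holo_S _ _ _ Hf0) as Hf1. destruct Hf0 as [f' [Hf Hf']].
    exists (fun z => Cexp (f z) * f' z)%C. split.
    + intros z Hz. apply (cderiv_comp f Cexp); auto. apply cderiv_Cexp.
    + apply holo_mult; auto.
Qed.

Definition smooth (rad : R) (f : C -> C) : Prop := forall n, holo n rad f.

(** The derivatives supplied by the various orders [n] agree on the disc by uniqueness, so a single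
    [f'] serves for all of them. *)
Lemma smooth_deriv (rad : R) (f : C -> C) : smooth rad f ->
  exists f', (forall z, Cmod z < rad -> cderiv f z (f' z)) /\ smooth rad f'.
Proof.
  intros H. destruct (H 1%nat) as [f' [Hf _]]. exists f'. split; auto. intros n.
  destruct (H (S n)) as [g [Hg Hg']]. apply (holo_ext _ _ g); auto.
  intros z Hz. apply (cderiv_unique f z); auto.
Qed.

(** * Passage to real derivatives along lines, and the mean value inequality *)

Lemma Re_plus (a b : C) : Re (a + b)%C = Re a + Re b.
Proof. reflexivity. Qed.

Lemma Re_minus (a b : C) : Re (a - b)%C = Re a - Re b.
Proof. reflexivity. Qed.

Lemma Re_scal (h : R) (a : C) : Re (RtoC h * a)%C = h * Re a.
Proof. destruct a. unfold RtoC, Cmult; simpl. ring. Qed.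

(** The bridge to real analysis: through it the real mean value theorem, integrals and second
    derivatives become available for complex functions. *)
Lemma Re_deriv_line (f : C -> C) (a e l : C) (s : R) :
  cderiv f (a + RtoC s * e)%C l ->
  is_derive (fun u : R => Re (f (a + RtoC u * e)%C)) s (Re (l * e)%C).
Proof.
  intros H. apply is_derive_Reals. intros eps Heps.
  destruct (Ceq_dec e 0) as [E|E].
  - exists (mkposreal 1 Rlt_0_1). intros h Hh _. subst e.
    replace (a + RtoC (s + h) * 0)%C with (a + RtoC s * 0)%C by ring.
    replace (l * 0)%C with (RtoC 0) by ring. simpl.
    replace ((Re (f (a + RtoC s * 0)%C) - Re (f (a + RtoC s * 0)%C)) / h - 0) with 0 by (field; auto).
    now rewrite Rabs_R0.
  - assert (Pe : 0 < Cmod e) by now apply Cmod_gt_0.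
    destruct (H (eps / Cmod e)) as [d [Pd Hd]]; [now apply Rdiv_lt_0_compat|].
    assert (Pd' : 0 < d / Cmod e) by now apply Rdiv_lt_0_compat.
    exists (mkposreal _ Pd'). intros h Hh Hhd. simpl in Hhd.
    set (z := (a + RtoC s * e)%C) in *.
    replace (a + RtoC (s + h) * e)%C with (z + RtoC h * e)%C
      by (unfold z; rewrite RtoC_plus; ring).
    assert (Hh' : RtoC h <> 0%C) by (intros F; apply RtoC_inj in F; contradiction).
    assert (Ew : (z + RtoC h * e - z)%C = (RtoC h * e)%C) by ring.
    specialize (Hd (z + RtoC h * e)%C).
    assert (A1 : (z + RtoC h * e)%C <> z).
    { intros F. rewrite F in Ew. replace (z - z)%C with (RtoC 0) in Ew by ring.
      symmetry in Ew. now apply (Cmult_neq_0 _ _ Hh' E). }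
    assert (A2 : Cmod (z + RtoC h * e - z)%C < d).
    { rewrite Ew, Cmod_mult, Cmod_R. apply Rmult_lt_reg_r with (/ Cmod e); [now apply Rinv_0_lt_compat|].
      rewrite Rmult_assoc, Rinv_r, Rmult_1_r by lra. exact Hhd. }
    specialize (Hd A1 A2). rewrite Ew in Hd.
    replace ((Re (f (z + RtoC h * e)%C) - Re (f z)) / h - Re (l * e)%C)
      with (Re (((f (z + RtoC h * e) - f z) / (RtoC h * e) - l) * e)%C).
    + eapply Rle_lt_trans; [apply re_le_Cmod|]. rewrite Cmod_mult.
      apply Rmult_lt_reg_r with (/ Cmod e); [now apply Rinv_0_lt_compat|].
      rewrite Rmult_assoc, Rinv_r, Rmult_1_r by lra. exact Hd.
    + replace (((f (z + RtoC h * e) - f z) / (RtoC h * e) - l) * e)%C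
        with (RtoC (/ h) * (f (z + RtoC h * e) - f z) - l * e)%C.
      * rewrite Re_minus, Re_scal, Re_minus. field. auto.
      * rewrite RtoC_inv by exact Hh. field. split; auto.
Qed.

(** The real mean value theorem is applied along the segment to the real part of [Cconj D * f],
    where [D = f b - f a]: its increment is [Cmod D ^ 2], and one factor [Cmod D] cancels. *)
Lemma complex_mvt (f f' : C -> C) (a b : C) (M : R) :
  (forall s, 0 <= s <= 1 -> cderiv f (a + RtoC s * (b - a))%C (f' (a + RtoC s * (b - a))%C)) ->
  (forall s, 0 <= s <= 1 -> Cmod (f' (a + RtoC s * (b - a))%C) <= M) ->
  Cmod (f b - f a)%C <= M * Cmod (b - a)%C.
Proof.
  intros Hf HM. set (D := (f b - f a)%C).
  destruct (Ceq_dec D 0) as [E|E].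
  { rewrite E, Cmod_0. apply Rmult_le_pos; [|apply Cmod_ge_0].
    eapply Rle_trans; [apply Cmod_ge_0|apply (HM 0); lra]. }
  assert (PD : 0 < Cmod D) by now apply Cmod_gt_0.
  destruct (MVT_cor2 (fun s => Re (Cconj D * f (a + RtoC s * (b - a)))%C)
    (fun s => Re (Cconj D * f' (a + RtoC s * (b - a)) * (b - a))%C) 0 1) as [c [Hc Hc1]]; [lra| |].
  { intros c Hc. apply is_derive_Reals.
    apply (Re_deriv_line (fun w => Cconj D * f w)%C). apply cderiv_scal. now apply Hf. }
  replace (a + RtoC 1 * (b - a))%C with b in Hc by ring.
  replace (a + RtoC 0 * (b - a))%C with a in Hc by ring.
  rewrite <- Re_minus in Hc. rewrite Rminus_0_r, Rmult_1_r in Hc.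
  replace (Cconj D * f b - Cconj D * f a)%C with (D * Cconj D)%C in Hc by (unfold D; ring).
  rewrite <- Cmod2_conj in Hc. change (Re (RtoC (Cmod D ^ 2))) with (Cmod D ^ 2) in Hc.
  pose proof (re_le_Cmod (Cconj D * f' (a + RtoC c * (b - a)) * (b - a))%C) as B.
  rewrite !Cmod_mult, Cmod_conj in B.
  pose proof (Rle_abs (Re (Cconj D * f' (a + RtoC c * (b - a)) * (b - a))%C)) as B'.
  specialize (HM c ltac:(lra)).
  apply Rmult_le_reg_l with (Cmod D); auto.
  apply Rle_trans with (Cmod D * Cmod (f' (a + RtoC c * (b - a))%C) * Cmod (b - a)%C).
  - replace (Cmod D * Cmod D) with (Cmod D ^ 2) by ring. lra.
  - rewrite Rmult_assoc. apply Rmult_le_compat_l; [lra|].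
    apply Rmult_le_compat_r; [apply Cmod_ge_0|]. exact HM.
Qed.

Lemma Cmod_segment_lt (a b : C) (s r : R) : 0 <= s <= 1 -> Cmod a < r -> Cmod b < r ->
  Cmod (a + RtoC s * (b - a))%C < r.
Proof.
  intros Hs Ha Hb. replace (a + RtoC s * (b - a))%C with (RtoC (1 - s) * a + RtoC s * b)%C
    by (rewrite RtoC_minus; ring).
  eapply Rle_lt_trans; [apply Cmod_triangle|]. rewrite !Cmod_mult, !Cmod_R, !Rabs_pos_eq by lra.
  destruct (Req_dec s 0) as [->|N]; [lra|].
  assert ((1 - s) * Cmod a <= (1 - s) * r) by (apply Rmult_le_compat_l; lra).
  assert (s * Cmod b < s * r) by (apply Rmult_lt_compat_l; lra). lra.
Qed.

Lemma Cmod_scal_le (s : R) (z : C) : 0 <= s <= 1 -> Cmod (RtoC s * z)%C <= Cmod z.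
Proof.
  intros H. rewrite Cmod_mult, Cmod_R, Rabs_pos_eq by lra.
  pose proof (Cmod_ge_0 z). nra.
Qed.

Lemma complex_mvt_0 (rad M : R) (f f' : C -> C) (z : C) : Cmod z < rad ->
  (forall w, Cmod w < rad -> cderiv f w (f' w)) ->
  (forall s, 0 <= s <= 1 -> Cmod (f' (RtoC s * z)%C) <= M) ->
  Cmod (f z - f 0)%C <= M * Cmod z.
Proof.
  intros Hz Df HM.
  assert (E : forall s, (0 + RtoC s * (z - 0) = RtoC s * z)%C) by (intros; ring).
  replace (Cmod z) with (Cmod (z - 0)) by (f_equal; ring).
  apply complex_mvt with f'; intros s Hs; rewrite E; auto.
  apply Df. eapply Rle_lt_trans; [now apply Cmod_scal_le|auto].
Qed.

Lemma cderiv_0_const (rad : R) (f : C -> C) :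
  (forall z, Cmod z < rad -> cderiv f z 0%C) -> forall z, Cmod z < rad -> f z = f 0%C.
Proof.
  intros H z Hz. apply Cminus_eq_0, Cmod_eq_0. apply Rle_antisym; [|apply Cmod_ge_0].
  apply Rle_trans with (0 * Cmod z); [|lra].
  apply (complex_mvt_0 rad) with (fun _ => RtoC 0); auto. intros. rewrite Cmod_0. lra.
Qed.

(** * Primitives and logarithms on a disc *)

Lemma ccont_Re (w : C) : ccont (fun w => RtoC (Re w)) w.
Proof.
  intros e He. exists e. split; auto. intros v _ Hv. rewrite <- RtoC_minus, Cmod_R.
  eapply Rle_lt_trans; [apply (re_le_Cmod (v - w)%C)|auto].
Qed.

Lemma ccont_Im (w : C) : ccont (fun w => RtoC (Im w)) w.
Proof.
  intros e He. exists e. split; auto. intros v _ Hv. rewrite <- RtoC_minus, Cmod_R.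
  eapply Rle_lt_trans; [apply (im_le_Cmod (v - w)%C)|auto].
Qed.

Lemma continuity_2d_of_ccont (g : C -> C) (x y : R) :
  ccont g (x, y) -> continuity_2d_pt (fun u v => Re (g (u, v))) x y.
Proof.
  intros H e. destruct (ccont_all _ _ H e) as [d [P Q]]; [apply cond_pos|].
  assert (P2 : 0 < d / 2) by lra. exists (mkposreal _ P2). simpl. intros u v Hu Hv.
  rewrite <- Re_minus. eapply Rle_lt_trans; [apply re_le_Cmod|]. apply Q.
  eapply Rle_lt_trans; [apply Cmod_le_abs|]. simpl.
  change (Rabs (u - x) + Rabs (v - y) < d). lra.
Qed.

Section Primitive.

Variables (rad : R) (f f' : C -> C).
Hypothesis f_deriv : forall z, Cmod z < rad -> cderiv f z (f' z).
Hypothesis f'_cont : forall z, Cmod z < rad -> ccont f' z.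

(** For [a = 1] and [a = - Ci] this is the real, respectively imaginary, part of the integral of [f]
    along the ray from 0 to [p]; the factor [a] lets one real integral serve for both. *)
Definition ray_integral (a p : C) : R := RInt (fun s => Re (a * p * f (RtoC s * p))%C) 0 1.

Lemma deriv_radial (a p : C) (s : R) : Cmod (RtoC s * p)%C < rad ->
  is_derive (fun s => Re (a * f (RtoC s * p))%C) s (Re (a * f' (RtoC s * p) * p)%C).
Proof.
  intros H.
  apply is_derive_ext with (fun s => Re ((fun w => a * f w) (0 + RtoC s * p)))%C.
  { intros t. cbv beta. do 3 f_equal. ring. }
  replace (RtoC s * p)%C with (0 + RtoC s * p)%C in * by ring.
  apply (Re_deriv_line (fun w => a * f w)%C).
  apply cderiv_scal. auto.
Qed.

Lemma ray_integrable (a p : C) : Cmod p < rad ->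
  ex_RInt (fun s => Re (a * p * f (RtoC s * p))%C) 0 1.
Proof.
  intros Hp. apply (ex_RInt_continuous (V := R_CompleteNormedModule)). intros s Hs.
  rewrite Rmin_left, Rmax_right in Hs by lra.
  apply (ex_derive_continuous (V := R_NormedModule) (fun s => Re (a * p * f (RtoC s * p))%C)).
  eexists. apply deriv_radial.
  eapply Rle_lt_trans; [now apply Cmod_scal_le|auto].
Qed.

(** Differentiation under the integral sign gives the integrand [K t s]. Since [f] has a complex
    derivative, [K t s] is also the derivative in [s] of the real part of [a * e * s * f (s * P t)],
    so the integral is the difference of the values at [s = 1] and [s = 0], and the latter is 0. *)
Lemma ray_integral_deriv (a p e : C) (t : R) : Cmod (p + RtoC t * e)%C < rad ->
  is_derive (fun u => ray_integral a (p + RtoC u * e)%C) t (Re (a * e * f (p + RtoC t * e))%C).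
Proof.
  intros Ht.
  set (P := fun u : R => (p + RtoC u * e)%C).
  set (K := fun u s : R => Re (a * e * f (RtoC s * P u) + a * P u * (f' (RtoC s * P u) * (RtoC s * e)))%C).
  assert (Pnear : locally t (fun u => Cmod (P u) < rad)).
  { assert (Q : 0 < (rad - Cmod (P t)) / (1 + Cmod e)).
    { apply Rdiv_lt_0_compat; [unfold P; lra|]. pose proof (Cmod_ge_0 e). lra. }
    exists (mkposreal _ Q). intros u Hu. change (Rabs (u - t) < (rad - Cmod (P t)) / (1 + Cmod e)) in Hu.
    apply disc_open with (P t).
    replace (P u - P t)%C with (RtoC (u - t) * e)%C by (unfold P; rewrite RtoC_minus; ring).
    rewrite Cmod_mult, Cmod_R. pose proof (Cmod_ge_0 e).
    apply Rle_lt_trans with (Rabs (u - t) * (1 + Cmod e)).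
    - apply Rmult_le_compat_l; [apply Rabs_pos|lra].
    - apply Rmult_lt_reg_r with (/ (1 + Cmod e)); [apply Rinv_0_lt_compat; lra|].
      rewrite Rmult_assoc, Rinv_r, Rmult_1_r by lra. exact Hu. }
  assert (Gd : forall u s, Cmod (RtoC s * P u)%C < rad ->
    is_derive (fun u => Re (a * P u * f (RtoC s * P u))%C) u (K u s)).
  { intros u s Hs.
    apply is_derive_ext with (fun u => Re ((fun w => a * w * f (RtoC s * w)) (p + RtoC u * e))%C).
    { reflexivity. }
    unfold K.
    replace (a * e * f (RtoC s * P u) + a * P u * (f' (RtoC s * P u) * (RtoC s * e)))%C
      with ((a * 1 * f (RtoC s * P u) + a * P u * (f' (RtoC s * P u) * (RtoC s * 1))) * e)%C by ring.
    apply (Re_deriv_line (fun w => a * w * f (RtoC s * w))%C).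
    apply (cderiv_mult (fun w => a * w)%C (fun w => f (RtoC s * w))%C).
    - apply (cderiv_scal a (fun w => w)), cderiv_id.
    - apply (cderiv_comp (fun w => RtoC s * w)%C f); [|now apply f_deriv].
      apply (cderiv_scal _ (fun w => w)), cderiv_id. }
  assert (Kcont : forall u s, Cmod (RtoC s * P u)%C < rad -> ccont (fun w =>
     a * e * f (RtoC (Im w) * P (Re w)) + a * P (Re w) * (f' (RtoC (Im w) * P (Re w)) * (RtoC (Im w) * e)))%C (u, s)).
  { intros u s Hs.
    assert (CP : ccont (fun w => P (Re w)) (u, s)).
    { apply clim_plus; [apply clim_const|]. apply clim_mult; [apply ccont_Re|apply clim_const]. }
    assert (CQ : ccont (fun w => RtoC (Im w) * P (Re w))%C (u, s)).
    { apply clim_mult; [apply ccont_Im|exact CP]. }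
    apply clim_plus.
    - apply clim_mult; [apply clim_const|]. apply (clim_comp _ f _ _ CQ).
      eapply cderiv_cont. now apply f_deriv.
    - apply clim_mult.
      + apply clim_mult; [apply clim_const|exact CP].
      + apply clim_mult.
        * apply (clim_comp _ f' _ _ CQ). now apply f'_cont.
        * apply clim_mult; [apply ccont_Im|apply clim_const]. }
  replace (Re (a * e * f (p + RtoC t * e))%C)
    with (RInt (fun s => Derive (fun u => Re (a * P u * f (RtoC s * P u))%C) t) 0 1).
  - apply (is_derive_RInt_param (fun u s => Re (a * P u * f (RtoC s * P u))%C)).
    + apply filter_imp with (2 := Pnear). intros u Hu s Hs.
      rewrite Rmin_left, Rmax_right in Hs by lra.
      eexists. apply Gd. eapply Rle_lt_trans; [now apply Cmod_scal_le|auto].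
    + intros s Hs. rewrite Rmin_left, Rmax_right in Hs by lra.
      assert (Hst : Cmod (RtoC s * P t)%C < rad).
      { eapply Rle_lt_trans; [now apply Cmod_scal_le|exact Ht]. }
      apply continuity_2d_pt_ext_loc with (fun u s => K u s).
      * assert (CQ : ccont (fun w => RtoC (Im w) * P (Re w))%C (t, s)).
        { apply clim_mult; [apply ccont_Im|]. apply clim_plus; [apply clim_const|].
          apply clim_mult; [apply ccont_Re|apply clim_const]. }
        destruct (ccont_all _ _ CQ (rad - Cmod (RtoC s * P t))) as [d [Pd Hd]]; [lra|].
        assert (P2 : 0 < d / 2) by lra. exists (mkposreal _ P2). simpl. intros u v Hu Hv.
        symmetry. apply is_derive_unique. apply Gd. apply disc_open with (RtoC s * P t)%C.
        apply (Hd (u, v)).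
        eapply Rle_lt_trans; [apply Cmod_le_abs|]. simpl.
        change (Rabs (u - t) + Rabs (v - s) < d). lra.
      * apply (continuity_2d_of_ccont _ _ _ (Kcont t s Hst)).
    + apply filter_imp with (2 := Pnear). intros u Hu. now apply ray_integrable.
  - transitivity (RInt (fun s => K t s) 0 1).
    + apply RInt_ext. intros s Hs. rewrite Rmin_left, Rmax_right in Hs by lra.
      apply is_derive_unique. apply Gd. eapply Rle_lt_trans; [apply Cmod_scal_le; lra|exact Ht].
    + apply is_RInt_unique.
      replace (Re (a * e * f (p + RtoC t * e))%C)
        with (minus (Re (a * e * RtoC 1 * f (RtoC 1 * P t))%C) (Re (a * e * RtoC 0 * f (RtoC 0 * P t))%C)).
      2:{ unfold minus, plus, opp; simpl. replace (RtoC 1 * P t)%C with (P t) by ring.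
          replace (a * e * RtoC 0 * f (RtoC 0 * P t))%C with (RtoC 0) by ring.
          replace (a * e * RtoC 1 * f (P t))%C with (a * e * f (P t))%C by ring.
          simpl. unfold P. ring. }
      apply (is_RInt_derive (V := R_CompleteNormedModule) (fun s => Re (a * e * RtoC s * f (RtoC s * P t))%C)).
      * intros s Hs. rewrite Rmin_left, Rmax_right in Hs by lra.
        assert (Hst : Cmod (RtoC s * P t)%C < rad).
        { eapply Rle_lt_trans; [now apply Cmod_scal_le|exact Ht]. }
        apply is_derive_ext with (fun u => Re ((fun w => a * e * w * f (w * P t)) (0 + RtoC u * 1))%C).
        { intros u. cbv beta. replace (0 + RtoC u * 1)%C with (RtoC u) by ring. reflexivity. }
        unfold K.
        replace (a * e * f (RtoC s * P t) + a * P t * (f' (RtoC s * P t) * (RtoC s * e)))%C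
          with ((a * e * 1 * f (RtoC s * P t) + a * e * RtoC s * (f' (RtoC s * P t) * (1 * P t + RtoC s * 0))) * 1)%C
          by ring.
        apply (Re_deriv_line (fun w => a * e * w * f (w * P t))%C).
        replace (0 + RtoC s * 1)%C with (RtoC s) by ring.
        apply (cderiv_mult (fun w => a * e * w)%C (fun w => f (w * P t))%C).
        -- apply (cderiv_scal (a * e) (fun w => w)), cderiv_id.
        -- apply (cderiv_comp (fun w => w * P t)%C f); [|now apply f_deriv].
           apply (cderiv_mult (fun w => w) (fun _ => P t)); [apply cderiv_id|apply cderiv_const].
      * intros s Hs. rewrite Rmin_left, Rmax_right in Hs by lra.
        assert (Hst : Cmod (RtoC s * P t)%C < rad).
        { eapply Rle_lt_trans; [now apply Cmod_scal_le|exact Ht]. }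
        pose proof (continuity_2d_of_ccont _ _ _ (Kcont t s Hst)) as C2.
        apply continuity_pt_filterlim. intros eps Heps.
        destruct (C2 (mkposreal _ Heps)) as [d Hd].
        exists d. split; [apply cond_pos|]. intros v [_ Hv].
        apply (Hd t v); auto. replace (t - t) with 0 by ring. rewrite Rabs_R0. apply cond_pos.
Qed.

Definition primitive (z : C) : C := (ray_integral 1 z, ray_integral (- Ci) z).

Lemma ray_integral_0 (a : C) : ray_integral a 0 = 0.
Proof.
  unfold ray_integral. transitivity (RInt (fun _ => 0) 0 1).
  - apply RInt_ext. intros s _.
    replace (a * 0 * f (RtoC s * 0))%C with (RtoC 0) by ring. reflexivity.
  - rewrite RInt_const. unfold scal; simpl; unfold mult; simpl. ring.
Qed.

Lemma primitive_0 : primitive 0 = 0%C.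
Proof. unfold primitive. now rewrite !ray_integral_0. Qed.

(** On the segment from [z] to [w] the mean value theorem, applied to each component, replaces the
    increment of the primitive by a value of [f] near [f z]; the two components cost [eps / 3]
    each. *)
Lemma primitive_deriv (z : C) : Cmod z < rad -> cderiv primitive z (f z).
Proof.
  intros Hz eps Heps.
  destruct (ccont_all f z (cderiv_cont _ _ _ (f_deriv z Hz)) (eps / 3)) as [d [Pd Hd]]; [lra|].
  exists (Rmin d (rad - Cmod z)). split; [apply Rmin_pos; lra|]. intros w Hw Hwd.
  assert (W1 : Cmod (w - z) < d) by (Rmin_bounds; lra).
  assert (W2 : Cmod (w - z) < rad - Cmod z) by (Rmin_bounds; lra).
  assert (Pw : 0 < Cmod (w - z)) by (apply Cmod_gt_0; now apply Cminus_neq_0).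
  assert (Est : forall a, Cmod a = 1 -> Rabs (ray_integral a w - ray_integral a z - Re (a * f z * (w - z))%C)
     <= eps / 3 * Cmod (w - z)).
  { intros a Ha.
    destruct (MVT_cor2 (fun t => ray_integral a (z + RtoC t * (w - z))%C)
      (fun t => Re (a * (w - z) * f (z + RtoC t * (w - z)))%C) 0 1) as [c [Hc Hc1]]; [lra| |].
    { intros c Hc. apply is_derive_Reals. apply ray_integral_deriv.
      apply Cmod_segment_lt; auto. now apply disc_open with z. }
    replace (z + RtoC 1 * (w - z))%C with w in Hc by ring.
    replace (z + RtoC 0 * (w - z))%C with z in Hc by ring.
    rewrite Hc, Rminus_0_r, Rmult_1_r, <- Re_minus.
    replace (a * (w - z) * f (z + RtoC c * (w - z)) - a * f z * (w - z))%C
      with (a * (f (z + RtoC c * (w - z)) - f z) * (w - z))%C by ring.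
    eapply Rle_trans; [apply re_le_Cmod|]. rewrite !Cmod_mult, Ha, Rmult_1_l.
    apply Rmult_le_compat_r; [lra|]. left. apply Hd.
    replace (z + RtoC c * (w - z) - z)%C with (RtoC c * (w - z))%C by ring.
    eapply Rle_lt_trans; [apply Cmod_scal_le; lra|auto]. }
  replace ((primitive w - primitive z) / (w - z) - f z)%C
    with ((primitive w - primitive z - f z * (w - z)) / (w - z))%C by (field; now apply Cminus_neq_0).
  rewrite Cmod_div by now apply Cminus_neq_0.
  apply Rmult_lt_reg_r with (Cmod (w - z)); auto. unfold Rdiv.
  rewrite Rmult_assoc, Rinv_l, Rmult_1_r by lra.
  eapply Rle_lt_trans; [apply Cmod_le_abs|].
  pose proof (Est 1%C Cmod_1) as E1.
  assert (E2 := Est (- Ci)%C). rewrite Cmod_opp, Cmod_Ci in E2. specialize (E2 eq_refl).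
  replace (Re (primitive w - primitive z - f z * (w - z)))%C
    with (ray_integral 1 w - ray_integral 1 z - Re (1 * f z * (w - z))%C).
  2:{ replace (1 * f z * (w - z))%C with (f z * (w - z))%C by ring. reflexivity. }
  replace (Im (primitive w - primitive z - f z * (w - z)))%C
    with (ray_integral (- Ci) w - ray_integral (- Ci) z - Re (- Ci * f z * (w - z))%C).
  2:{ replace (Re (- Ci * f z * (w - z))%C) with (Im (f z * (w - z))%C).
      - reflexivity.
      - destruct (f z) as [x1 y1], w as [x2 y2], z as [x3 y3].
        unfold Ci, Cmult, Copp, Cminus, Cplus; simpl. ring. }
  nra.
Qed.

End Primitive.

(** [G] is a primitive of [u' / u], and [u * Cexp (- G)] has derivative zero. The prescribed value
    [g0] selects the branch, which is how a lift is made to start at a given point. *)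
Lemma log_exists (rad : R) (u : C -> C) (g0 : C) : 0 < rad ->
  smooth rad u -> (forall z, Cmod z < rad -> u z <> 0%C) -> Cexp g0 = u 0%C ->
  exists G, smooth rad G /\ G 0%C = g0 /\ forall z, Cmod z < rad -> Cexp (G z) = u z.
Proof.
  intros Hr Su Hu Hg.
  destruct (smooth_deriv _ _ Su) as [u' [Du Su']].
  set (f := fun z => (u' z / u z)%C).
  assert (Sf : smooth rad f) by (intros n; apply holo_div; auto).
  destruct (smooth_deriv _ _ Sf) as [f' [Df Sf']].
  pose proof (Sf' O) as Cf'. simpl in Cf'.
  set (G := fun z => (g0 + primitive f z)%C).
  assert (DG : forall z, Cmod z < rad -> cderiv G z (f z)).
  { intros z Hz. replace (f z) with (0 + f z)%C by ring.
    apply cderiv_plus; [apply cderiv_const|]. now apply (primitive_deriv rad f f'). }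
  exists G. split; [|split].
  - intros [|n].
    + intros z Hz. eapply cderiv_cont. now apply DG.
    + exists f. split; auto.
  - unfold G. rewrite primitive_0. ring.
  - intros z Hz.
    assert (E : (u z * Cexp (- G z))%C = (u 0 * Cexp (- G 0))%C).
    { apply (cderiv_0_const rad (fun z => u z * Cexp (- G z))%C); auto. intros w Hw.
      replace (RtoC 0) with (u' w * Cexp (- G w) + u w * (Cexp (- G w) * (- f w)))%C
        by (unfold f; field; auto).
      apply (cderiv_mult u (fun w => Cexp (- G w))); auto.
      apply (cderiv_comp (fun w => - G w)%C Cexp); [|apply cderiv_Cexp].
      apply cderiv_opp; auto. }
    replace (G 0)%C with g0 in E by (unfold G; rewrite primitive_0; ring).
    rewrite <- Hg, Cexp_opp_mult, Cexp_opp in E.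
    transitivity (Cexp (G z) * (u z * / Cexp (G z)))%C.
    + rewrite E. ring.
    + field. apply Cexp_neq_0.
Qed.

(** * Second derivatives and the maximum principle *)

Definition second_deriv (phi : R -> R) (v : R) : Prop :=
  exists d : R -> R, locally 0 (fun s => is_derive phi s (d s)) /\ is_derive d 0 v.

(** Only the restrictions to the horizontal and the vertical line through [z] enter; for the second
    derivative test at a maximum this is enough. *)
Definition has_laplacian (f : C -> R) (z : C) (L : R) : Prop :=
  exists v1 v2, second_deriv (fun s => f (z + RtoC s * 1)%C) v1 /\
    second_deriv (fun s => f (z + RtoC s * Ci)%C) v2 /\ L = v1 + v2.

Lemma second_deriv_plus (f g : R -> R) (a b : R) :
  second_deriv f a -> second_deriv g b -> second_deriv (fun s => f s + g s) (a + b).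
Proof.
  intros [d [H1 H2]] [d' [H1' H2']]. exists (fun s => d s + d' s). split.
  - apply filter_imp with (2 := filter_and _ _ H1 H1'). intros s [A B].
    apply (is_derive_plus (K := R_AbsRing) (V := R_NormedModule)); auto.
  - apply (is_derive_plus (K := R_AbsRing) (V := R_NormedModule)); auto.
Qed.

Lemma second_deriv_scal (f : R -> R) (k a : R) :
  second_deriv f a -> second_deriv (fun s => k * f s) (k * a).
Proof.
  intros [d [H1 H2]]. exists (fun s => k * d s). split.
  - apply filter_imp with (2 := H1). intros s A. now apply is_derive_scal.
  - now apply is_derive_scal.
Qed.

Lemma second_deriv_ext (f g : R -> R) (a d0 : R) : 0 < d0 ->
  (forall s, Rabs s < d0 -> f s = g s) -> second_deriv f a -> second_deriv g a.
Proof.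
  intros Hd H [d [H1 H2]]. exists d. split; auto.
  assert (N : locally 0 (fun s => locally s (fun u => f u = g u))).
  { apply locally_locally. exists (mkposreal _ Hd). intros s Hs. apply H.
    change (Rabs (s - 0) < d0) in Hs. now rewrite Rminus_0_r in Hs. }
  apply filter_imp with (2 := filter_and _ _ N H1). intros s [A B].
  eapply is_derive_ext_loc; eauto.
Qed.

Lemma has_laplacian_plus (f g : C -> R) (z : C) (a b : R) :
  has_laplacian f z a -> has_laplacian g z b -> has_laplacian (fun w => f w + g w) z (a + b).
Proof.
  intros [v1 [v2 [H1 [H2 E]]]] [u1 [u2 [F1 [F2 F]]]].
  exists (v1 + u1), (v2 + u2). split; [|split].
  - now apply (second_deriv_plus (fun s => f (z + RtoC s * 1)%C) (fun s => g (z + RtoC s * 1)%C)).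
  - now apply (second_deriv_plus (fun s => f (z + RtoC s * Ci)%C) (fun s => g (z + RtoC s * Ci)%C)).
  - lra.
Qed.

Lemma has_laplacian_scal (f : C -> R) (z : C) (k a : R) :
  has_laplacian f z a -> has_laplacian (fun w => k * f w) z (k * a).
Proof.
  intros [v1 [v2 [H1 [H2 E]]]]. exists (k * v1), (k * v2). split; [|split].
  - now apply (second_deriv_scal (fun s => f (z + RtoC s * 1)%C)).
  - now apply (second_deriv_scal (fun s => f (z + RtoC s * Ci)%C)).
  - rewrite E. ring.
Qed.

Lemma Cmod_line (z e : C) (s : R) : Cmod e = 1 -> Cmod (z + RtoC s * e - z)%C = Rabs s.
Proof.
  intros He. replace (z + RtoC s * e - z)%C with (RtoC s * e)%C by ring.
  rewrite Cmod_mult, Cmod_R, He. ring.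
Qed.

Lemma has_laplacian_ext (f g : C -> R) (z : C) (a d0 : R) : 0 < d0 ->
  (forall w, Cmod (w - z) < d0 -> f w = g w) -> has_laplacian f z a -> has_laplacian g z a.
Proof.
  intros Hd H [v1 [v2 [H1 [H2 E]]]]. exists v1, v2. split; [|split]; auto.
  - apply second_deriv_ext with (3 := H1) (d0 := d0); auto. intros s Hs. apply H.
    rewrite Cmod_line; auto using Cmod_1.
  - apply second_deriv_ext with (3 := H2) (d0 := d0); auto. intros s Hs. apply H.
    rewrite Cmod_line; auto using Cmod_Ci.
Qed.

(** If [v > 0], then [d], which vanishes at 0 by Fermat's rule, is positive just to the right of 0,
    and [phi] would rise above [phi 0] there. *)
Lemma second_deriv_max (phi : R -> R) (v d0 : R) : 0 < d0 ->
  (forall s, Rabs s < d0 -> phi s <= phi 0) -> second_deriv phi v -> v <= 0.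
Proof.
  intros Hd Hmax [d [H1 H2]]. apply Rnot_lt_le. intros Hv.
  destruct H1 as [d1 H1]. destruct (proj1 (is_derive_Reals _ _ _) H2 v Hv) as [d2 H2'].
  set (m := Rmin d0 (Rmin d1 d2) / 2).
  assert (P0 : 0 < Rmin d0 (Rmin d1 d2)) by (repeat apply Rmin_pos; auto using cond_pos).
  assert (Pm : 0 < m) by (unfold m; lra).
  assert (M0 : m < d0).
  { Rmin_bounds. unfold m; lra. }
  assert (M1 : m < d1).
  { Rmin_bounds. unfold m; lra. }
  assert (M2 : m < d2).
  { Rmin_bounds. unfold m; lra. }
  assert (Der : forall s, Rabs s <= m -> derivable_pt_lim phi s (d s)).
  { intros s Hs. apply is_derive_Reals. apply H1.
    change (Rabs (s - 0) < d1). rewrite Rminus_0_r. lra. }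
  assert (D0 : d 0 = 0).
  { assert (Hz := Der 0 ltac:(rewrite Rabs_R0; lra)).
    assert (pr : derivable_pt phi 0) by (exists (d 0); exact Hz).
    rewrite <- (derive_pt_eq_0 _ _ _ pr Hz).
    apply (deriv_maximum phi (- m) m); try lra.
    intros x Hx1 Hx2. apply Hmax. apply Rabs_def1; lra. }
  destruct (MVT_cor2 phi d 0 m Pm) as [c [Hc Hc1]].
  { intros c Hc. apply Der. rewrite Rabs_pos_eq; lra. }
  specialize (Hmax m ltac:(rewrite Rabs_pos_eq; lra)).
  assert (Hdc : 0 < d c).
  { specialize (H2' c ltac:(lra) ltac:(rewrite Rabs_pos_eq; lra)).
    rewrite Rplus_0_l, D0, Rminus_0_r in H2'. apply Rabs_def2 in H2'.
    assert (0 < d c / c) by lra. replace (d c) with (d c / c * c) by (field; lra).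
    apply Rmult_lt_0_compat; lra. }
  rewrite Rminus_0_r in Hc. assert (0 < d c * m) by (apply Rmult_lt_0_compat; lra). lra.
Qed.

Lemma has_laplacian_max (f : C -> R) (z : C) (L d0 : R) : 0 < d0 ->
  (forall w, Cmod (w - z) < d0 -> f w <= f z) -> has_laplacian f z L -> L <= 0.
Proof.
  intros Hd Hmax [v1 [v2 [H1 [H2 E]]]].
  assert (v1 <= 0).
  { apply second_deriv_max with (3 := H1) (d0 := d0); auto. intros s Hs.
    replace (z + RtoC 0 * 1)%C with z by ring. apply Hmax. rewrite Cmod_line; auto using Cmod_1. }
  assert (v2 <= 0).
  { apply second_deriv_max with (3 := H2) (d0 := d0); auto. intros s Hs.
    replace (z + RtoC 0 * Ci)%C with z by ring. apply Hmax. rewrite Cmod_line; auto using Cmod_Ci. }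
  lra.
Qed.

(** * Laplacians of logarithms of squared moduli *)

Definition sqmod (z : C) : R := Re z * Re z + Im z * Im z.

Lemma sqmod_Cmod (z : C) : sqmod z = Cmod z * Cmod z.
Proof. pose proof (Cmod2_alt z). unfold sqmod. simpl in H. lra. Qed.

Lemma sqmod_mult (a b : C) : sqmod (a * b)%C = sqmod a * sqmod b.
Proof. rewrite !sqmod_Cmod, Cmod_mult. ring. Qed.

Lemma sqmod_ge_0 (z : C) : 0 <= sqmod z.
Proof. unfold sqmod. nra. Qed.

Lemma sqmod_pos (z : C) : z <> 0%C -> 0 < sqmod z.
Proof. intros H. rewrite sqmod_Cmod. apply Cmod_gt_0 in H. nra. Qed.

Lemma ccont_sqmod (f : C -> C) (z : C) : ccont f z -> ccont (fun w => RtoC (sqmod (f w))) z.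
Proof.
  intros H. unfold sqmod.
  pose proof (clim_comp f _ z _ H (ccont_Re (f z))) as HR.
  pose proof (clim_comp f _ z _ H (ccont_Im (f z))) as HI.
  unfold ccont. rewrite RtoC_plus, !RtoC_mult.
  eapply clim_ext; [|apply clim_plus; apply clim_mult; [exact HR|exact HR|exact HI|exact HI]].
  intros w _. cbv beta. now rewrite RtoC_plus, !RtoC_mult.
Qed.

Lemma second_deriv_ln_quadratic (a s : R) (X Y X1 Y1 : R -> R) (X2 Y2 : R) :
  locally 0 (fun t => is_derive X t (X1 t)) -> is_derive X1 0 X2 ->
  locally 0 (fun t => is_derive Y t (Y1 t)) -> is_derive Y1 0 Y2 ->
  let W t := a + s * (X t * X t + Y t * Y t) in
  0 < W 0 ->
  second_deriv (fun t => ln (W t))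
    (2 * s * (X1 0 * X1 0 + X 0 * X2 + Y1 0 * Y1 0 + Y 0 * Y2) / W 0
     - (2 * s * (X 0 * X1 0 + Y 0 * Y1 0)) * (2 * s * (X 0 * X1 0 + Y 0 * Y1 0)) / (W 0 * W 0)).
Proof.
  intros HX HX1 HY HY1 W W0.
  pose proof (locally_singleton _ _ HX) as DX. pose proof (locally_singleton _ _ HY) as DY.
  assert (DW : locally 0 (fun t => is_derive W t (2 * s * (X t * X1 t + Y t * Y1 t)))).
  { apply filter_imp with (2 := filter_and _ _ HX HY). intros t [A B]. unfold W.
    auto_derive; [repeat split; eexists; eauto|].
    rewrite (is_derive_unique (fun x : R => X x) _ _ A), (is_derive_unique (fun x : R => Y x) _ _ B). ring. }
  exists (fun t => 2 * s * (X t * X1 t + Y t * Y1 t) / W t). split.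
  - assert (CW : continuous W 0).
    { apply (ex_derive_continuous (V := R_NormedModule)). eexists. exact (locally_singleton _ _ DW). }
    assert (NW : locally 0 (fun t => 0 < W t)).
    { apply CW. exists (mkposreal _ W0). intros y Hy.
      change (Rabs (y - W 0) < W 0) in Hy.
      apply Rabs_def2 in Hy. lra. }
    apply filter_imp with (2 := filter_and _ _ DW NW). intros t [A B].
    apply is_derive_ext with (fun t => ln (W t)); auto.
    replace (2 * s * (X t * X1 t + Y t * Y1 t) / W t) with (2 * s * (X t * X1 t + Y t * Y1 t) * / W t) by reflexivity.
    apply (is_derive_comp ln W); auto. apply is_derive_Reals. now apply derivable_pt_lim_ln.
  - pose proof (locally_singleton _ _ DW) as DW0.
    auto_derive.
    + repeat split; first [eexists; exact DX | eexists; exact HX1 | eexists; exact DY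
        | eexists; exact HY1 | eexists; exact DW0 | lra].
    + rewrite (is_derive_unique (fun x : R => X x) _ _ DX), (is_derive_unique (fun x : R => X1 x) _ _ HX1),
        (is_derive_unique (fun x : R => Y x) _ _ DY), (is_derive_unique (fun x : R => Y1 x) _ _ HY1),
        (is_derive_unique (fun x : R => W x) _ _ DW0). field. lra.
Qed.

Lemma Im_as_Re (z : C) : Im z = Re (- Ci * z)%C.
Proof. destruct z. simpl. ring. Qed.

Lemma Im_deriv_line (f : C -> C) (a e l : C) (s : R) :
  cderiv f (a + RtoC s * e)%C l ->
  is_derive (fun u : R => Im (f (a + RtoC u * e)%C)) s (Im (l * e)%C).
Proof.
  intros H. apply is_derive_ext with (fun t => Re (- Ci * f (a + RtoC t * e))%C).
  { intros. now rewrite Im_as_Re. }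
  rewrite Im_as_Re, Cmult_assoc. apply (Re_deriv_line (fun w => - Ci * f w)%C). now apply cderiv_scal.
Qed.

Lemma second_deriv_ln_sqmod (rad a s : R) (k k1 : C -> C) (z k2 e : C) :
  Cmod e = 1 -> Cmod z < rad ->
  (forall w, Cmod w < rad -> cderiv k w (k1 w)) -> cderiv k1 z k2 ->
  0 < a + s * sqmod (k z) ->
  let X1 := Re (k1 z * e)%C in let Y1 := Im (k1 z * e)%C in
  let X2 := Re (k2 * e * e)%C in let Y2 := Im (k2 * e * e)%C in
  let X := Re (k z) in let Y := Im (k z) in let W := a + s * sqmod (k z) in
  second_deriv (fun t => ln (a + s * sqmod (k (z + RtoC t * e)%C)))
    (2 * s * (X1 * X1 + X * X2 + Y1 * Y1 + Y * Y2) / W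
     - (2 * s * (X * X1 + Y * Y1)) * (2 * s * (X * X1 + Y * Y1)) / (W * W)).
Proof.
  intros He Hz Hk Hk1 HW. cbv zeta.
  assert (Near : locally 0 (fun t => Cmod (z + RtoC t * e)%C < rad)).
  { assert (P : 0 < rad - Cmod z) by lra. exists (mkposreal _ P). intros t Ht.
    change (Rabs (t - 0) < rad - Cmod z) in Ht. rewrite Rminus_0_r in Ht.
    apply disc_open with z. now rewrite Cmod_line. }
  assert (E0 : (z + RtoC 0 * e)%C = z) by ring.
  assert (D1 : cderiv (fun w => k1 w * e)%C z (k2 * e)%C).
  { apply cderiv_ext_loc with (fun w => e * k1 w)%C 1; [lra|intros; ring|].
    replace (k2 * e)%C with (e * k2)%C by ring. now apply cderiv_scal. }
  pose proof (second_deriv_ln_quadratic a s (fun t => Re (k (z + RtoC t * e)%C))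
    (fun t => Im (k (z + RtoC t * e)%C)) (fun t => Re (k1 (z + RtoC t * e) * e)%C)
    (fun t => Im (k1 (z + RtoC t * e) * e)%C) (Re (k2 * e * e)%C) (Im (k2 * e * e)%C)) as H.
  cbv zeta beta in H. rewrite E0 in H. apply H; auto.
  - apply filter_imp with (2 := Near). intros t Ht. apply Re_deriv_line. auto.
  - apply (Re_deriv_line (fun w => k1 w * e)%C). now rewrite E0.
  - apply filter_imp with (2 := Near). intros t Ht. apply Im_deriv_line. auto.
  - apply (Im_deriv_line (fun w => k1 w * e)%C). now rewrite E0.
Qed.

(** In the sum over the directions [1] and [Ci] the terms with [k2] cancel because [Ci * Ci = -1].
    Three cases are used: [a = 0] gives the harmonic function [ln |k|^2], [a = s = 1] a positive
    Laplacian where [k1] does not vanish, and [a = r * r], [s = -1] the weight of the hyperbolic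
    metric of the disc. *)
Lemma laplacian_ln_sqmod (rad a s : R) (k k1 : C -> C) (z : C) :
  Cmod z < rad -> (forall w, Cmod w < rad -> cderiv k w (k1 w)) -> holo 1 rad k1 ->
  0 < a + s * sqmod (k z) ->
  has_laplacian (fun w => ln (a + s * sqmod (k w))) z
    (4 * s * a * sqmod (k1 z) / ((a + s * sqmod (k z)) * (a + s * sqmod (k z)))).
Proof.
  intros Hz Hk [k2 [Hk2 _]] HW.
  pose proof (second_deriv_ln_sqmod rad a s k k1 z (k2 z) 1 Cmod_1 Hz Hk (Hk2 z Hz) HW) as H1.
  pose proof (second_deriv_ln_sqmod rad a s k k1 z (k2 z) Ci Cmod_Ci Hz Hk (Hk2 z Hz) HW) as H2.
  cbv zeta in H1, H2.
  eexists. eexists. split; [exact H1|]. split; [exact H2|].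
  unfold sqmod in *. destruct (k z) as [x y], (k1 z) as [x1 y1], (k2 z) as [x2 y2].
  simpl in *. field. lra.
Qed.

(** * Maxima on discs and the Schwarz lemma *)

Lemma ccont_Rmax_Cmod (r : R) (z : C) : ccont (fun w => RtoC (Rmax r (Cmod w))) z.
Proof.
  intros e He. exists e. split; auto. intros w _ Hw. rewrite <- RtoC_minus, Cmod_R.
  pose proof (Cmod_bound_near w z). pose proof (Cmod_bound_near z w).
  rewrite (Cmod_minus_sym z w) in H0.
  unfold Rmax. destruct (Rle_dec r (Cmod w)), (Rle_dec r (Cmod z)); apply Rabs_def1; lra.
Qed.

(** Composing [W] with the radial retraction of the plane onto the disc gives a continuous function
    on a square, which is maximised in [y] for each [x] and then in [x]; uniform continuity makes
    the partial maximum [m] continuous. *)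
Lemma disc_max (W : C -> R) (r : R) : 0 < r ->
  (forall z, Cmod z <= r -> ccont (fun w => RtoC (W w)) z) ->
  exists z0, Cmod z0 <= r /\ forall z, Cmod z <= r -> W z <= W z0.
Proof.
  intros Hr HW.
  set (ret := fun z => (z * (RtoC r / RtoC (Rmax r (Cmod z))))%C).
  assert (PM : forall z, 0 < Rmax r (Cmod z)) by (intros z; pose proof (Rmax_l r (Cmod z)); lra).
  assert (PM' : forall z, RtoC (Rmax r (Cmod z)) <> 0%C).
  { intros z E. apply RtoC_inj in E. specialize (PM z). lra. }
  assert (Rret : forall z, Cmod (ret z) <= r).
  { intros z. unfold ret. rewrite Cmod_mult, Cmod_div by auto. rewrite !Cmod_R, !Rabs_pos_eq; auto with real.
    - specialize (PM z). pose proof (Rmax_r r (Cmod z)).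
      apply Rmult_le_reg_r with (Rmax r (Cmod z)); auto.
      replace (Cmod z * (r / Rmax r (Cmod z)) * Rmax r (Cmod z)) with (r * Cmod z) by (field; lra).
      apply Rmult_le_compat_l; lra. }
  assert (Idret : forall z, Cmod z <= r -> ret z = z).
  { intros z Hz. unfold ret. rewrite Rmax_left by auto. field. intros E. apply RtoC_inj in E. lra. }
  assert (Cret : forall z, ccont ret z).
  { intros z. apply clim_mult; [apply clim_id|]. apply clim_div; auto; [apply clim_const|].
    apply ccont_Rmax_Cmod. }
  set (f := fun x y => W (ret (x, y))).
  assert (Cf : forall x y, continuity_2d_pt f x y).
  { intros x y. apply (continuity_2d_of_ccont (fun w => RtoC (W (ret w)))).
    apply (clim_comp ret (fun w => RtoC (W w)) (x, y) (ret (x, y))); [apply Cret|].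
    apply HW, Rret. }
  destruct (functional_choice (fun x y => - r <= y <= r /\ forall c, - r <= c <= r -> f x c <= f x y))
    as [my Hmy].
  { intros x. destruct (continuity_ab_maj (f x) (- r) r) as [y [H1 H2]]; [lra| |exists y; auto].
    intros c _ eps Heps. destruct (Cf x c (mkposreal _ Heps)) as [d Hd].
    exists d. split; [apply cond_pos|]. intros v [_ Hv]. apply (Hd x v); auto.
    replace (x - x) with 0 by ring. rewrite Rabs_R0. apply cond_pos. }
  set (m := fun x => f x (my x)).
  destruct (continuity_ab_maj m (- r) r) as [x0 [H1 H2]]; [lra| |].
  { intros c Hc eps Heps. assert (Heps2 : 0 < eps / 2) by lra.
    destruct (uniform_continuity_2d f (c - 1) (c + 1) (- r) r (fun x y _ _ => Cf x y) (mkposreal _ Heps2)) as [d Hd].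
    simpl in Hd. exists (Rmin 1 d). split; [apply Rmin_pos; [lra|apply cond_pos]|].
    intros x [_ Hx]. unfold dist in *; simpl in *; unfold R_dist in *.
    assert (X1 : Rabs (x - c) < 1) by (Rmin_bounds; lra).
    assert (X2 : Rabs (x - c) < d) by (Rmin_bounds; lra).
    apply Rabs_def2 in X1.
    destruct (Hmy x) as [M1 M2], (Hmy c) as [N1 N2].
    assert (Z : forall y : R, Rabs (y - y) < d).
    { intros y. replace (y - y) with 0 by ring. rewrite Rabs_R0. apply cond_pos. }
    assert (A1 := Hd c (my x) x (my x) ltac:(lra) M1 ltac:(lra) M1 X2 (Z _)).
    assert (A2 := Hd c (my c) x (my c) ltac:(lra) N1 ltac:(lra) N1 X2 (Z _)).
    specialize (M2 (my c) N1). specialize (N2 (my x) M1). unfold m.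
    apply Rabs_def2 in A1. apply Rabs_def2 in A2. apply Rabs_def1; lra. }
  exists (ret (x0, my x0)). split; auto. intros z Hz.
  rewrite <- (Idret z Hz). destruct z as [x y].
  pose proof (re_le_Cmod (x, y)) as Bx. pose proof (im_le_Cmod (x, y)) as By. simpl in Bx, By.
  assert (Hx : - r <= x <= r) by (apply Rabs_le_between; lra).
  assert (Hy : - r <= y <= r) by (apply Rabs_le_between; lra).
  apply Rle_trans with (m x).
  - apply (proj2 (Hmy x)). auto.
  - now apply H1.
Qed.

(** At an interior maximum with [W > 0], [ln W] would have a Laplacian at most 0. The condition
    bears on [ln W] because the functions of interest are products of powers, and only where
    [W > 0], so that zeros are allowed. *)
Lemma maximum_principle (W : C -> R) (r B : R) : 0 < r -> 0 <= B ->
  (forall z, Cmod z <= r -> ccont (fun w => RtoC (W w)) z) ->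
  (forall z, Cmod z < r -> 0 < W z -> exists L, 0 < L /\ has_laplacian (fun w => ln (W w)) z L) ->
  (forall z, Cmod z = r -> W z <= B) ->
  forall z, Cmod z <= r -> W z <= B.
Proof.
  intros Hr HB HW HL Hb z Hz.
  destruct (disc_max W r Hr HW) as [z0 [Hz0 Hmax]].
  apply Rle_trans with (W z0); auto.
  destruct (Req_dec (Cmod z0) r) as [E|E]; auto.
  destruct (Rle_lt_dec (W z0) 0) as [N|P]; [lra|].
  destruct (HL z0) as [L [PL HLap]]; [lra|auto|].
  exfalso. apply (Rlt_not_le _ _ PL).
  destruct (ccont_all _ _ (HW z0 Hz0) (W z0) P) as [d [Pd Hd]].
  apply has_laplacian_max with (3 := HLap) (d0 := Rmin d (r - Cmod z0)); [apply Rmin_pos; lra|].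
  intros w Hw.
  assert (W1 : Cmod (w - z0) < d) by (Rmin_bounds; lra).
  assert (W2 : Cmod (w - z0) < r - Cmod z0) by (Rmin_bounds; lra).
  specialize (Hd w W1). rewrite <- RtoC_minus, Cmod_R in Hd. apply Rabs_def2 in Hd.
  apply ln_le; [lra|]. apply Hmax. left. now apply disc_open with z0.
Qed.

Lemma ccont_sqmod_id (z : C) : ccont (fun w => RtoC (sqmod w)) z.
Proof. apply (ccont_sqmod (fun w => w)). apply clim_id. Qed.

Lemma ccont_R_mult (u v : C -> R) (z : C) : ccont (fun w => RtoC (u w)) z ->
  ccont (fun w => RtoC (v w)) z -> ccont (fun w => RtoC (u w * v w)) z.
Proof.
  intros Hu Hv. unfold ccont. rewrite RtoC_mult.
  eapply clim_ext; [|apply (clim_mult _ _ _ _ _ Hu Hv)].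
  intros w _. cbv beta. now rewrite RtoC_mult.
Qed.

Lemma ccont_R_plus (u v : C -> R) (z : C) : ccont (fun w => RtoC (u w)) z ->
  ccont (fun w => RtoC (v w)) z -> ccont (fun w => RtoC (u w + v w)) z.
Proof.
  intros Hu Hv. unfold ccont. rewrite RtoC_plus.
  eapply clim_ext; [|apply (clim_plus _ _ _ _ _ Hu Hv)].
  intros w _. cbv beta. now rewrite RtoC_plus.
Qed.

Lemma ccont_R_pow (u : C -> R) (n : nat) (z : C) : ccont (fun w => RtoC (u w)) z ->
  ccont (fun w => RtoC (u w ^ n)) z.
Proof.
  intros Hu. induction n.
  - exact (clim_const 1 z).
  - now apply ccont_R_mult.
Qed.

Lemma ccont_R_inv (u : C -> R) (z : C) : u z <> 0 -> ccont (fun w => RtoC (u w)) z ->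
  ccont (fun w => RtoC (/ u w)) z.
Proof.
  intros H0 Hu.
  assert (H0' : RtoC (u z) <> 0%C) by (intros E; apply RtoC_inj in E; auto).
  destruct (ccont_neq_0_loc _ _ Hu H0') as [d [Pd Hd]].
  unfold ccont. rewrite RtoC_inv by auto.
  apply clim_ext_loc with (2 := fun w _ Hw => eq_sym (RtoC_inv (u w)
     (fun E => Hd w Hw (f_equal RtoC E)))); auto.
  now apply (clim_inv (fun w => RtoC (u w))).
Qed.

(** By Bernoulli's inequality. This serves to take m-th roots: a bound [X ^ m * k <= Y ^ m * K] with
    fixed [k] and [K], valid for all [m >= 1], forces [X <= Y]. *)
Lemma pow_grows (X Y k K : R) : 0 <= Y -> Y < X -> 0 < k ->
  exists m, (1 <= m)%nat /\ Y ^ m * K < X ^ m * k.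
Proof.
  intros HY HX Hk. destruct (Req_dec Y 0) as [->|N].
  - exists 1%nat. split; auto. simpl. nra.
  - assert (PY : 0 < Y) by lra.
    set (d := X / Y - 1).
    assert (Pd : 0 < d).
    { unfold d. apply Rlt_0_minus. apply Rmult_lt_reg_r with Y; auto.
      unfold Rdiv. rewrite Rmult_assoc, Rinv_l; lra. }
    destruct (INR_unbounded (K / k / d)) as [m Hm].
    exists (S m). split; [lia|].
    assert (E : X = Y * (1 + d)) by (unfold d; field; lra).
    rewrite E, Rpow_mult_distr, Rmult_assoc.
    apply Rmult_lt_compat_l; [now apply pow_lt|].
    pose proof (poly (S m) d Pd) as P.
    apply Rlt_le_trans with ((1 + INR (S m) * d) * k); [|apply Rmult_le_compat_r; lra].
    rewrite S_INR.
    assert (K < INR m * d * k).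
    { apply Rmult_lt_compat_r with (r := d * k) in Hm; [|nra].
      replace (K / k / d * (d * k)) with K in Hm by (field; lra). lra. }
    nra.
Qed.

(** The maximum principle is applied to [|g|^(2m) / |z|^(2q) * (1 + |z|^2)] with [q = m p - 1].
    Giving up one power of [|z|^2] makes the quotient tend to 0 at the origin, and the factor
    [1 + |z|^2] makes the Laplacian of the logarithm strictly positive. Both losses are independent
    of [m] up to constants and disappear after an m-th root, by [pow_grows]. *)
Lemma schwarz_order (rad r B M d : R) (p : nat) (g : C -> C) :
  0 < r < rad -> (1 <= p)%nat -> holo 2 rad g ->
  (forall z, Cmod z < rad -> Cmod (g z) <= B) ->
  0 < d -> (forall z, Cmod z < d -> Cmod (g z) <= M * Cmod z ^ p) ->
  forall z, Cmod z <= r -> Cmod (g z) * r ^ p <= B * Cmod z ^ p.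
Proof.
  intros Hr Hp Hg HB Hd HM z Hz.
  assert (B0 : 0 <= B).
  { eapply Rle_trans; [apply Cmod_ge_0|apply (HB 0%C)]. rewrite Cmod_0. lra. }
  destruct (Ceq_dec z 0) as [->|Nz].
  { specialize (HM 0%C). rewrite Cmod_0 in *. specialize (HM Hd).
    rewrite pow_ne_zero in * by lia. rewrite Rmult_0_r in *.
    pose proof (Cmod_ge_0 (g 0%C)). assert (Cmod (g 0%C) = 0) by lra. rewrite H0. lra. }
  apply Rnot_lt_le. intros Hlt.
  destruct Hg as [g' [Dg Hg']].
  assert (Cg : forall w, Cmod w < rad -> ccont g w) by (intros; eapply cderiv_cont; auto).
  assert (Key : forall m, (1 <= m)%nat ->
    (sqmod (g z) * (r * r) ^ p) ^ m * sqmod z <= (B * B * sqmod z ^ p) ^ m * (r * r * (1 + r * r))).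
  { intros m Hm.
    set (q := (m * p - 1)%nat). assert (Eq : (m * p)%nat = S q) by (unfold q; nia).
    set (W0 := fun w => sqmod (g w) ^ m * / sqmod w ^ q * (1 + sqmod w)).
    (* The value 0 at the origin is the continuous extension, since [W0 v <= A * sqmod v] nearby. *)
    set (W := fun w => if Ceq_dec w 0 then 0 else W0 w).
    assert (EW : forall w : C, w <> 0%C -> W w = W0 w).
    { intros w Hw. unfold W. destruct (Ceq_dec w 0) as [F|_]; [now elim Hw|reflexivity]. }
    assert (Bd : W z <= (B * B) ^ m * / (r * r) ^ q * (1 + r * r)).
    { apply (maximum_principle W r); auto; try lra.
      - apply Rmult_le_pos; [|nra]. apply Rmult_le_pos; [apply pow_le; nra|].
        left. apply Rinv_0_lt_compat, pow_lt. nra.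
      - intros w Hw. destruct (Ceq_dec w 0) as [->|Nw].
        + intros e He. unfold W at 2. destruct (Ceq_dec 0 0) as [_|F]; [|now elim F].
          set (A := (M * M) ^ m * 2).
          assert (A0 : 0 <= A) by (unfold A; apply Rmult_le_pos; [apply pow_le; nra|lra]).
          exists (Rmin (Rmin 1 d) (e / (1 + A))). split.
          { repeat apply Rmin_pos; try lra. apply Rdiv_lt_0_compat; lra. }
          intros v Nv Hv. replace (v - 0)%C with v in Hv by ring.
          Rmin_bounds.
          rewrite <- RtoC_minus, Cmod_R, Rminus_0_r, EW by auto. unfold W0.
          pose proof (sqmod_pos v Nv) as Pv.
          assert (Pq : 0 < / sqmod v ^ q) by (apply Rinv_0_lt_compat, pow_lt; auto).
          rewrite Rabs_pos_eq.
          2:{ apply Rmult_le_pos; [|lra]. apply Rmult_le_pos; [|lra]. apply pow_le, sqmod_ge_0. }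
          assert (G : sqmod (g v) <= M * M * sqmod v ^ p).
          { rewrite !sqmod_Cmod, Rpow_mult_distr.
            replace (M * M * (Cmod v ^ p * Cmod v ^ p)) with ((M * Cmod v ^ p) * (M * Cmod v ^ p)) by ring.
            pose proof (Cmod_ge_0 (g v)). specialize (HM v ltac:(lra)).
            apply Rmult_le_compat; auto. }
          assert (V1 : sqmod v < 1) by (rewrite sqmod_Cmod; pose proof (Cmod_ge_0 v); nra).
          apply Rle_lt_trans with ((M * M * sqmod v ^ p) ^ m * / sqmod v ^ q * 2).
          { apply Rmult_le_compat; try lra.
            - apply Rmult_le_pos; [|lra]. apply pow_le, sqmod_ge_0.
            - apply Rmult_le_compat_r; [lra|]. apply pow_incr. split; [apply sqmod_ge_0|auto]. }
          replace ((M * M * sqmod v ^ p) ^ m * / sqmod v ^ q * 2) with (A * sqmod v).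
          2:{ rewrite Rpow_mult_distr, <- pow_mult, (Nat.mul_comm p m), Eq. unfold A. simpl.
              field. apply pow_nonzero. lra. }
          assert (V2 : sqmod v <= Cmod v) by (rewrite sqmod_Cmod; pose proof (Cmod_ge_0 v); nra).
          assert (V3 : Cmod v * (1 + A) < e).
          { apply Rmult_lt_reg_r with (/ (1 + A)); [apply Rinv_0_lt_compat; lra|].
            rewrite Rmult_assoc, Rinv_r, Rmult_1_r by lra. unfold Rdiv in *. lra. }
          pose proof (Cmod_ge_0 v). nra.
        + destruct (ccont_neq_0_loc (fun w => w) w (clim_id w) Nw) as [d1 [P1 H1]].
          apply ccont_ext_loc with (fun w => RtoC (W0 w)) d1; auto.
          { intros v Hv. now rewrite EW by auto. }
          pose proof (sqmod_pos w Nw).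
          apply ccont_R_mult; [apply ccont_R_mult|].
          * apply ccont_R_pow. apply ccont_sqmod. apply Cg. lra.
          * apply ccont_R_inv; [apply pow_nonzero; lra|]. apply ccont_R_pow, ccont_sqmod_id.
          * apply ccont_R_plus; [apply clim_const|apply ccont_sqmod_id].
      - intros w Hw PW.
        assert (Nw : w <> 0%C).
        { intros ->. unfold W in PW. destruct (Ceq_dec 0 0) as [_|F]; [lra|now elim F]. }
        rewrite EW in PW by auto. pose proof (sqmod_pos w Nw) as Pw.
        assert (Ng : g w <> 0%C).
        { intros E. unfold W0 in PW. rewrite E in PW. unfold sqmod at 1 in PW. simpl in PW.
          replace (0 * 0 + 0 * 0) with 0 in PW by ring. rewrite pow_ne_zero in PW by lia. lra. }
        pose proof (sqmod_pos _ Ng) as Pg.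
        assert (L1 : has_laplacian (fun v => ln (0 + 1 * sqmod (g v))) w
           (4 * 1 * 0 * sqmod (g' w) / ((0 + 1 * sqmod (g w)) * (0 + 1 * sqmod (g w))))).
        { apply (laplacian_ln_sqmod rad); auto; lra. }
        assert (L2 : forall a s, 0 < a + s * sqmod w ->
          has_laplacian (fun v => ln (a + s * sqmod v)) w
           (4 * s * a * sqmod 1 / ((a + s * sqmod w) * (a + s * sqmod w)))).
        { intros a s Has. apply (laplacian_ln_sqmod rad a s (fun v => v) (fun _ => RtoC 1)); auto; try lra.
          - intros v _. apply cderiv_id.
          - apply holo_const. }
        destruct (ccont_neq_0_loc (fun w => w) w (clim_id w) Nw) as [d1 [P1 H1]].
        destruct (ccont_neq_0_loc g w (Cg w ltac:(lra)) Ng) as [d2 [P2 H2]].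
        eexists. split; [|
          eapply has_laplacian_ext; [| |
            apply (has_laplacian_plus _ _ _ _ _
              (has_laplacian_plus _ _ _ _ _ (has_laplacian_scal _ _ (INR m) _ L1)
                 (has_laplacian_scal _ _ (- INR q) _ (L2 0 1 ltac:(lra)))) (L2 1 1 ltac:(lra)))]].
        + assert (S1 : sqmod 1 = 1) by (unfold sqmod; simpl; ring). rewrite S1.
          apply Rlt_le_trans with (4 * 1 * 1 * 1 / ((1 + 1 * sqmod w) * (1 + 1 * sqmod w))).
          * apply Rdiv_lt_0_compat; nra.
          * right. unfold Rdiv. ring.
        + exact (Rmin_pos _ _ P1 P2).
        + intros v Hv. cbv beta.
          Rmin_bounds.
          specialize (H1 v ltac:(lra)). specialize (H2 v ltac:(lra)).
          rewrite EW by auto. unfold W0.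
          pose proof (sqmod_pos _ H1). pose proof (sqmod_pos _ H2).
          assert (Pq : 0 < sqmod v ^ q) by now apply pow_lt.
          assert (Pm : 0 < sqmod (g v) ^ m) by now apply pow_lt.
          pose proof (Rinv_0_lt_compat _ Pq).
          rewrite !ln_mult, ln_Rinv, !ln_pow by (auto; nra).
          rewrite !Rplus_0_l, !Rmult_1_l. ring.
      - intros w Hw.
        assert (Nw : w <> 0%C) by (intros ->; rewrite Cmod_0 in Hw; lra).
        rewrite EW by auto. unfold W0. rewrite (sqmod_Cmod w), Hw.
        apply Rmult_le_compat_r; [nra|]. apply Rmult_le_compat_r.
        + left. apply Rinv_0_lt_compat, pow_lt. nra.
        + apply pow_incr. split; [apply sqmod_ge_0|]. rewrite sqmod_Cmod.
          specialize (HB w ltac:(lra)). pose proof (Cmod_ge_0 (g w)). nra. }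
    rewrite EW in Bd by auto. unfold W0 in Bd.
    pose proof (sqmod_pos z Nz) as Pz. assert (Prr : 0 < r * r) by nra.
    assert (PZ : 0 < sqmod z ^ q) by now apply pow_lt.
    assert (PR : 0 < (r * r) ^ q) by now apply pow_lt.
    assert (H1 : sqmod (g z) ^ m * / sqmod z ^ q <= (B * B) ^ m * / (r * r) ^ q * (1 + r * r)).
    { eapply Rle_trans; [|exact Bd]. pose proof (Rinv_0_lt_compat _ PZ).
      assert (0 <= sqmod (g z) ^ m * / sqmod z ^ q)
        by (apply Rmult_le_pos; [apply pow_le, sqmod_ge_0|lra]). nra. }
    rewrite (Rpow_mult_distr (sqmod (g z))), (Rpow_mult_distr (B * B)), <- !pow_mult,
      (Nat.mul_comm p m), Eq.
    change ((r * r) ^ S q) with (r * r * (r * r) ^ q). change (sqmod z ^ S q) with (sqmod z * sqmod z ^ q).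
    revert H1. generalize (sqmod (g z) ^ m), (sqmod z ^ q), ((r * r) ^ q), ((B * B) ^ m), PZ, PR.
    intros G Zq Rq Bm PZq PRq H1.
    apply Rmult_le_compat_r with (r := Zq * Rq * (r * r) * sqmod z) in H1.
    2:{ apply Rlt_le. repeat apply Rmult_lt_0_compat; auto; lra. }
    replace (G * / Zq * (Zq * Rq * (r * r) * sqmod z)) with (G * (r * r * Rq) * sqmod z) in H1 by (field; lra).
    replace (Bm * / Rq * (1 + r * r) * (Zq * Rq * (r * r) * sqmod z))
      with (Bm * (sqmod z * Zq) * (r * r * (1 + r * r))) in H1 by (field; lra).
    exact H1. }
  set (X := sqmod (g z) * (r * r) ^ p) in *. set (Y := B * B * sqmod z ^ p) in *.
  destruct (pow_grows X Y (sqmod z) (r * r * (1 + r * r))) as [m [Hm1 Hm2]].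
  - unfold Y. apply Rmult_le_pos; [nra|]. apply pow_le, sqmod_ge_0.
  - unfold X, Y. rewrite !sqmod_Cmod, !Rpow_mult_distr.
    replace (B * B * (Cmod z ^ p * Cmod z ^ p)) with ((B * Cmod z ^ p) * (B * Cmod z ^ p)) by ring.
    replace (Cmod (g z) * Cmod (g z) * (r ^ p * r ^ p)) with ((Cmod (g z) * r ^ p) * (Cmod (g z) * r ^ p)) by ring.
    assert (0 <= B * Cmod z ^ p) by (apply Rmult_le_pos; auto; apply pow_le, Cmod_ge_0). nra.
  - now apply sqmod_pos.
  - specialize (Key m Hm1). lra.
Qed.

(** * Landau's theorem by Ahlfors' method *)

Lemma Cexp_surj (w : C) : w <> 0%C -> exists g, Cexp g = w.
Proof.
  intros Hw. assert (Pw : 0 < Cmod w) by now apply Cmod_gt_0.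
  set (m := Cmod w) in *.
  assert (E : Re w * Re w + Im w * Im w = m * m).
  { pose proof (sqmod_Cmod w). unfold sqmod in H. exact H. }
  set (a := Re w / m). set (b := Im w / m).
  assert (Eab : a * a + b * b = 1).
  { unfold a, b. replace (Re w / m * (Re w / m) + Im w / m * (Im w / m))
      with ((Re w * Re w + Im w * Im w) / (m * m)) by (field; lra). rewrite E. field. lra. }
  assert (Ha : -1 <= a <= 1) by nra.
  assert (S : sin (acos a) = Rabs b).
  { rewrite sin_acos by auto. rewrite <- sqrt_Rsqr_abs. f_equal. unfold Rsqr. lra. }
  assert (Ew : w = (m * a, m * b)).
  { destruct w as [x y]. unfold a, b. simpl. f_equal; field; lra. }
  destruct (Rle_dec 0 b) as [Hb|Hb].
  - exists (ln m, acos a). unfold Cexp; simpl. rewrite exp_ln, cos_acos, S, Rabs_pos_eq by auto. now rewrite Ew.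
  - exists (ln m, - acos a). unfold Cexp; simpl.
    rewrite exp_ln, cos_neg, sin_neg, cos_acos, S, Rabs_left by (auto; lra).
    rewrite Ropp_involutive. now rewrite Ew.
Qed.

(** [k] is [Cexp] of one sixth of a logarithm of [u]. A sixth root is taken so that [sqmod k] is the
    cube root of [|u|], which puts the factors of Ahlfors' metric in the form treated by
    [laplacian_ln_sqmod]; the last identity is [u' = 6 k^5 k']. *)
Lemma sixth_root (rad : R) (u u' : C -> C) : 0 < rad -> smooth rad u ->
  (forall z, Cmod z < rad -> cderiv u z (u' z)) -> smooth rad u' ->
  (forall z, Cmod z < rad -> u z <> 0%C) ->
  exists k k' : C -> C, (forall z, Cmod z < rad -> cderiv k z (k' z)) /\ smooth rad k' /\
    (forall z, Cmod z < rad -> 0 < sqmod (k z) /\ sqmod (u z) = sqmod (k z) ^ 6 /\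
       36 * sqmod (k z) ^ 5 * sqmod (k' z) = sqmod (u' z)).
Proof.
  intros Hr Su Du Su' Nu.
  destruct (Cexp_surj (u 0%C)) as [g0 Hg0]; [apply Nu; rewrite Cmod_0; auto|].
  destruct (log_exists rad u g0) as [G [SG [_ HG]]]; auto.
  destruct (smooth_deriv _ _ SG) as [G' [DG SG']].
  set (k := fun z => Cexp (/ 6 * G z)).
  assert (Sk : smooth rad k).
  { intros n. apply (holo_Cexp n rad (fun z => / 6 * G z)%C). apply holo_mult; auto. apply holo_const. }
  assert (Dk : forall z, Cmod z < rad -> cderiv k z (k z * (/ 6 * G' z))%C).
  { intros z Hz. apply (cderiv_comp (fun z => / 6 * G z)%C Cexp); [|apply cderiv_Cexp].
    apply cderiv_scal. auto. }
  assert (H6 : RtoC 6 <> 0%C) by (intros F; apply RtoC_inj in F; lra).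
  exists k, (fun z => k z * (/ 6 * G' z))%C. split; [auto|split].
  - intros n. apply holo_mult; auto. apply holo_mult; auto. apply holo_const.
  - intros z Hz.
    assert (Ek : u z = (k z * k z * k z * k z * k z * k z)%C).
    { rewrite <- (HG z Hz). unfold k. rewrite <- !Cexp_plus. f_equal. field. }
    assert (Eu' : u' z = (u z * G' z)%C).
    { apply (cderiv_unique u z); auto. rewrite <- (HG z Hz).
      apply (cderiv_ext_loc (fun w => Cexp (G w)) u z _ (rad - Cmod z)); [lra| |].
      - intros w Hw. apply HG. now apply disc_open with z.
      - apply (cderiv_comp G Cexp); auto. apply cderiv_Cexp. }
    split; [apply sqmod_pos, Cexp_neq_0|]. split.
    + rewrite Ek, !sqmod_mult. ring.
    + rewrite Eu', Ek, !sqmod_mult.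
      replace (sqmod (/ 6)%C) with (/ 36).
      * field.
      * rewrite sqmod_Cmod, Cmod_inv, Cmod_R, Rabs_pos_eq by (auto; lra). field.
Qed.

(** This is the curvature bound of Ahlfors' metric. The larger variable, say [y], is at least
    [3 / 4], hence [1 + y <= 7 / 3 * y], and [(7/3)^4 = 2401/81] is at most [40 * (3/4) = 30]. *)
Lemma ahlfors_ineq (x y : R) : 0 < x -> 0 < y -> 1 <= x ^ 3 + y ^ 3 ->
  (1 + x) ^ 3 * (1 + y) ^ 3 <= 40 * (y ^ 5 * (1 + y) ^ 2 + x ^ 5 * (1 + x) ^ 2).
Proof.
  assert (Half : forall x y, 0 < x -> x <= y -> 1 <= x ^ 3 + y ^ 3 ->
    (1 + x) ^ 3 * (1 + y) ^ 3 <= 40 * (y ^ 5 * (1 + y) ^ 2)).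
  { clear. intros x y Hx Hxy H.
    assert (Hy : 3 / 4 <= y).
    { apply Rnot_lt_le. intros F. assert (x ^ 3 <= y ^ 3) by (apply pow_incr; lra).
      assert (y ^ 3 <= (3 / 4) ^ 3) by (apply pow_incr; lra). lra. }
    apply Rle_trans with ((1 + y) ^ 3 * (1 + y) ^ 3).
    - apply Rmult_le_compat_r; [apply pow_le; lra|]. apply pow_incr. lra.
    - replace ((1 + y) ^ 3 * (1 + y) ^ 3) with ((1 + y) ^ 4 * (1 + y) ^ 2) by ring.
      rewrite <- Rmult_assoc. apply Rmult_le_compat_r; [apply pow_le; lra|].
      apply Rle_trans with ((7 / 3 * y) ^ 4); [apply pow_incr; lra|].
      replace ((7 / 3 * y) ^ 4) with (2401 / 81 * y ^ 4) by field.
      replace (y ^ 5) with (y ^ 4 * y) by ring.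
      assert (0 < y ^ 4) by (apply pow_lt; lra). nra. }
  intros Hx Hy H.
  assert (0 < y ^ 5 * (1 + y) ^ 2) by (apply Rmult_lt_0_compat; apply pow_lt; lra).
  assert (0 < x ^ 5 * (1 + x) ^ 2) by (apply Rmult_lt_0_compat; apply pow_lt; lra).
  destruct (Rle_dec x y) as [L|L].
  - specialize (Half x y Hx L H). lra.
  - specialize (Half y x Hy ltac:(lra) ltac:(lra)). lra.
Qed.

(* Ahlfors' method: the metric
   ((1+x)(1+y)/(x^5 y^5))^(1/2) |dw|, x = |w|^(1/3), y = |w-c|^(1/3), on C \ {0,c}
   has curvature bounded above by a negative constant. *)
Lemma ahlfors_schwarz (rad r : R) (c : C) (h h' : C -> C) :
  0 < r < rad -> 1 <= Cmod c -> smooth rad h ->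
  (forall z, Cmod z < rad -> cderiv h z (h' z)) -> smooth rad h' ->
  (forall z, Cmod z < rad -> h z <> 0%C /\ h z <> c) ->
  exists x y : C -> R,
    (forall z, Cmod z < rad -> 0 < x z /\ 0 < y z /\ x z ^ 3 = Cmod (h z) /\ y z ^ 3 = Cmod (h z - c)%C) /\
    (forall z, Cmod z <= r ->
      sqmod (h' z) * (r * r - sqmod z) ^ 2 * ((1 + x z) * (1 + y z)) <=
      2880 * (r * r) * (x z ^ 5 * y z ^ 5)).
Proof.
  intros Hr Hc Sh Dh Sh' Hom.
  assert (Pr : 0 < rad) by lra.
  destruct (sixth_root rad h h' Pr Sh Dh Sh') as [k [k1 [Dk [Sk1 Hk]]]]; [apply Hom|].
  destruct (sixth_root rad (fun z => h z - c)%C h' Pr) as [l [l1 [Dl [Sl1 Hl]]]]; auto.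
  { intros n. apply holo_minus; auto. apply holo_const. }
  { intros z Hz. replace (h' z) with (h' z - 0)%C by ring.
    apply cderiv_minus; auto. apply cderiv_const. }
  { intros z Hz. apply Cminus_neq_0. now apply Hom. }
  assert (Cube : forall a w, 0 < a -> sqmod w = a ^ 6 -> a ^ 3 = Cmod w).
  { intros a w Pa E. rewrite sqmod_Cmod in E.
    assert (0 < a ^ 3) by now apply pow_lt. pose proof (Cmod_ge_0 w).
    replace (a ^ 6) with (a ^ 3 * a ^ 3) in E by ring. nra. }
  exists (fun z => sqmod (k z)), (fun z => sqmod (l z)). split.
  { intros z Hz. destruct (Hk z Hz) as [K1 [K2 _]]. destruct (Hl z Hz) as [L1 [L2 _]].
    repeat split; auto. }
  (* The squared ratio of the pulled-back Ahlfors metric to the hyperbolic metric of the disc of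
     radius [r], up to a constant. It vanishes on the circle, so a positive maximum is interior, and
     the sign of the Laplacian there yields the bound. *)
  set (W := fun z => sqmod (h' z) * (r * r + -1 * sqmod z) ^ 2 * ((1 + sqmod (k z)) * (1 + sqmod (l z)))
     * / (sqmod (k z) ^ 5 * sqmod (l z) ^ 5)).
  assert (Bound : forall z, Cmod z <= r -> W z <= 2880 * (r * r)).
  { assert (Ck : forall z, Cmod z < rad -> ccont k z) by (intros; eapply cderiv_cont; auto).
    assert (Cl : forall z, Cmod z < rad -> ccont l z) by (intros; eapply cderiv_cont; auto).
    assert (Ch' : forall z, Cmod z < rad -> ccont h' z) by (apply (Sh' O)).
    destruct (disc_max W r) as [z0 [Hz0 Hmax]]; [lra| |].
    { intros z Hz. assert (Hz' : Cmod z < rad) by lra.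
      destruct (Hk z Hz') as [K1 _], (Hl z Hz') as [L1 _].
      apply ccont_R_mult; [apply ccont_R_mult; [apply ccont_R_mult|apply ccont_R_mult]|].
      - apply ccont_sqmod; auto.
      - apply ccont_R_pow. apply ccont_R_plus; [exact (clim_const _ z)|].
        apply ccont_R_mult; [exact (clim_const _ z)|apply ccont_sqmod_id].
      - apply ccont_R_plus; [exact (clim_const _ z)|]. apply ccont_sqmod; auto.
      - apply ccont_R_plus; [exact (clim_const _ z)|]. apply ccont_sqmod; auto.
      - apply ccont_R_inv.
        + apply Rmult_integral_contrapositive. split; apply pow_nonzero; lra.
        + apply ccont_R_mult; apply ccont_R_pow, ccont_sqmod; auto. }
    intros z Hz. apply Rle_trans with (W z0); auto. clear z Hz.
    assert (Prr : 0 < r * r) by nra.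
    destruct (Rle_lt_dec (W z0) 0) as [N|P]; [lra|].
    assert (Hz0' : Cmod z0 < rad) by lra.
    destruct (Hk z0 Hz0') as [K1 [K2 K3]], (Hl z0 Hz0') as [L1 [L2 L3]].
    assert (Pkl : 0 < sqmod (k z0) ^ 5 * sqmod (l z0) ^ 5) by (apply Rmult_lt_0_compat; now apply pow_lt).
    assert (Nh' : h' z0 <> 0%C).
    { intros E. unfold W in P. rewrite E in P. replace (sqmod 0) with 0 in P by (unfold sqmod; simpl; ring). lra. }
    assert (Hz0r : Cmod z0 < r).
    { destruct (Req_dec (Cmod z0) r) as [E|E]; [|lra]. exfalso. unfold W in P.
      rewrite (sqmod_Cmod z0), E in P. replace (r * r + -1 * (r * r)) with 0 in P by ring. lra. }
    assert (Pz0 : 0 < r * r + -1 * sqmod z0) by (rewrite sqmod_Cmod; pose proof (Cmod_ge_0 z0); nra).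
    pose proof (sqmod_pos _ Nh') as Ph'.
    assert (Lk : forall a, 0 <= a -> has_laplacian (fun w => ln (a + 1 * sqmod (k w))) z0
      (4 * 1 * a * sqmod (k1 z0) / ((a + 1 * sqmod (k z0)) * (a + 1 * sqmod (k z0))))).
    { intros a Ha. apply (laplacian_ln_sqmod rad); auto; lra. }
    assert (Ll : forall a, 0 <= a -> has_laplacian (fun w => ln (a + 1 * sqmod (l w))) z0
      (4 * 1 * a * sqmod (l1 z0) / ((a + 1 * sqmod (l z0)) * (a + 1 * sqmod (l z0))))).
    { intros a Ha. apply (laplacian_ln_sqmod rad); auto; lra. }
    destruct (smooth_deriv _ _ Sh') as [h2 [Dh' Sh2]].
    assert (Lh : has_laplacian (fun w => ln (0 + 1 * sqmod (h' w))) z0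
      (4 * 1 * 0 * sqmod (h2 z0) / ((0 + 1 * sqmod (h' z0)) * (0 + 1 * sqmod (h' z0))))).
    { apply (laplacian_ln_sqmod rad); auto; lra. }
    assert (Lz : has_laplacian (fun w => ln (r * r + -1 * sqmod w)) z0
      (4 * -1 * (r * r) * sqmod 1 / ((r * r + -1 * sqmod z0) * (r * r + -1 * sqmod z0)))).
    { apply (laplacian_ln_sqmod rad (r * r) (-1) (fun w => w) (fun _ => RtoC 1)); auto.
      - intros w _. apply cderiv_id.
      - apply holo_const. }
    pose proof (has_laplacian_plus _ _ _ _ _
      (has_laplacian_plus _ _ _ _ _ Lh (has_laplacian_scal _ _ 2 _ Lz))
      (has_laplacian_plus _ _ _ _ _
        (has_laplacian_plus _ _ _ _ _ (Lk 1 Rle_0_1) (has_laplacian_scal _ _ (-5) _ (Lk 0 (Rle_refl 0))))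
        (has_laplacian_plus _ _ _ _ _ (Ll 1 Rle_0_1) (has_laplacian_scal _ _ (-5) _ (Ll 0 (Rle_refl 0)))))) as LL.
    set (Lap := _ + _) in LL at 1.
    assert (HLap : Lap <= 0).
    { destruct (ccont_neq_0_loc h' z0 (Ch' z0 Hz0') Nh') as [d [Pd Hd]].
      assert (Form : forall w, Cmod w < r -> h' w <> 0%C ->
        ln (0 + 1 * sqmod (h' w)) + 2 * ln (r * r + -1 * sqmod w) +
        (ln (1 + 1 * sqmod (k w)) + -5 * ln (0 + 1 * sqmod (k w)) +
         (ln (1 + 1 * sqmod (l w)) + -5 * ln (0 + 1 * sqmod (l w)))) = ln (W w) /\ 0 < W w).
      { intros w Hw Nw. assert (Hw' : Cmod w < rad) by lra.
        destruct (Hk w Hw') as [A1 _], (Hl w Hw') as [A2 _].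
        pose proof (sqmod_pos _ Nw) as A3.
        assert (A4 : 0 < r * r + -1 * sqmod w) by (rewrite sqmod_Cmod; pose proof (Cmod_ge_0 w); nra).
        assert (B1 : 0 < sqmod (k w) ^ 5) by now apply pow_lt.
        assert (B2 : 0 < sqmod (l w) ^ 5) by now apply pow_lt.
        assert (B3 : 0 < (r * r + -1 * sqmod w) ^ 2) by now apply pow_lt.
        assert (B4 : 0 < sqmod (k w) ^ 5 * sqmod (l w) ^ 5) by now apply Rmult_lt_0_compat.
        assert (B5 : 0 < / (sqmod (k w) ^ 5 * sqmod (l w) ^ 5)) by now apply Rinv_0_lt_compat.
        assert (B6 : 0 < (1 + sqmod (k w)) * (1 + sqmod (l w))) by nra.
        assert (B7 : 0 < sqmod (h' w) * (r * r + -1 * sqmod w) ^ 2) by now apply Rmult_lt_0_compat.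
        unfold W. split.
        - rewrite (ln_mult _ (/ _)), (ln_mult (_ * _) (_ * _)), (ln_mult (sqmod (h' w))),
            (ln_mult (1 + _)), ln_Rinv, (ln_mult (_ ^ 5)), !ln_pow
            by (auto; try lra; now apply Rmult_lt_0_compat).
          rewrite !Rplus_0_l, !Rmult_1_l. simpl. ring.
        - apply Rmult_lt_0_compat; auto. now apply Rmult_lt_0_compat. }
      apply has_laplacian_max with (3 := LL) (d0 := Rmin d (r - Cmod z0)); [apply Rmin_pos; lra|].
      intros w Hw.
      assert (W1 : Cmod (w - z0) < d) by (Rmin_bounds; lra).
      assert (W2 : Cmod (w - z0) < r - Cmod z0) by (Rmin_bounds; lra).
      assert (W3 : Cmod w < r) by now apply disc_open with z0.
      destruct (Form w W3 (Hd w W1)) as [F1 F2]. destruct (Form z0 Hz0r Nh') as [F3 F4].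
      cbv beta. rewrite F1, F3. apply ln_le; auto. apply Hmax. lra. }
    assert (S1 : sqmod 1 = 1) by (unfold sqmod; simpl; ring).
    unfold Lap in HLap. rewrite S1 in HLap. clear LL Lap Lk Ll Lh Lz Hmax.
    assert (Tri : 1 <= sqmod (k z0) ^ 3 + sqmod (l z0) ^ 3).
    { rewrite (Cube _ (h z0) K1 K2), (Cube _ _ L1 L2).
      pose proof (Cmod_triangle_minus (h z0 - c) (h z0) 0) as T0.
      pose proof (Cmod_triangle (h z0) (- (h z0 - c))) as T. rewrite Cmod_opp in T.
      replace (h z0 + - (h z0 - c))%C with c in T by ring. lra. }
    pose proof (ahlfors_ineq _ _ K1 L1 Tri) as AI.
    unfold W in *. clear W.
    revert K1 K3 L1 L3 Pkl AI HLap Pz0 Ph' Prr.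
    generalize (sqmod (k z0)), (sqmod (l z0)), (sqmod (k1 z0)), (sqmod (l1 z0)), (sqmod (h' z0)),
      (sqmod (h2 z0)).
    generalize (r * r + -1 * sqmod z0). generalize (r * r).
    clear. intros rr D x y x1 y1 H H2 Px K3 Py L3 Pxy AI HLap PD PH Prr.
    assert (Ex : x1 = H / (36 * x ^ 5)) by (rewrite <- K3; field; lra).
    assert (Ey : y1 = H / (36 * y ^ 5)) by (rewrite <- L3; field; lra).
    (* The inequality [HLap] with denominators cleared: the weight of the disc contributes
       [8 * rr / D ^ 2] and the sixth roots the factor 9, whence 72. Together with the 40 of
       [ahlfors_ineq] this gives 2880. *)
    assert (Main : H * D ^ 2 * (y ^ 5 * (1 + y) ^ 2 + x ^ 5 * (1 + x) ^ 2)
      <= 72 * rr * (x ^ 5 * y ^ 5 * (1 + x) ^ 2 * (1 + y) ^ 2)).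
    { subst x1 y1.
      apply Rmult_le_compat_r with (r := 9 * D ^ 2 * (x ^ 5 * y ^ 5 * (1 + x) ^ 2 * (1 + y) ^ 2)) in HLap.
      2:{ apply Rlt_le. repeat first [lra | apply pow_lt | apply Rmult_lt_0_compat]. }
      rewrite Rmult_0_l in HLap. apply Rminus_le.
      eapply Rle_trans; [|exact HLap]. right. field. repeat split; lra. }
    apply Rmult_le_reg_r with (x ^ 5 * y ^ 5 * ((1 + x) ^ 2 * (1 + y) ^ 2)).
    { repeat first [lra | apply pow_lt | apply Rmult_lt_0_compat]. }
    replace (H * D ^ 2 * ((1 + x) * (1 + y)) * / (x ^ 5 * y ^ 5) * (x ^ 5 * y ^ 5 * ((1 + x) ^ 2 * (1 + y) ^ 2)))
      with (H * D ^ 2 * ((1 + x) ^ 3 * (1 + y) ^ 3)) by (field; lra).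
    apply Rle_trans with (H * D ^ 2 * (40 * (y ^ 5 * (1 + y) ^ 2 + x ^ 5 * (1 + x) ^ 2))).
    { apply Rmult_le_compat_l; auto. apply Rmult_le_pos; [lra|]. apply pow_le. lra. }
    lra. }
  intros z Hz. assert (Hz' : Cmod z < rad) by lra.
  destruct (Hk z Hz') as [K1 _], (Hl z Hz') as [L1 _].
  assert (Pkl : 0 < sqmod (k z) ^ 5 * sqmod (l z) ^ 5) by (apply Rmult_lt_0_compat; now apply pow_lt).
  specialize (Bound z Hz). unfold W in Bound.
  apply Rmult_le_compat_r with (r := sqmod (k z) ^ 5 * sqmod (l z) ^ 5) in Bound; [|lra].
  rewrite (Rmult_assoc _ (/ _)), Rinv_l, Rmult_1_r in Bound by lra.
  replace (r * r - sqmod z) with (r * r + -1 * sqmod z) by ring. exact Bound.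
Qed.

(** Bounding [(1 + x) * (1 + y)] below by [x * y] leaves [x^4 * y^4], and both fourth powers are at
    most [(3 + |h|)^2]. On the half disc [r^2 - |z|^2 >= 3/4 r^2], and
    [2880 * 16 / 9 = 5120 <= 5184 = 72^2]. *)
Lemma landau_deriv_bound (rad r : R) (c : C) (h h' : C -> C) :
  0 < r < rad -> 1 <= Cmod c <= 2 -> smooth rad h ->
  (forall z, Cmod z < rad -> cderiv h z (h' z)) -> smooth rad h' ->
  (forall z, Cmod z < rad -> h z <> 0%C /\ h z <> c) ->
  forall z, Cmod z <= r / 2 -> Cmod (h' z) <= 72 / r * (3 + Cmod (h z)) ^ 2.
Proof.
  intros Hr Hc Sh Dh Sh' Hom z Hz.
  destruct (ahlfors_schwarz rad r c h h') as [x [y [Hxy HB]]]; auto; [lra|].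
  destruct (Hxy z) as [Px [Py [Ex Ey]]]; [lra|]. specialize (HB z ltac:(lra)).
  assert (Z : sqmod z <= r * r / 4).
  { rewrite sqmod_Cmod. pose proof (Cmod_ge_0 z). nra. }
  set (X := x z) in *. set (Y := y z) in *.
  assert (HY : Cmod (h z - c) <= Cmod (h z) + 2).
  { unfold Cminus. eapply Rle_trans; [apply Cmod_triangle|]. rewrite Cmod_opp. lra. }
  set (m := Cmod (h z)) in *. assert (M0 : 0 <= m) by apply Cmod_ge_0.
  assert (Pow4 : forall v, 0 < v -> v ^ 3 <= 2 + m -> v ^ 4 <= (3 + m) ^ 2).
  { intros v Pv Hv. assert (P3 : 0 < v ^ 3) by now apply pow_lt.
    apply Rle_trans with ((1 + v ^ 3) ^ 2); [|apply pow_incr; lra].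
    destruct (Rle_dec v 1).
    - assert (v ^ 4 <= 1 ^ 4) by (apply pow_incr; lra). rewrite pow1 in H. nra.
    - assert (v ^ 4 * 1 <= v ^ 4 * v ^ 2) by (apply Rmult_le_compat_l; [apply pow_le|]; nra). nra. }
  assert (X4 : X ^ 4 <= (3 + m) ^ 2) by (apply Pow4; lra).
  assert (Y4 : Y ^ 4 <= (3 + m) ^ 2) by (apply Pow4; lra).
  assert (S : sqmod (h' z) * (r * r) <= 5184 * (3 + m) ^ 4).
  { assert (A1 : (3 / 4 * (r * r)) ^ 2 <= (r * r - sqmod z) ^ 2) by (apply pow_incr; nra).
    pose proof (sqmod_ge_0 (h' z)) as A0.
    assert (A2 : sqmod (h' z) * (9 / 16 * (r * r) * (r * r)) * (X * Y) <= 2880 * (r * r) * (X ^ 4 * Y ^ 4) * (X * Y)).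
    { apply Rle_trans with (sqmod (h' z) * (r * r - sqmod z) ^ 2 * ((1 + X) * (1 + Y))).
      - apply Rmult_le_compat.
        + apply Rmult_le_pos; [lra|]. nra.
        + nra.
        + apply Rmult_le_compat_l; auto. nra.
        + nra.
      - eapply Rle_trans; [exact HB|]. right. ring. }
    apply Rmult_le_reg_r in A2; [|nra].
    assert (A3 : sqmod (h' z) * (9 / 16 * (r * r)) * (r * r) <= 2880 * (X ^ 4 * Y ^ 4) * (r * r)) by lra.
    apply Rmult_le_reg_r in A3; [|nra].
    assert (A4 : X ^ 4 * Y ^ 4 <= (3 + m) ^ 2 * (3 + m) ^ 2).
    { apply Rmult_le_compat; auto; apply pow_le; lra. }
    replace ((3 + m) ^ 4) with ((3 + m) ^ 2 * (3 + m) ^ 2) by ring.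
    assert (0 <= (3 + m) ^ 2 * (3 + m) ^ 2) by (apply Rmult_le_pos; apply pow_le; lra). lra. }
  apply Rmult_le_reg_r with r; [lra|].
  replace (72 / r * (3 + m) ^ 2 * r) with (72 * (3 + m) ^ 2) by (field; lra).
  rewrite sqmod_Cmod in S. pose proof (Cmod_ge_0 (h' z)).
  assert (0 <= (3 + m) ^ 2) by (apply pow_le; lra).
  apply Rsqr_incr_0_var; [|lra]. unfold Rsqr.
  replace (72 * (3 + m) ^ 2 * (72 * (3 + m) ^ 2)) with (5184 * (3 + m) ^ 4) by ring. lra.
Qed.

(** Comparison with the equation [v' = A v^2], whose solutions have [1 / v] of constant slope. The
    differentiable [sqrt (9 + |h|^2)] stands in for [3 + |h|], with
    [(3 + |h|)^2 <= 2 * (9 + |h|^2)]; along the ray its inverse drops by at most [2 * A * |z|], that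
    is by at most a quarter of its initial value. *)
Lemma growth_bound (h h' : C -> C) (A d : R) (z : C) : 0 < A ->
  (forall w, Cmod w < d -> cderiv h w (h' w)) ->
  (forall w, Cmod w < d -> Cmod (h' w) <= A * (3 + Cmod (h w)) ^ 2) ->
  Cmod z < d -> Cmod z * (8 * A * (3 + Cmod (h 0%C))) <= 1 ->
  Cmod (h z) <= 2 * (3 + Cmod (h 0%C)).
Proof.
  intros HA Dh HB Hz Hsmall.
  set (E := fun s : R => 9 + sqmod (h (0 + RtoC s * z)%C)).
  set (E1 := fun s : R => 2 * (Re (h (0 + RtoC s * z)%C) * Re (h' (0 + RtoC s * z) * z)%C
     + Im (h (0 + RtoC s * z)%C) * Im (h' (0 + RtoC s * z) * z)%C)).
  assert (PE : forall s, 9 <= E s) by (intros s; unfold E; pose proof (sqmod_ge_0 (h (0 + RtoC s * z)%C)); lra).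
  assert (Hseg : forall s, 0 <= s <= 1 -> Cmod (0 + RtoC s * z)%C < d).
  { intros s Hs. replace (0 + RtoC s * z)%C with (RtoC s * z)%C by ring.
    eapply Rle_lt_trans; [now apply Cmod_scal_le|auto]. }
  assert (DE : forall s, 0 <= s <= 1 -> is_derive E s (E1 s)).
  { intros s Hs. specialize (Hseg s Hs).
    pose proof (Re_deriv_line h 0 z _ s (Dh _ Hseg)) as D1.
    pose proof (Im_deriv_line h 0 z _ s (Dh _ Hseg)) as D2.
    unfold E, E1, sqmod.
    set (X := fun s : R => Re (h (0 + RtoC s * z)%C)) in D1.
    set (Y := fun s : R => Im (h (0 + RtoC s * z)%C)) in D2.
    apply is_derive_ext with (fun t => 9 + (X t * X t + Y t * Y t)); [reflexivity|].
    auto_derive; [repeat split; first [eexists; exact D1|eexists; exact D2]|].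
    rewrite (is_derive_unique (fun x : R => X x) _ _ D1), (is_derive_unique (fun x : R => Y x) _ _ D2).
    unfold X, Y. ring. }
  assert (Dz : forall s, 0 <= s <= 1 ->
    derivable_pt_lim (fun s => / sqrt (E s)) s (- E1 s / (2 * E s * sqrt (E s)))).
  { intros s Hs. apply is_derive_Reals. specialize (DE s Hs). specialize (PE s).
    assert (PS : 0 < sqrt (E s)) by (apply sqrt_lt_R0; lra).
    auto_derive.
    - split; [eexists; exact DE|split; [lra|split; [lra|auto]]].
    - rewrite (is_derive_unique (fun x : R => E x) _ _ DE).
      assert (SS : sqrt (E s) * sqrt (E s) = E s) by (apply sqrt_sqrt; lra).
      set (q := sqrt (E s)) in *. rewrite <- SS. field. lra. }
  destruct (MVT_cor2 _ _ 0 1 Rlt_0_1 Dz) as [s [Hs Hs1]].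
  assert (Q : forall s, sqrt (E s) <= 3 + Cmod (h (0 + RtoC s * z)%C) /\ Cmod (h (0 + RtoC s * z)%C) <= sqrt (E s)).
  { intros t. unfold E. rewrite sqmod_Cmod. pose proof (Cmod_ge_0 (h (0 + RtoC t * z)%C)). split.
    - rewrite <- (sqrt_square (3 + Cmod (h (0 + RtoC t * z)%C))) by lra. apply sqrt_le_1; nra.
    - rewrite <- (sqrt_square (Cmod (h (0 + RtoC t * z)%C))) at 1 by lra. apply sqrt_le_1; nra. }
  assert (PS : forall s, 0 < sqrt (E s)) by (intros t; apply sqrt_lt_R0; specialize (PE t); lra).
  assert (Est : - (2 * A * Cmod z) <= - E1 s / (2 * E s * sqrt (E s))).
  { specialize (Hseg s ltac:(lra)). specialize (HB _ Hseg). specialize (PE s). specialize (PS s).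
    destruct (Q s) as [_ Q2].
    set (u := h (0 + RtoC s * z)%C) in *. set (v := h' (0 + RtoC s * z)%C) in *.
    assert (V : Cmod v <= 2 * A * E s).
    { eapply Rle_trans; [exact HB|]. replace (E s) with (9 + Cmod u * Cmod u)
        by (unfold E; rewrite sqmod_Cmod; reflexivity).
      pose proof (Cmod_ge_0 u). assert (0 <= A * (3 - Cmod u) ^ 2) by (apply Rmult_le_pos; [lra|apply pow2_ge_0]). nra. }
    assert (B1 : E1 s <= 2 * (Cmod u * (Cmod v * Cmod z))).
    { unfold E1. fold u v. apply Rmult_le_compat_l; [lra|].
      rewrite <- Cmod_mult, <- (Cmod_conj u), <- Cmod_mult.
      eapply Rle_trans; [|apply re_le_Cmod]. eapply Rle_trans; [|apply Rle_abs]. right.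
      destruct u as [u1 u2], (v * z)%C as [w1 w2]. simpl. ring. }
    assert (B2 : Cmod u * (Cmod v * Cmod z) <= sqrt (E s) * (2 * A * E s * Cmod z)).
    { pose proof (Cmod_ge_0 u). pose proof (Cmod_ge_0 v). pose proof (Cmod_ge_0 z).
      apply Rmult_le_compat; auto; [nra|]. apply Rmult_le_compat_r; auto. }
    apply Rmult_le_reg_r with (2 * E s * sqrt (E s)); [nra|].
    replace (- E1 s / (2 * E s * sqrt (E s)) * (2 * E s * sqrt (E s))) with (- E1 s) by (field; lra).
    nra. }
  rewrite Rminus_0_r, Rmult_1_r in Hs.
  destruct (Q 0) as [Q1 _], (Q 1) as [_ Q2].
  replace (0 + RtoC 0 * z)%C with (RtoC 0) in Q1 by ring.
  replace (0 + RtoC 1 * z)%C with z in Q2 by ring.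
  pose proof (PS 0) as P0. pose proof (PS 1) as P1.
  set (q0 := sqrt (E 0)) in *. set (q1 := sqrt (E 1)) in *.
  assert (Z : 2 * A * Cmod z <= / (4 * q0)).
  { pose proof (Cmod_ge_0 z). apply Rmult_le_reg_r with (4 * q0); [lra|]. rewrite Rinv_l by lra.
    assert (Cmod z * (8 * A) * q0 <= Cmod z * (8 * A) * (3 + Cmod (h 0%C))).
    { apply Rmult_le_compat_l; auto. nra. } lra. }
  assert (F : / q0 - / (4 * q0) <= / q1) by lra.
  assert (F2 : 3 / (4 * q0) <= / q1) by (replace (3 / (4 * q0)) with (/ q0 - / (4 * q0)) by (field; lra); lra).
  apply Rmult_le_compat_r with (r := 4 * q0 * q1) in F2; [|nra].
  replace (3 / (4 * q0) * (4 * q0 * q1)) with (3 * q1) in F2 by (field; lra).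
  replace (/ q1 * (4 * q0 * q1)) with (4 * q0) in F2 by (field; lra). lra.
Qed.

(** The quadratic bound on [h'] is integrated from 0 by [growth_bound]. The point is the order of
    the quantifiers: [r] and [B] depend on [rad], [M] and [c] only, so one pair will serve for all
    lifts. *)
Lemma landau_bound (rad M : R) (c : C) : 0 < rad -> 1 <= Cmod c <= 2 -> 0 <= M ->
  exists r B, 0 < r < rad /\ forall h : C -> C, smooth rad h -> Cmod (h 0%C) <= M ->
    (forall z, Cmod z < rad -> h z <> 0%C /\ h z <> c) ->
    forall z, Cmod z < r -> Cmod (h z) <= B.
Proof.
  intros Hr Hc HM.
  set (A := 72 / (rad / 2)).
  assert (PA : 0 < A) by (apply Rdiv_lt_0_compat; lra).
  set (e := / (8 * A * (3 + M))).
  assert (Pe0 : 0 < 8 * A * (3 + M)) by (nra).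
  assert (Pe : 0 < e) by now apply Rinv_0_lt_compat.
  exists (Rmin (rad / 4) e), (2 * (3 + M)). split.
  - split; [apply Rmin_pos; lra|]. Rmin_bounds. lra.
  - intros h Sh H0 Hom z Hz.
    destruct (smooth_deriv _ _ Sh) as [h' [Dh Sh']].
    Rmin_bounds.
    apply Rle_trans with (2 * (3 + Cmod (h 0%C))); [|lra].
    apply growth_bound with (h' := h') (A := A) (d := rad / 4); auto; try lra.
    + intros w Hw. apply Dh. lra.
    + intros w Hw. apply (landau_deriv_bound rad (rad / 2) c); auto; lra.
    + pose proof (Cmod_ge_0 z). pose proof (Cmod_ge_0 (h 0%C)).
      apply Rle_trans with (e * (8 * A * (3 + M))).
      * apply Rmult_le_compat; try lra; [|apply Rmult_le_compat_l; lra].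
        apply Rmult_le_pos; lra.
      * unfold e. rewrite Rinv_l; lra.
Qed.

(** * Order of vanishing *)

Lemma cderiv_pow (n : nat) (z : C) : cderiv (fun w => w ^ S n)%C z (RtoC (INR (S n)) * z ^ n)%C.
Proof.
  induction n.
  - replace (RtoC (INR 1) * z ^ 0)%C with (1 * z ^ 0 + z * 0)%C by (simpl; ring).
    apply (cderiv_mult (fun w => w) (fun w => w ^ 0)%C); [apply cderiv_id|exact (cderiv_const 1 z)].
  - replace (RtoC (INR (S (S n))) * z ^ S n)%C with (1 * z ^ S n + z * (RtoC (INR (S n)) * z ^ n))%C.
    + apply (cderiv_mult (fun w => w) (fun w => w ^ S n)%C); [apply cderiv_id|auto].
    + rewrite (S_INR (S n)), RtoC_plus. simpl (z ^ S n)%C. ring.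
Qed.

Lemma ccont_pow (n : nat) (z : C) : ccont (fun w => w ^ n)%C z.
Proof.
  destruct n; [exact (clim_const 1 z)|]. eapply cderiv_cont, cderiv_pow.
Qed.

Lemma clim_bounded (f : C -> C) (z l : C) : clim f z l ->
  exists d, 0 < d /\ forall w, w <> z -> Cmod (w - z) < d -> Cmod (f w) <= 1 + Cmod l.
Proof.
  intros H. destruct (H 1 Rlt_0_1) as [d [P Q]]. exists d. split; auto. intros w Hw Hd.
  specialize (Q w Hw Hd). pose proof (Cmod_bound_near (f w) l). lra.
Qed.

Lemma ccont_bounded (f : C -> C) (z : C) : ccont f z ->
  exists d, 0 < d /\ forall w, Cmod (w - z) < d -> Cmod (f w) <= 1 + Cmod (f z).
Proof.
  intros H. destruct (ccont_all f z H 1 Rlt_0_1) as [d [P Q]]. exists d. split; auto. intros w Hd.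
  specialize (Q w Hd). pose proof (Cmod_bound_near (f w) (f z)). lra.
Qed.

(** By induction on [p] through the derivative: when [g 0 = 0], a limit [c] of [g' / w^k] integrates
    to the limit [c / (k + 1)] of [g / w^(k+1)], and a bound [M |w|^p] of [g'] to a bound
    [M |w|^(p+1)] of [g], both by the mean value inequality. *)
Lemma order_dichotomy_upto (rad : R) (p : nat) (g : C -> C) : 0 < rad -> smooth rad g ->
  (exists k c, c <> RtoC 0 /\ clim (fun w => g w / w ^ k)%C 0 c) \/
  (exists M d, 0 < d <= rad /\ forall w, Cmod w < d -> Cmod (g w) <= M * Cmod w ^ p).
Proof.
  intros Hr. revert g. induction p; intros g Sg.
  - right. assert (C0 : ccont g 0) by (apply (Sg O); now rewrite Cmod_0).
    destruct (ccont_bounded g 0 C0) as [d [Pd Hd]].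
    exists (1 + Cmod (g 0%C)), (Rmin d rad). split; [split; [now apply Rmin_pos|apply Rmin_r]|].
    intros w Hw. simpl. rewrite Rmult_1_r. apply Hd. replace (w - 0)%C with w by ring.
    Rmin_bounds; lra.
  - destruct (smooth_deriv _ _ Sg) as [g' [Dg Sg']].
    assert (C0 : ccont g 0) by (apply (Sg O); now rewrite Cmod_0).
    destruct (Ceq_dec (g 0%C) 0) as [E|E].
    2:{ left. exists O, (g 0%C). split; auto.
        apply clim_ext with g; auto. intros w _. simpl. field. }
    destruct (IHp g' Sg') as [[k [c [Hc L]]]|[M [d [Pd Hd]]]].
    + left. exists (S k), (c / RtoC (INR (S k)))%C.
      assert (NS : RtoC (INR (S k)) <> 0%C).
      { intros F. apply RtoC_inj in F. pose proof (lt_0_INR (S k) ltac:(lia)). lra. }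
      split.
      { intros F. apply Hc. replace c with (c / RtoC (INR (S k)) * RtoC (INR (S k)))%C by (field; auto).
        rewrite F. ring. }
      intros e He. destruct (L (e / 2) ltac:(lra)) as [d [Pd Hd]].
      exists (Rmin d rad). split; [now apply Rmin_pos|]. intros w Nw Hw.
      replace (w - 0)%C with w in Hw by ring.
      Rmin_bounds.
      set (F := fun z => (g z - c / RtoC (INR (S k)) * z ^ S k)%C).
      set (F' := fun z => (g' z - c * z ^ k)%C).
      assert (DF : forall z, Cmod z < rad -> cderiv F z (F' z)).
      { intros z Hz. unfold F'.
        replace (g' z - c * z ^ k)%C
          with (g' z - c / RtoC (INR (S k)) * (RtoC (INR (S k)) * z ^ k))%C by (field; auto).
        apply cderiv_minus; auto. apply (cderiv_scal _ (fun z => z ^ S k)%C), cderiv_pow. }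
      assert (BF : forall z, z <> RtoC 0 -> Cmod z <= Cmod w -> Cmod (F' z) <= e / 2 * Cmod w ^ k).
      { intros z Nz Hz. specialize (Hd z Nz). replace (z - 0)%C with z in Hd by ring.
        specialize (Hd ltac:(lra)).
        assert (Nk : (z ^ k)%C <> 0%C) by now apply Cpow_nz.
        replace (F' z) with ((g' z / z ^ k - c) * z ^ k)%C by (unfold F'; field; auto).
        rewrite Cmod_mult, Cmod_pow. apply Rmult_le_compat; try apply Cmod_ge_0.
        - apply pow_le, Cmod_ge_0.
        - lra.
        - apply pow_incr. split; [apply Cmod_ge_0|auto]. }
      assert (Pw : 0 < Cmod w) by now apply Cmod_gt_0.
      (* The segment from 0 to [w] contains 0, where the punctured limit says nothing; continuity of
         [F'] supplies the bound there. *)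
      assert (BF0 : Cmod (F' 0%C) <= e / 2 * Cmod w ^ k).
      { apply le_epsilon. intros e' He'.
        assert (CF : ccont F' 0).
        { apply clim_minus; [apply (Sg' O); rewrite Cmod_0; auto|].
          apply clim_mult; [apply clim_const|apply ccont_pow]. }
        destruct (CF e' He') as [d' [Pd' Hd']].
        destruct (exists_near 0 (Rmin d' (Cmod w))) as [z [Nz Hz]]; [now apply Rmin_pos|].
        Rmin_bounds.
        specialize (Hd' z Nz ltac:(lra)). replace (z - 0)%C with z in Hz by ring.
        specialize (BF z Nz ltac:(lra)).
        pose proof (Cmod_bound_near (F' 0%C) (F' z)). rewrite Cmod_minus_sym in H3. lra. }
      assert (BFw : Cmod (F w - F 0)%C <= e / 2 * Cmod w ^ k * Cmod w).
      { apply (complex_mvt_0 rad) with F'; auto; [lra|]. intros s Hs.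
        destruct (Ceq_dec (RtoC s * w) 0) as [->|N]; auto.
        apply BF; auto. now apply Cmod_scal_le. }
      replace (F 0%C) with (RtoC 0) in BFw by (unfold F; rewrite E; simpl; ring).
      replace (F w - 0)%C with (F w) in BFw by ring.
      assert (Nk : (w ^ S k)%C <> 0%C) by now apply Cpow_nz.
      replace (g w / w ^ S k - c / RtoC (INR (S k)))%C with (F w / w ^ S k)%C
        by (unfold F; field; auto).
      rewrite Cmod_div, Cmod_pow by auto.
      apply Rmult_lt_reg_r with (Cmod w ^ S k); [now apply pow_lt|].
      assert (Pk : 0 < Cmod w ^ k) by now apply pow_lt.
      unfold Rdiv at 1. rewrite Rmult_assoc, Rinv_l, Rmult_1_r by (simpl; nra).
      simpl. eapply Rle_lt_trans; [exact BFw|]. assert (0 < Cmod w ^ k * Cmod w) by nra. nra.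
    + right. exists M, d. split; auto. intros w Hw.
      replace (M * Cmod w ^ S p) with (M * Cmod w ^ p * Cmod w) by (simpl; ring).
      replace (g w) with (g w - g 0)%C by (rewrite E; ring).
      assert (M0 : 0 <= M * Cmod w ^ p) by (eapply Rle_trans; [apply Cmod_ge_0|now apply Hd]).
      apply (complex_mvt_0 rad) with g'; auto; [lra|]. intros s Hs.
        pose proof (Cmod_scal_le s w Hs) as Hle.
        specialize (Hd (RtoC s * w)%C ltac:(lra)). eapply Rle_trans; [exact Hd|].
        rewrite Cmod_mult, Cmod_R, Rabs_pos_eq, Rpow_mult_distr by lra.
        replace (M * (s ^ p * Cmod w ^ p)) with (s ^ p * (M * Cmod w ^ p)) by ring.
        assert (s ^ p <= 1) by (rewrite <- (pow1 p); apply pow_incr; lra).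
        rewrite <- (Rmult_1_l (M * Cmod w ^ p)) at 2. apply Rmult_le_compat_r; auto.
Qed.

(** If no finite order exists, [schwarz_order] holds for every exponent [m] with the same constant
    [B], so [|g w| * (r/2)^m <= B * |w|^m] for all [m >= 1]; for [|w| < r/2] this forces
    [g w = 0]. *)
Lemma finite_order_or_zero (rad : R) (g : C -> C) : 0 < rad -> smooth rad g -> g 0%C = 0%C ->
  (exists p c, (1 <= p)%nat /\ c <> RtoC 0 /\ clim (fun w => g w / w ^ p)%C 0 c) \/
  (exists d, 0 < d /\ forall w, Cmod w < d -> g w = 0%C).
Proof.
  intros Hr Sg G0.
  assert (C0 : ccont g 0) by (apply (Sg O); now rewrite Cmod_0).
  destruct (classic (exists k c, c <> RtoC 0 /\ clim (fun w => g w / w ^ k)%C 0 c)) as [[k [c [Hc L]]]|N].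
  - left. exists k, c. split; [|split; auto].
    destruct k; [|lia]. exfalso. apply Hc. apply (clim_unique (fun w => g w / w ^ 0)%C 0); auto.
    unfold ccont in C0. rewrite G0 in C0. apply clim_ext with (2 := C0). intros w _. simpl. field.
  - right. destruct (ccont_bounded g 0 C0) as [d [Pd Hd]].
    set (r := Rmin d rad). assert (Pr : 0 < r) by now apply Rmin_pos.
    assert (R1 : r <= d) by apply Rmin_l. assert (R2 : r <= rad) by apply Rmin_r.
    exists (r / 2). split; [lra|]. intros w Hw.
    destruct (Ceq_dec (g w) 0) as [E|E]; auto. exfalso.
    set (B := 1 + Cmod (g 0%C)).
    destruct (pow_grows (r / 2) (Cmod w) (Cmod (g w)) B) as [m [Hm1 Hm2]].
    + apply Cmod_ge_0.
    + auto.
    + now apply Cmod_gt_0.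
    + destruct (order_dichotomy_upto rad m g Hr Sg) as [?|[M [d' [Pd' HM]]]]; [contradiction|].
      assert (Cmod (g w) * (r / 2) ^ m <= B * Cmod w ^ m).
      { apply (schwarz_order r (r / 2) B M d' m g); auto; try lra.
        - apply (holo_mono 2 r rad); auto.
        - intros z Hz. apply Hd. replace (z - 0)%C with z by ring. lra. }
      lra.
Qed.

(** * Holomorphic motions of the singular orbit *)

(** [T_w w] is the covering [x |-> e^(2ix)] of the punctured plane followed by the Moebius map
    [e |-> w (e - 1) / (e + 1)]. Poles correspond to [e = -1], and the asymptotic values [w] and
    [-w] to the omitted [e = oo] and [e = 0]. *)
Definition expi2 (x : C) : C := Cexp (2 * Ci * x).

Lemma expi2_plus (x y : C) : expi2 (x + y) = (expi2 x * expi2 y)%C.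
Proof. unfold expi2. rewrite <- Cexp_plus. f_equal. ring. Qed.

Lemma expi2_opp (x : C) : expi2 (- x) = (/ expi2 x)%C.
Proof. unfold expi2. rewrite <- Cexp_opp. f_equal. ring. Qed.

Lemma expi2_neq_0 (x : C) : expi2 x <> 0%C.
Proof. apply Cexp_neq_0. Qed.

Lemma expi2_0 : expi2 0 = 1%C.
Proof. unfold expi2. replace (2 * Ci * 0)%C with (RtoC 0) by ring. apply Cexp_0. Qed.

Lemma cderiv_expi2 (x : C) : cderiv expi2 x (2 * Ci * expi2 x)%C.
Proof.
  replace (2 * Ci * expi2 x)%C with (Cexp (2 * Ci * x) * (2 * Ci * 1))%C by (unfold expi2; ring).
  apply (cderiv_comp (fun x => 2 * Ci * x)%C Cexp); [|apply cderiv_Cexp].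
  apply (cderiv_scal _ (fun x => x)), cderiv_id.
Qed.

Lemma smooth_expi2 (rad : R) (f : C -> C) : smooth rad f -> smooth rad (fun z => expi2 (f z)).
Proof.
  intros H n. apply (holo_Cexp n rad (fun z => 2 * Ci * f z)%C).
  apply holo_mult; auto. apply holo_const.
Qed.

Lemma RtoC_neq_0 (x : R) : x <> 0 -> RtoC x <> 0%C.
Proof. intros H E. apply H. now apply RtoC_inj. Qed.

Lemma Ci_neq_0 : Ci <> 0%C.
Proof. intros H. injection H. lra. Qed.

Lemma Ci_sqr : (Ci * Ci)%C = (- (1))%C.
Proof. unfold Ci, Cmult, Copp, RtoC. simpl. f_equal; ring. Qed.

Lemma T_w_mobius (w x : C) : (expi2 x + 1)%C <> 0%C ->
  T_w w x = (w * (expi2 x - 1) / (expi2 x + 1))%C.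
Proof.
  intros H. unfold T_w, Ctan, Csin, Ccos.
  assert (E2 : expi2 x = (Cexp (Ci * x) * Cexp (Ci * x))%C).
  { unfold expi2. rewrite <- Cexp_plus. f_equal. ring. }
  rewrite Cexp_opp, E2 in *. pose proof (Cexp_neq_0 (Ci * x)) as N.
  set (a := Cexp (Ci * x)) in *. pose proof Ci_neq_0.
  assert (H2 : RtoC 2 <> 0%C) by (apply RtoC_neq_0; lra).
  field. repeat split; auto.
Qed.

Lemma T_w_rel (w x : C) : (expi2 x + 1)%C <> 0%C ->
  (expi2 x * (w - T_w w x) = w + T_w w x)%C.
Proof. intros H. rewrite T_w_mobius by auto. field. auto. Qed.

Lemma T_w_odd (w x : C) : T_w w (- x) = (- T_w w x)%C.
Proof.
  unfold T_w, Ctan, Csin, Ccos, Cdiv.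
  replace (Ci * - x)%C with (- (Ci * x))%C by ring.
  replace (- - (Ci * x))%C with (Ci * x)%C by ring.
  replace (Cexp (- (Ci * x)) + Cexp (Ci * x))%C with (Cexp (Ci * x) + Cexp (- (Ci * x)))%C by ring.
  ring.
Qed.

(** Injectivity of the inverse Moebius map, written as a relation so that no denominator has to be
    kept away from zero. *)
Lemma cayley_inj (e x a b : C) : x <> 0%C ->
  (e * (x - a) = x + a)%C -> (e * (x - b) = x + b)%C -> a = b.
Proof.
  intros Hx Ha Hb. apply Cminus_eq_0.
  replace (a - b)%C with (/ 2 * / x * ((x + a) * (x - b) - (x + b) * (x - a)))%C by (field; auto).
  rewrite <- Ha, <- Hb. ring.
Qed.

Definition orb (w : C) (i : nat) : C := Nat.iter i (T_w w) w.

Fixpoint csum (f : nat -> C) (n : nat) : C :=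
  match n with O => 0%C | S n => (csum f n + f n)%C end.

Lemma csum_ext (f g : nat -> C) (n : nat) : (forall i, (i < n)%nat -> f i = g i) -> csum f n = csum g n.
Proof. induction n; intros H; simpl; auto. rewrite IHn, H; auto. Qed.

Lemma csum_scal (a : C) (f : nat -> C) (n : nat) : csum (fun i => a * f i)%C n = (a * csum f n)%C.
Proof. induction n; simpl; [ring|]. rewrite IHn. ring. Qed.

Lemma csum_minus (f g : nat -> C) (n : nat) :
  csum (fun i => f i - g i)%C n = (csum f n - csum g n)%C.
Proof. induction n; simpl; [ring|]. rewrite IHn. ring. Qed.

Lemma csum_shift (f : nat -> C) (n : nat) : csum (fun i => f (S i)) n = (csum f (S n) - f O)%C.
Proof. induction n; simpl; [ring|]. rewrite IHn. simpl. ring. Qed.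

Lemma csum_bound (f g : nat -> C) (b : R) (n : nat) : (forall i, (i < n)%nat -> Cmod (g i) <= b) ->
  Cmod (csum (fun i => f i * g i)%C n) <= Re (csum (fun i => RtoC (Cmod (f i))) n) * b.
Proof.
  induction n; intros H; cbn [csum].
  - rewrite Cmod_0. simpl. lra.
  - eapply Rle_trans; [apply Cmod_triangle|]. rewrite Re_plus, Rmult_plus_distr_r.
    apply Rplus_le_compat; auto. rewrite Cmod_mult. simpl.
    apply Rmult_le_compat_l; [apply Cmod_ge_0|]. apply H. lia.
Qed.

Lemma uniform_radius (n : nat) (Q : nat -> C -> Prop) :
  (forall i, (i <= n)%nat -> exists d, 0 < d /\ forall z, Cmod z < d -> Q i z) ->
  exists d, 0 < d /\ forall z, Cmod z < d -> forall i, (i <= n)%nat -> Q i z.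
Proof.
  induction n; intros H.
  - destruct (H O (le_n 0)) as [d [P Hd]]. exists d. split; auto. intros z Hz i Hi.
    replace i with O by lia. auto.
  - destruct IHn as [d1 [P1 H1]]; [intros; apply H; lia|].
    destruct (H (S n) (le_n _)) as [d2 [P2 H2]].
    exists (Rmin d1 d2). split; [now apply Rmin_pos|]. intros z Hz i Hi.
    Rmin_bounds.
    destruct (Nat.eq_dec i (S n)) as [->|N]; [apply H2; lra|apply H1; [lra|lia]].
Qed.

Lemma ccont_near_0 (f : C -> C) : ccont f 0 -> f 0%C <> 0%C ->
  exists d, 0 < d /\ forall z, Cmod z < d -> f z <> 0%C.
Proof.
  intros H N. destruct (ccont_neq_0_loc f 0 H N) as [d [P Hd]]. exists d. split; auto.
  intros z Hz. apply Hd. now replace (z - 0)%C with z by ring.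
Qed.

Lemma orb_smooth (t : C) (n : nat) :
  (forall i, (i < n)%nat -> (expi2 (orb t i) + 1)%C <> 0%C) ->
  exists rad, 0 < rad /\ (forall i, (i <= n)%nat -> smooth rad (fun l => orb (t + l) i)) /\
    (forall i l, (i < n)%nat -> Cmod l < rad -> (expi2 (orb (t + l) i) + 1)%C <> 0%C).
Proof.
  induction n; intros H.
  - exists 1. split; [lra|]. split; [|intros; lia]. intros i Hi. replace i with O by lia.
    intros k. apply holo_plus; [apply holo_const|apply holo_id].
  - destruct IHn as [r1 [P1 [S1 N1]]]; [intros; apply H; lia|].
    set (g := fun l => (expi2 (orb (t + l) n) + 1)%C).
    assert (Sg : smooth r1 g).
    { intros k. apply holo_plus; [|apply holo_const]. apply smooth_expi2. now apply S1. }
    destruct (ccont_near_0 g) as [d [Pd Hd]].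
    + apply (Sg O). now rewrite Cmod_0.
    + unfold g. replace (t + 0)%C with t by ring. apply H. lia.
    + set (r := Rmin r1 d). assert (Pr : 0 < r) by now apply Rmin_pos.
      assert (R1 : r <= r1) by apply Rmin_l. assert (R2 : r <= d) by apply Rmin_r.
      exists r. split; auto. split.
      * intros i Hi. destruct (Nat.eq_dec i (S n)) as [->|N].
        -- intros k. apply holo_ext with (fun l => (t + l) * (expi2 (orb (t + l) n) - 1) / (expi2 (orb (t + l) n) + 1))%C.
           { intros z Hz. symmetry. apply (T_w_mobius (t + z) (orb (t + z) n)). apply Hd. lra. }
           assert (Se : holo k r (fun l => expi2 (orb (t + l) n))).
           { apply (holo_mono k r r1); auto. apply (smooth_expi2 r1 (fun l => orb (t + l) n)). now apply S1. }
           apply holo_div.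
           ++ intros z Hz. apply Hd. lra.
           ++ apply holo_mult; [apply holo_plus; [apply holo_const|apply holo_id]|].
              apply holo_minus; auto. apply holo_const.
           ++ apply holo_plus; auto. apply holo_const.
        -- intros k. apply (holo_mono k r r1); auto. apply S1. lia.
      * intros i l Hi Hl. destruct (Nat.eq_dec i n) as [->|N]; [apply Hd; lra|apply N1; [lia|lra]].
Qed.

(** * Motions of the orbit and their lifts *)

Section Motion.

Variables (t c0 : C) (K : nat).
Hypothesis K_pos : (1 <= K)%nat.
Hypothesis c0_pole : expi2 c0 = (- (1))%C.
Hypothesis c0_mod : 1 <= Cmod c0 <= 2.
Hypothesis no_pole : forall i, (i < K)%nat -> (expi2 (orb t i) + 1)%C <> 0%C.
Hypothesis orb_K : orb t K = c0.

Let z (i : nat) : C := orb t i.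

Lemma c0_neq_0 : c0 <> 0%C.
Proof. apply Cmod_gt_0. lra. Qed.

(** [T] fixes 0, so an orbit that meets 0 stays there and never reaches [c0]. *)
Lemma orb_neq_0 (i : nat) : (i <= K)%nat -> z i <> 0%C.
Proof.
  intros Hi E. apply c0_neq_0. rewrite <- orb_K.
  assert (G : forall j, orb t (i + j) = 0%C).
  { induction j.
    - now rewrite Nat.add_0_r.
    - rewrite Nat.add_succ_r. change (T_w t (orb t (i + j)) = 0%C). rewrite IHj.
      assert (N2 : (1 + 1)%C <> 0%C) by (rewrite <- RtoC_plus; apply RtoC_neq_0; lra).
      rewrite T_w_mobius; rewrite expi2_0; auto. field. }
  replace K with (i + (K - i))%nat by lia. apply G.
Qed.

(** [T] is odd, so [z i = z j] or [z i = - z j] persists along the orbit up to sign; when the later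
    index arrives at [K], the earlier one would sit at a pole before time [K]. *)
Lemma orb_neq (i j : nat) : (i < j <= K)%nat -> z i <> z j /\ z i <> (- z j)%C.
Proof.
  intros Hij.
  assert (G : forall e : C, e = 1%C \/ e = (- (1))%C -> z i <> (e * z j)%C).
  { intros e He E.
    assert (Shift : forall k, orb t (i + k) = (e * orb t (j + k))%C).
    { induction k.
      - now rewrite !Nat.add_0_r.
      - rewrite !Nat.add_succ_r. change (T_w t (orb t (i + k)) = e * T_w t (orb t (j + k)))%C.
        rewrite IHk. destruct He as [->| ->].
        + now rewrite !Cmult_1_l.
        + replace (- (1) * orb t (j + k))%C with (- orb t (j + k))%C by ring. rewrite T_w_odd. ring. }
    specialize (Shift (K - j)%nat). replace (j + (K - j))%nat with K in Shift by lia.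
    apply (no_pole (i + (K - j))%nat); [lia|]. rewrite Shift, orb_K.
    destruct He as [->| ->].
    - rewrite Cmult_1_l, c0_pole. ring.
    - replace (- (1) * c0)%C with (- c0)%C by ring. rewrite expi2_opp, c0_pole. field. }
  split; intros E.
  - apply (G 1%C); auto. rewrite E. ring.
  - apply (G (- (1))%C); auto. rewrite E. ring.
Qed.

(** Each [h i] with [i < K] omits the two values 0 and [c0 = h K l], as Landau's theorem requires.
    The radius is a parameter because lifting does not shrink it. *)
Definition motion (rad : R) (h : nat -> C -> C) : Prop :=
  (forall i, (i <= K)%nat -> smooth rad (h i)) /\
  (forall i, (i <= K)%nat -> h i 0%C = z i) /\
  (forall l, Cmod l < rad ->
     h K l = c0 /\ (forall i, (i <= K)%nat -> h i l <> 0%C) /\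
     (forall i j, (i < j <= K)%nat -> h i l <> h j l /\ h i l <> (- h j l)%C)).

(* The last condition in [motion] gives [h 0 l <> h i l] and [h 0 l <> - h i l]: the points to
   be lifted through [T] avoid its asymptotic values. *)
Lemma motion_lift (rad : R) (h : nat -> C -> C) : 0 < rad -> motion rad h ->
  exists h', motion rad h' /\ forall i l, (i < K)%nat -> Cmod l < rad ->
    (expi2 (h' i l) * (h O l - h (S i) l) = h O l + h (S i) l)%C.
Proof.
  intros Hr [Sh [H0 Hm]].
  assert (M1 : forall i l, (i < K)%nat -> Cmod l < rad -> (h O l - h (S i) l)%C <> 0%C).
  { intros i l Hi Hl. apply Cminus_neq_0. destruct (Hm l Hl) as [_ [_ A]]. apply (A O (S i)). lia. }
  assert (M2 : forall i l, (i < K)%nat -> Cmod l < rad -> (h O l + h (S i) l)%C <> 0%C).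
  { intros i l Hi Hl E. destruct (Hm l Hl) as [_ [_ A]]. apply (A O (S i)); [lia|].
    replace (h O l) with (h O l + h (S i) l - h (S i) l)%C by ring. rewrite E. ring. }
  assert (H2i : (2 * Ci)%C <> 0%C) by (apply Cmult_neq_0; [apply RtoC_neq_0; lra|apply Ci_neq_0]).
  assert (Lift : forall i, exists g, (i < K)%nat -> smooth rad g /\ g 0%C = z i /\
    forall l, Cmod l < rad -> (expi2 (g l) * (h O l - h (S i) l) = h O l + h (S i) l)%C).
  { intros i. destruct (le_lt_dec K i) as [L|L]; [exists (fun l => l); lia|].
    (* [u] is the value that [expi2] must take at the lifted point. Its logarithm exists on the
       whole disc, since the moving points avoid the asymptotic values, and starts at the branch
       given by [z i]. *)
    set (u := fun l => ((h O l + h (S i) l) / (h O l - h (S i) l))%C).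
    destruct (log_exists rad u (2 * Ci * z i)%C) as [G [SG [G0 HG]]]; auto.
    - intros n. apply holo_div; [intros l Hl; now apply M1| |].
      + apply holo_plus; [apply (Sh O)|apply (Sh (S i))]; lia.
      + apply holo_minus; [apply (Sh O)|apply (Sh (S i))]; lia.
    - intros l Hl. apply Cmult_neq_0; [now apply M2|]. 
      intros F. apply (M1 i l L Hl). 
      assert (h O l - h (S i) l = (h O l - h (S i) l) * (h O l - h (S i) l) * / (h O l - h (S i) l))%C
        by (field; now apply M1). rewrite H, F. ring.
    - assert (N0 := M1 i 0%C L ltac:(now rewrite Cmod_0)).
      unfold u. rewrite !H0 in * by lia. change (expi2 (z i) = (z 0 + z (S i)) / (z 0 - z (S i)))%C.
      pose proof (T_w_rel t (z i) (no_pole i L)) as T.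
      change (T_w t (z i)) with (z (S i)) in T. change (z O) with t in *.
      rewrite <- T. field. auto.
    - exists (fun l => / (2 * Ci) * G l)%C. intros _. split; [|split].
      + intros n. apply holo_mult; auto. apply holo_const.
      + rewrite G0. field. apply Ci_neq_0.
      + intros l Hl. unfold expi2. replace (2 * Ci * (/ (2 * Ci) * G l))%C with (G l).
        * rewrite HG by auto. unfold u. field. now apply M1.
        * field. apply Ci_neq_0. }
  destruct (functional_choice _ Lift) as [g Hg].
  (* The last point is not lifted: it is put back at [c0]. *)
  set (h' := fun i => if lt_dec i K then g i else fun _ => c0).
  assert (Eg : forall i, (i < K)%nat -> h' i = g i).
  { intros i Hi. unfold h'. destruct (lt_dec i K); [auto|lia]. }
  assert (EK : h' K = fun _ => c0).
  { unfold h'. destruct (lt_dec K K); [lia|auto]. }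
  assert (Rel : forall i l, (i < K)%nat -> Cmod l < rad ->
    (expi2 (h' i l) * (h O l - h (S i) l) = h O l + h (S i) l)%C).
  { intros i l Hi Hl. rewrite Eg by auto. now apply Hg. }
  exists h'. split; auto. split; [|split].
  - intros i Hi. destruct (Nat.eq_dec i K) as [->|N].
    + rewrite EK. intros n. apply holo_const.
    + rewrite Eg by lia. apply Hg. lia.
  - intros i Hi. destruct (Nat.eq_dec i K) as [->|N].
    + rewrite EK. symmetry. apply orb_K.
    + rewrite Eg by lia. apply Hg. lia.
  - intros l Hl. destruct (Hm l Hl) as [HK [Hn Hd]].
    split; [now rewrite EK|split].
    + intros i Hi. destruct (Nat.eq_dec i K) as [->|N]; [rewrite EK; apply c0_neq_0|].
      intros E. specialize (Rel i l ltac:(lia) Hl). rewrite E, expi2_0 in Rel.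
      apply (Hn (S i)); [lia|]. apply (cayley_inj 1 (h O l)); auto; [apply Hn; lia|ring].
    + intros i j Hij. pose proof (Rel i l ltac:(lia) Hl) as Ri.
      assert (Hn0 : h O l <> 0%C) by (apply Hn; lia).
      destruct (Nat.eq_dec j K) as [->|N].
      * rewrite EK.
        (* A lift never lands on a pole: there the relation would read [- (a - b) = a + b] with
           [a = h O l], and force [a = 0]. *)
        assert (P : forall x, expi2 x = (- (1))%C -> h' i l <> x).
        { intros x Hx E. rewrite E, Hx in Ri. apply Hn0.
          replace (h O l) with (/ 2 * ((h O l + h (S i) l) - - (1) * (h O l - h (S i) l)))%C by field.
          rewrite Ri. ring. }
        split; apply P; auto. rewrite expi2_opp, c0_pole. field. auto.
      * pose proof (Rel j l ltac:(lia) Hl) as Rj.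
        destruct (Hd (S i) (S j) ltac:(lia)) as [D1 D2]. split; intros E; rewrite E in Ri.
        -- apply D1. now apply (cayley_inj (expi2 (h' j l)) (h O l)).
        -- apply D2. rewrite expi2_opp in Ri. pose proof (expi2_neq_0 (h' j l)) as Ne.
           replace (h (S i) l) with (- - h (S i) l)%C by ring. f_equal.
           apply (cayley_inj (expi2 (h' j l)) (h O l)); auto.
           replace (h O l + - h (S i) l)%C with (h O l - h (S i) l)%C by ring.
           replace (h O l - - h (S i) l)%C with (h O l + h (S i) l)%C by ring.
           rewrite <- Ri. field. auto.
Qed.

(** The perturbed orbit with its last point frozen at [c0]. All the conditions are open and finite
    in number, and at [l = 0] they are [orb_neq_0] and [orb_neq]. The clauses before the last one
    record nonvanishing needed to linearise the lifting. *)
Lemma motion_initial : exists rad, 0 < rad /\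
  (forall i, (i <= K)%nat -> smooth rad (fun l => orb (t + l) i)) /\
  (forall i l, (i < K)%nat -> Cmod l < rad -> (expi2 (orb (t + l) i) + 1)%C <> 0%C) /\
  (forall i l, (i < K)%nat -> Cmod l < rad -> (orb (t + l) 0 + orb (t + l) (S i))%C <> 0%C) /\
  motion rad (fun i => if lt_dec i K then fun l => orb (t + l) i else fun _ => c0).
Proof.
  destruct (orb_smooth t K no_pole) as [r0 [P0 [S0 N0]]].
  set (h := fun i => if lt_dec i K then fun l => orb (t + l) i else fun _ => c0).
  assert (Sh : forall i, (i <= K)%nat -> smooth r0 (h i)).
  { intros i Hi. unfold h. destruct (lt_dec i K); [now apply S0|]. intros k. apply holo_const. }
  assert (H0 : forall i, (i <= K)%nat -> h i 0%C = z i).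
  { intros i Hi. unfold h, z. destruct (lt_dec i K); [now replace (t + 0)%C with t by ring|].
    replace i with K by lia. now rewrite orb_K. }
  assert (C0 : forall i, (i <= K)%nat -> ccont (h i) 0).
  { intros i Hi. apply (Sh i Hi O). now rewrite Cmod_0. }
  destruct (uniform_radius K (fun i l => h i l <> 0%C)) as [r1 [P1 H1]].
  { intros i Hi. apply ccont_near_0; auto. rewrite H0 by auto. now apply orb_neq_0. }
  destruct (uniform_radius K (fun i l => forall j, (j <= K)%nat -> (i < j)%nat ->
    h i l <> h j l /\ h i l <> (- h j l)%C)) as [r2 [P2 H2]].
  { intros i Hi.
    destruct (uniform_radius K (fun j l => (i < j)%nat -> h i l <> h j l /\ h i l <> (- h j l)%C)) as [d [Pd Hd]].
    - intros j Hj. destruct (le_lt_dec j i) as [L|L]; [exists 1; split; [lra|lia]|].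
      destruct (orb_neq i j ltac:(lia)) as [A1 A2].
      destruct (ccont_near_0 (fun l => h i l - h j l)%C) as [d1 [Q1 B1]].
      { apply clim_minus; now apply C0. }
      { rewrite !H0 by auto. now apply Cminus_neq_0. }
      destruct (ccont_near_0 (fun l => h i l - - h j l)%C) as [d2 [Q2 B2]].
      { apply clim_minus; [now apply C0|]. apply clim_opp. now apply C0. }
      { rewrite !H0 by auto. now apply Cminus_neq_0. }
      exists (Rmin d1 d2). split; [now apply Rmin_pos|]. intros l Hl _.
      Rmin_bounds.
      split; intros E.
      + apply (B1 l ltac:(lra)). rewrite E. ring.
      + apply (B2 l ltac:(lra)). rewrite E. ring.
    - exists d. split; auto. }
  destruct (uniform_radius (K - 1) (fun i l => (orb (t + l) 0 + orb (t + l) (S i))%C <> 0%C)) as [r3 [P3 H3]].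
  { intros i Hi. apply ccont_near_0.
    - apply clim_plus.
      + apply (S0 O ltac:(lia) O). now rewrite Cmod_0.
      + apply (S0 (S i) ltac:(lia) O). now rewrite Cmod_0.
    - replace (t + 0)%C with t by ring. intros E.
      destruct (orb_neq 0 (S i) ltac:(lia)) as [_ A]. apply A. unfold z.
      replace (orb t 0) with (orb t 0 + orb t (S i) - orb t (S i))%C by ring. rewrite E. ring. }
  set (r := Rmin (Rmin r0 r1) (Rmin r2 r3)).
  assert (Pr : 0 < r) by (repeat apply Rmin_pos; auto).
  assert (L : r <= r0 /\ r <= r1 /\ r <= r2 /\ r <= r3).
  { unfold r. Rmin_bounds. lra. }
  exists r. split; [auto|split; [|split; [|split]]].
  - intros i Hi n. apply (holo_mono n r r0); [lra|]. now apply S0.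
  - intros i l Hi Hl. apply N0; auto; lra.
  - intros i l Hi Hl. apply H3; [lra|lia].
  - split; [|split].
    + intros i Hi n. apply (holo_mono n r r0); [lra|]. now apply Sh.
    + exact H0.
    + intros l Hl. repeat apply conj.
      * unfold h. destruct (lt_dec K K); [lia|auto].
      * intros i Hi. apply (H1 l ltac:(lra) i Hi).
      * intros i j Hij. apply (H2 l ltac:(lra) i ltac:(lia) j ltac:(lia) ltac:(lia)).
Qed.

(** * Linearisation of the lifting *)

(** This is [T'(z i)]: from [tan' = 1 + tan^2] one gets [T' = i (t^2 - T^2) / t]. *)
Definition tau (i : nat) : C := (Ci * (z 0 * z 0 - z (S i) * z (S i)) / z 0)%C.

Lemma tau_neq_0 (i : nat) : (i < K)%nat -> tau i <> 0%C.
Proof.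
  intros Hi. destruct (orb_neq 0 (S i) ltac:(lia)) as [A1 A2].
  assert (N0 : z 0 <> 0%C) by (apply orb_neq_0; lia).
  assert (Inv : (/ z 0)%C <> 0%C).
  { intros F. apply (RtoC_neq_0 1); [lra|]. replace (RtoC 1) with (z 0 * / z 0)%C by (field; auto). rewrite F. ring. }
  unfold tau. apply Cmult_neq_0; auto. apply Cmult_neq_0; [apply Ci_neq_0|].
  replace (z 0 * z 0 - z (S i) * z (S i))%C with ((z 0 - z (S i)) * (z 0 - - z (S i)))%C by ring.
  apply Cmult_neq_0; now apply Cminus_neq_0.
Qed.

(** Factoring [x] out of [expi2 x - 1] linearises at 0 without dividing by the displacement, which
    may vanish. *)
Lemma expi2_quotient : exists psi : C -> C, ccont psi 0 /\ psi 0%C = (2 * Ci)%C /\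
  forall x, (expi2 x - 1 = x * psi x)%C.
Proof.
  exists (fun x => if Ceq_dec x 0 then (2 * Ci)%C else ((expi2 x - 1) / x)%C).
  assert (V : (if Ceq_dec 0 0 then (2 * Ci)%C else ((expi2 0 - 1) / 0)%C) = (2 * Ci)%C).
  { destruct (Ceq_dec 0 0) as [_|F]; [auto|now elim F]. }
  split; [|split; auto].
  - unfold ccont. rewrite V.
    assert (D : cderiv expi2 0 (2 * Ci)%C).
    { replace (2 * Ci)%C with (2 * Ci * expi2 0)%C by (rewrite expi2_0; ring). apply cderiv_expi2. }
    apply clim_ext with (2 := D). intros w Nw. destruct (Ceq_dec w 0) as [F|_]; [now elim Nw|].
    rewrite expi2_0. now replace (w - 0)%C with w by ring.
  - intros x. destruct (Ceq_dec x 0) as [->|N].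
    + rewrite expi2_0. ring.
    + field. auto.
Qed.

(** To first order the displacement of the lifted point, times [T'(z i)], is the displacement of the
    target minus that of the parameter times the partial derivative [z (S i) / z 0] of [T] in the
    parameter. The true orbit satisfies the same relation as the lift, which makes an exact
    comparison possible. *)
Lemma lift_coefficient (rad : R) (p i : nat) (h h' : nat -> C -> C) (s0 s1 : C) :
  0 < rad -> (i < K)%nat ->
  (forall j, (j <= K)%nat -> smooth rad (fun l => orb (t + l) j)) ->
  (forall j l, (j < K)%nat -> Cmod l < rad -> (expi2 (orb (t + l) j) + 1)%C <> 0%C) ->
  (forall j l, (j < K)%nat -> Cmod l < rad -> (orb (t + l) 0 + orb (t + l) (S j))%C <> 0%C) ->
  motion rad h -> motion rad h' ->
  (forall l, Cmod l < rad ->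
    (expi2 (h' i l) * (h O l - h (S i) l) = h O l + h (S i) l)%C) ->
  clim (fun l => (h O l - orb (t + l) 0) / l ^ p)%C 0 s0 ->
  clim (fun l => (h (S i) l - orb (t + l) (S i)) / l ^ p)%C 0 s1 ->
  clim (fun l => (h' i l - orb (t + l) i) / l ^ p)%C 0 ((s1 - z (S i) / z 0 * s0) / tau i)%C.
Proof.
  intros Hr Hi So Np Nd Mh Mh' Rel L0 L1.
  destruct Mh as [Sh [H0 Hm]]. destruct Mh' as [Sh' [H0' _]].
  destruct expi2_quotient as [psi [Cpsi [psi0 Epsi]]].
  assert (Cont : forall f, smooth rad f -> ccont f 0) by (intros f Sf; apply (Sf O); now rewrite Cmod_0).
  set (g := fun j l => orb (t + l) j).
  assert (G0 : forall j, g j 0%C = z j) by (intros j; unfold g; now replace (t + 0)%C with t by ring).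
  assert (Cg : forall j, (j <= K)%nat -> clim (g j) 0 (z j)).
  { intros j Hj. rewrite <- G0. apply Cont. now apply So. }
  assert (Ch : forall j, (j <= K)%nat -> clim (h j) 0 (z j)).
  { intros j Hj. rewrite <- H0 by auto. apply Cont. now apply Sh. }
  set (del := fun l => (h' i l - g i l)%C).
  assert (Cdel : clim del 0 0%C).
  { replace (RtoC 0) with (z i - z i)%C at 2 by ring. apply clim_minus; [|apply Cg; lia].
    rewrite <- H0' by lia. apply Cont. apply Sh'. lia. }
  assert (Cps : clim (fun l => psi (del l)) 0 (2 * Ci)%C).
  { rewrite <- psi0. now apply (clim_comp del psi). }
  assert (N2i : (2 * Ci)%C <> 0%C) by (apply Cmult_neq_0; [apply RtoC_neq_0; lra|apply Ci_neq_0]).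
  destruct (clim_neq_0_loc _ _ _ Cps N2i) as [d [Pd Hd]].
  destruct (orb_neq 0 (S i) ltac:(lia)) as [A1 A2].
  assert (N0 : z 0 <> 0%C) by (apply orb_neq_0; lia).
  assert (B1 : (z 0 - z (S i))%C <> 0%C) by now apply Cminus_neq_0.
  assert (B2 : (z 0 + z (S i))%C <> 0%C).
  { intros E. apply A2. replace (z 0) with (z 0 + z (S i) - z (S i))%C by ring. rewrite E. ring. }
  set (Q := fun l => (2 * (g O l * ((h (S i) l - g (S i) l) / l ^ p) - g (S i) l * ((h O l - g O l) / l ^ p))
     / ((h O l - h (S i) l) * (g O l + g (S i) l)) / psi (del l))%C).
  apply clim_ext_loc with Q (Rmin d rad); [now apply Rmin_pos| |].
  - intros l Nl Hl. Rmin_bounds.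
    specialize (Hd l Nl ltac:(lra)). replace (l - 0)%C with l in Hl by ring.
    assert (Hl' : Cmod l < rad) by lra. specialize (Rel l Hl').
    pose proof (T_w_rel (t + l) (g i l) (Np i l Hi Hl')) as T.
    change (T_w (t + l) (g i l)) with (g (S i) l) in T. change (t + l)%C with (g O l) in T.
    pose proof (Nd i l Hi Hl') as Ng. fold (g O l) (g (S i) l) in Ng.
    destruct (Hm l Hl') as [_ [_ Hne]]. destruct (Hne O (S i) ltac:(lia)) as [Hne1 _].
    apply Cminus_neq_0 in Hne1.
    assert (Nk : (l ^ p)%C <> 0%C) by now apply Cpow_nz.
    assert (Ed : (h' i l - g i l)%C = del l) by reflexivity.
    change (orb (t + l) i) with (g i l). rewrite Ed.
    (* The relation of the lift divided by that of the orbit; subtracting 1 then gives [Ep], which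
       is linear in the displacements of the two target points. *)
    assert (Ex : (expi2 (del l) * ((h O l - h (S i) l) * (g O l + g (S i) l)) =
       (h O l + h (S i) l) * (g O l - g (S i) l))%C).
    { unfold del. unfold Cminus at 1. rewrite expi2_plus, expi2_opp, <- Rel, <- T.
      field. apply expi2_neq_0. }
    assert (Ep : (del l * psi (del l) * ((h O l - h (S i) l) * (g O l + g (S i) l)) =
      2 * (g O l * (h (S i) l - g (S i) l) - g (S i) l * (h O l - g O l)))%C).
    { rewrite <- Epsi.
      replace ((expi2 (del l) - 1) * ((h O l - h (S i) l) * (g O l + g (S i) l)))%C
        with (expi2 (del l) * ((h O l - h (S i) l) * (g O l + g (S i) l))
          - (h O l - h (S i) l) * (g O l + g (S i) l))%C by ring.
      rewrite Ex. ring. }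
    unfold Q.
    replace (del l / l ^ p)%C
      with (del l * psi (del l) * ((h O l - h (S i) l) * (g O l + g (S i) l))
        / (l ^ p * psi (del l) * ((h O l - h (S i) l) * (g O l + g (S i) l))))%C
      by (field; repeat split; auto).
    rewrite Ep. field. repeat split; auto.
  - replace ((s1 - z (S i) / z 0 * s0) / tau i)%C
      with (2 * (z 0 * s1 - z (S i) * s0) / ((z 0 - z (S i)) * (z 0 + z (S i))) / (2 * Ci))%C.
    + apply clim_div; auto. apply clim_div; [now apply Cmult_neq_0| |].
      * apply clim_mult; [apply clim_const|]. apply clim_minus; apply clim_mult; auto; apply Cg; lia.
      * apply clim_mult; [apply clim_minus; apply Ch; lia|apply clim_plus; apply Cg; lia].
    + unfold tau. field.
      assert (N2 : RtoC 2 <> 0%C) by (apply RtoC_neq_0; lra).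
      assert (B3 : (z 0 * z 0 - z (S i) * z (S i))%C <> 0%C).
      { replace (z 0 * z 0 - z (S i) * z (S i))%C with ((z 0 - z (S i)) * (z 0 + z (S i)))%C by ring.
        now apply Cmult_neq_0. }
      repeat split; auto using Ci_neq_0.
Qed.

(** By the chain rule this is [(T^i)'(t)]. *)
Fixpoint multiplier (i : nat) : C :=
  match i with O => 1%C | S i => (multiplier i * tau i)%C end.

Lemma multiplier_neq_0 (i : nat) : (i <= K)%nat -> multiplier i <> 0%C.
Proof.
  induction i; intros Hi.
  - apply RtoC_neq_0. lra.
  - apply Cmult_neq_0; [apply IHi; lia|apply tau_neq_0; lia].
Qed.

(* [weight rho] is a left eigenvector, with eigenvalue [/ rho], of the linearised
   lifting operator as soon as [rho] is a root of the sum in the hypothesis. *)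
Lemma weight_lift (rho : R) (s s' : nat -> C) : rho <> 0 ->
  let weight i := (RtoC rho ^ i / multiplier i)%C in
  csum (fun i => weight i * (z i / z 0))%C (S K) = 0%C ->
  (forall i, (i < K)%nat -> s' i = ((s (S i) - z (S i) / z 0 * s O) / tau i)%C) ->
  (RtoC rho * csum (fun i => weight i * s' i) K = csum (fun i => weight i * s i) K + weight K * s K)%C.
Proof.
  intros Hrho weight HD Hs.
  assert (N0 : z 0 <> 0%C) by (apply orb_neq_0; lia).
  rewrite <- csum_scal.
  rewrite (csum_ext _ (fun i => weight (S i) * s (S i) - s O * (weight (S i) * (z (S i) / z 0)))%C).
  - rewrite csum_minus, csum_scal.
    rewrite (csum_shift (fun i => weight i * s i)%C), (csum_shift (fun i => weight i * (z i / z 0))%C), HD.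
    assert (W0 : weight O = 1%C) by (unfold weight; simpl; field).
    rewrite W0. simpl. field. auto.
  - intros i Hi. rewrite Hs by auto. unfold weight. simpl.
    pose proof (multiplier_neq_0 i ltac:(lia)). pose proof (tau_neq_0 i Hi).
    field. repeat split; auto.
Qed.

(** After [n] lifts the weighted sum of coefficients is [- a_n] times [weight K * c], where
    [a_0 = 0] and [a_(n+1) = (a_n + 1) / rho], so [a_n >= n] because [rho <= 1]. The coefficients
    themselves are bounded by [S0] for every motion. *)
Lemma no_small_root (rho : R) (p : nat) (c : C) :
  0 < rho <= 1 -> (1 <= p)%nat -> c <> RtoC 0 ->
  clim (fun l => (orb (t + l) K - c0) / l ^ p)%C 0 c ->
  csum (fun i => RtoC rho ^ i / multiplier i * (z i / z 0))%C (S K) <> 0%C.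
Proof.
  intros Hrho Hp Hc HPhi HD.
  destruct motion_initial as [rad [Pr [So [Np [Nd M0]]]]].
  set (h0 := fun i => if lt_dec i K then fun l => orb (t + l) i else fun _ => c0) in M0.
  set (weight := fun i => (RtoC rho ^ i / multiplier i)%C).
  assert (NK : weight K <> 0%C).
  { unfold weight. intros F. apply (RtoC_neq_0 1); [lra|].
    assert (Nr : RtoC rho <> 0%C) by (apply RtoC_neq_0; lra).
    pose proof (Cpow_nz (RtoC rho) K Nr) as Nrk. pose proof (multiplier_neq_0 K (le_n K)) as Nm.
    replace (RtoC 1) with (RtoC rho ^ K / multiplier K * (multiplier K / RtoC rho ^ K))%C by (field; auto).
    rewrite F. ring. }
  (* All motions start from the same points [z i], so a single application of Landau's theorem
     bounds them all. *)
  assert (Bounded : exists r B, 0 < r < rad /\ forall h, motion rad h ->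
    forall i l, (i < K)%nat -> Cmod l < r -> Cmod (h i l) <= B).
  { assert (HM : exists M, 0 <= M /\ forall i, (i <= K)%nat -> Cmod (z i) <= M).
    { clear. induction K as [|k [M [P H]]].
      - exists (Cmod (z 0)). split; [apply Cmod_ge_0|]. intros i Hi. replace i with O by lia. lra.
      - exists (Rmax M (Cmod (z (S k)))). pose proof (Rmax_l M (Cmod (z (S k)))). pose proof (Rmax_r M (Cmod (z (S k)))).
        split; [lra|]. intros i Hi. destruct (Nat.eq_dec i (S k)) as [->|N]; auto.
        specialize (H i ltac:(lia)). lra. }
    destruct HM as [M [PM HM]].
    destruct (landau_bound rad M c0 Pr c0_mod PM) as [r [B [Hr HB]]].
    exists r, B. split; auto. intros h [Sh [H0 Hm]] i l Hi Hl.
    apply HB; auto.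
    - apply Sh. lia.
    - rewrite H0 by lia. apply HM. lia.
    - intros w Hw. destruct (Hm w Hw) as [HK [Hn Hd]]. split; [apply Hn; lia|].
      rewrite <- HK. apply Hd. lia. }
  destruct Bounded as [r [B [Hr HB]]].
  (* The true orbit is bounded by [B] as well, being the initial motion for [i < K]; the difference
     is therefore at most [2 * B], and the Schwarz lemma at radius [r / 2] turns this into a bound
     on the p-th coefficient. *)
  set (S0 := 2 * B / (r / 2) ^ p).
  assert (Coef : forall h i s, motion rad h -> (i < K)%nat ->
    clim (fun l => (h i l - orb (t + l) i) / l ^ p)%C 0 s -> Cmod s <= S0).
  { intros h i s Mh Hi L.
    assert (Bo : forall l, Cmod l < r -> Cmod (orb (t + l) i) <= B).
    { intros l Hl. specialize (HB h0 M0 i l Hi Hl). unfold h0 in HB. destruct (lt_dec i K); [auto|lia]. }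
    destruct (clim_bounded _ _ _ L) as [d [Pd Hd]].
    set (g := fun l => (h i l - orb (t + l) i)%C).
    destruct Mh as [Sh [H0 Hm]].
    assert (Sg : smooth rad g) by (intros n; apply holo_minus; [apply Sh|apply So]; lia).
    assert (Schw : forall l, Cmod l <= r / 2 -> Cmod (g l) * (r / 2) ^ p <= 2 * B * Cmod l ^ p).
    { apply (schwarz_order r (r / 2) (2 * B) (1 + Cmod s) d p g); auto; try lra.
      - apply (holo_mono 2 r rad); [lra|]. apply Sg.
      - intros l Hl. unfold g, Cminus. eapply Rle_trans; [apply Cmod_triangle|]. rewrite Cmod_opp.
        specialize (Bo l Hl). assert (Mh' : motion rad h) by (split; auto).
        specialize (HB h Mh' i l Hi Hl). lra.
      - intros l Hl. destruct (Ceq_dec l 0) as [->|Nl].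
        + unfold g. rewrite H0 by lia. replace (t + 0)%C with t by ring.
          unfold z. replace (orb t i - orb t i)%C with (RtoC 0) by ring. rewrite Cmod_0, pow_ne_zero by lia. lra.
        + specialize (Hd l Nl). replace (l - 0)%C with l in Hd by ring. specialize (Hd Hl).
          assert (Nk : (l ^ p)%C <> 0%C) by now apply Cpow_nz.
          rewrite Cmod_div, Cmod_pow in Hd by auto. fold (g l) in Hd.
          assert (Pl : 0 < Cmod l ^ p) by (apply pow_lt; now apply Cmod_gt_0).
          apply Rmult_le_reg_r with (/ Cmod l ^ p); [now apply Rinv_0_lt_compat|].
          rewrite Rmult_assoc, Rinv_r, Rmult_1_r by lra. exact Hd. }
    assert (Prp : 0 < (r / 2) ^ p) by (apply pow_lt; lra).
    apply le_epsilon. intros e He. destruct (L e He) as [d' [Pd' Hd']].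
    destruct (exists_near 0 (Rmin d' (r / 2))) as [l [Nl Hl]]; [apply Rmin_pos; lra|].
    Rmin_bounds.
    specialize (Hd' l Nl ltac:(lra)). replace (l - 0)%C with l in Hl by ring.
    specialize (Schw l ltac:(lra)). fold (g l) in Hd'.
    assert (Nk : (l ^ p)%C <> 0%C) by now apply Cpow_nz.
    assert (Pl : 0 < Cmod l ^ p) by (apply pow_lt; now apply Cmod_gt_0).
    assert (Q : Cmod (g l / l ^ p)%C <= S0).
    { rewrite Cmod_div, Cmod_pow by auto. unfold S0.
      apply Rmult_le_reg_r with (Cmod l ^ p * (r / 2) ^ p); [now apply Rmult_lt_0_compat|].
      replace (Cmod (g l) / Cmod l ^ p * (Cmod l ^ p * (r / 2) ^ p)) with (Cmod (g l) * (r / 2) ^ p) by (field; lra).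
      replace (2 * B / (r / 2) ^ p * (Cmod l ^ p * (r / 2) ^ p)) with (2 * B * Cmod l ^ p); auto.
      set (q := (r / 2) ^ p) in *. field. lra. }
    pose proof (Cmod_bound_near s (g l / l ^ p)%C) as Bn. rewrite Cmod_minus_sym in Bn. lra. }
  set (mu := / rho).
  assert (Hmu : 1 <= mu) by (unfold mu; rewrite <- Rinv_1; apply Rinv_le_contravar; lra).
  assert (Iter : forall n, exists h s, motion rad h /\
    (forall i, (i <= K)%nat -> clim (fun l => (h i l - orb (t + l) i) / l ^ p)%C 0 (s i)) /\
    exists a, INR n <= a /\ csum (fun i => weight i * s i)%C K = (- (RtoC a * (weight K * c)))%C).
  (* Every motion holds its last point at [c0] while the true orbit leaves it like [c * l^p]: this
     is the source term added at each lift. *)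
  { assert (HK : forall h, motion rad h -> clim (fun l => (h K l - orb (t + l) K) / l ^ p)%C 0 (- c)%C).
    { intros h [_ [_ Hm]].
      apply clim_ext_loc with (fun l => - ((orb (t + l) K - c0) / l ^ p))%C rad; auto.
      - intros l Nl Hl. replace (l - 0)%C with l in Hl by ring. destruct (Hm l Hl) as [-> _].
        field. now apply Cpow_nz.
      - now apply clim_opp. }
    induction n.
    - exists h0, (fun i => if lt_dec i K then RtoC 0 else (- c)%C). split; [auto|split].
      + intros i Hi. destruct (lt_dec i K) as [L|L].
        * apply clim_ext with (fun _ => RtoC 0); [|apply clim_const].
          intros l Nl. unfold h0. destruct (lt_dec i K); [|lia]. field. now apply Cpow_nz.
        * replace i with K by lia. now apply HK.
      + exists 0. split; [simpl; lra|].
        rewrite (csum_ext _ (fun _ => 0 * 0)%C).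
        * rewrite csum_scal. ring.
        * intros i Hi. destruct (lt_dec i K); [ring|lia].
    - destruct IHn as [h [s [Mh [Ls [a [Ha Es]]]]]].
      destruct (motion_lift rad h Pr Mh) as [h' [Mh' Rel]].
      set (s' := fun i => if lt_dec i K then ((s (S i) - z (S i) / z 0 * s O) / tau i)%C else (- c)%C).
      exists h', s'. split; [auto|split].
      + intros i Hi. unfold s'. destruct (lt_dec i K) as [L|L].
        * apply (lift_coefficient rad p i h h'); auto; apply Ls; lia.
        * replace i with K by lia. now apply HK.
      + assert (EsK : s K = (- c)%C).
        { apply (clim_unique (fun l => (h K l - orb (t + l) K) / l ^ p)%C 0); auto. }
        exists (mu * (a + 1)). split.
        * rewrite S_INR. pose proof (pos_INR n). nra.
        * assert (Hrho0 : rho <> 0) by lra.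
          pose proof (weight_lift rho s s' Hrho0 HD) as WL. cbv zeta in WL.
          assert (Hs' : forall i, (i < K)%nat -> s' i = ((s (S i) - z (S i) / z 0 * s O) / tau i)%C).
          { intros i Hi. unfold s'. destruct (lt_dec i K); [auto|lia]. }
          specialize (WL Hs').
          change (RtoC rho * csum (fun i => weight i * s' i) K
            = csum (fun i => weight i * s i) K + weight K * s K)%C in WL.
          rewrite Es, EsK in WL.
          assert (Nr : RtoC rho <> 0%C) by (apply RtoC_neq_0; lra).
          transitivity (/ RtoC rho * (RtoC rho * csum (fun i => weight i * s' i) K))%C.
          { field. auto. }
          rewrite WL. unfold mu. rewrite RtoC_mult, RtoC_inv, RtoC_plus by lra. ring. }
  set (T := Re (csum (fun i => RtoC (Cmod (weight i))) K) * S0).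
  assert (Pwc : 0 < Cmod (weight K * c)%C) by (apply Cmod_gt_0; now apply Cmult_neq_0).
  destruct (INR_unbounded (T / Cmod (weight K * c)%C)) as [n Hn].
  destruct (Iter n) as [h [s [Mh [Ls [a [Ha Es]]]]]].
  assert (Up : Cmod (csum (fun i => weight i * s i)%C K) <= T).
  { apply csum_bound. intros i Hi. apply (Coef h i); auto. apply Ls. lia. }
  rewrite Es, Cmod_opp, Cmod_mult, Cmod_R, Rabs_pos_eq in Up by (pose proof (pos_INR n); lra).
  apply Rmult_lt_compat_r with (r := Cmod (weight K * c)%C) in Hn; auto.
  unfold Rdiv in Hn. rewrite Rmult_assoc, Rinv_l, Rmult_1_r in Hn by lra.
  assert (INR n * Cmod (weight K * c)%C <= a * Cmod (weight K * c)%C) by (apply Rmult_le_compat_r; lra).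
  lra.
Qed.

End Motion.

(** * Real orbits *)

Definition rorb (n : nat) (t : R) : R := Nat.iter n (f_t t) t.

Lemma expi2_plus_1 (z : C) : (expi2 z + 1)%C = (2 * Cexp (Ci * z) * Ccos z)%C.
Proof.
  unfold Ccos. rewrite Cexp_opp.
  replace (expi2 z) with (Cexp (Ci * z) * Cexp (Ci * z))%C.
  - field. apply Cexp_neq_0.
  - unfold expi2. rewrite <- Cexp_plus. f_equal. ring.
Qed.

Lemma expi2_pole (z : C) : (expi2 z + 1)%C <> 0%C <-> Ccos z <> 0%C.
Proof.
  rewrite expi2_plus_1. split; intros H E.
  - apply H. rewrite E. ring.
  - revert E. apply Cmult_neq_0; auto. apply Cmult_neq_0; [apply RtoC_neq_0; lra|apply Cexp_neq_0].
Qed.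

Lemma Cexp_Ci_R (x : R) : Cexp (Ci * RtoC x) = (cos x, sin x).
Proof.
  unfold Cexp, Ci, RtoC, Cmult; simpl.
  replace (0 * x - 1 * 0) with 0 by ring. replace (0 * 0 + 1 * x) with x by ring.
  rewrite exp_0. f_equal; ring.
Qed.

Lemma Cexp_R (x : R) : Cexp (RtoC x) = RtoC (exp x).
Proof. unfold Cexp, RtoC; simpl. rewrite cos_0, sin_0. f_equal; ring. Qed.

Lemma Cinv_cos_sin (x : R) : (/ (cos x, sin x))%C = (cos x, (- sin x)%R).
Proof.
  pose proof (sin2_cos2 x) as S. unfold Rsqr in S. unfold Cinv; simpl.
  replace (cos x * (cos x * 1) + sin x * (sin x * 1)) with 1 by lra. f_equal; field.
Qed.

Lemma Ccos_R (x : R) : Ccos (RtoC x) = RtoC (cos x).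
Proof.
  unfold Ccos. rewrite Cexp_opp, Cexp_Ci_R, Cinv_cos_sin.
  unfold RtoC, Cdiv, Cinv, Cmult, Cplus; simpl. f_equal; field.
Qed.

Lemma Csin_R (x : R) : Csin (RtoC x) = RtoC (sin x).
Proof.
  unfold Csin. rewrite Cexp_opp, Cexp_Ci_R, Cinv_cos_sin.
  replace ((cos x, sin x) - (cos x, (- sin x)%R))%C with (2 * Ci * RtoC (sin x))%C.
  - field. apply Ci_neq_0.
  - unfold RtoC, Ci, Cmult, Cminus, Copp, Cplus; simpl. f_equal; ring.
Qed.

Lemma exp_opp_mult (s : R) : exp s * exp (- s) = 1.
Proof. rewrite <- exp_plus, Rplus_opp_r. apply exp_0. Qed.

Lemma cosh_pos (s : R) : 0 < cosh s.
Proof. unfold cosh. pose proof (exp_pos s). pose proof (exp_pos (- s)). lra. Qed.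

Lemma Ccos_Ci_R (s : R) : Ccos (Ci * RtoC s) = RtoC (cosh s).
Proof.
  unfold Ccos, cosh.
  replace (Ci * (Ci * RtoC s))%C with (RtoC (- s))
    by (rewrite Cmult_assoc, Ci_sqr, RtoC_opp; ring).
  rewrite <- RtoC_opp, !Cexp_R, Ropp_involutive, RtoC_div, RtoC_plus by lra. field.
Qed.

Lemma Csin_Ci_R (s : R) : Csin (Ci * RtoC s) = (Ci * RtoC (sinh s))%C.
Proof.
  unfold Csin, sinh.
  replace (Ci * (Ci * RtoC s))%C with (RtoC (- s))
    by (rewrite Cmult_assoc, Ci_sqr, RtoC_opp; ring).
  rewrite <- RtoC_opp, !Cexp_R, Ropp_involutive, RtoC_div, RtoC_minus by lra.
  replace (RtoC (exp (- s)) - RtoC (exp s))%C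
    with (Ci * Ci * (RtoC (exp s) - RtoC (exp (- s))))%C by (rewrite Ci_sqr; ring).
  field. apply Ci_neq_0.
Qed.

Lemma T_w_R (t x : R) : cos x <> 0 -> T_w (RtoC t) (RtoC x) = (Ci * RtoC (t * tan x))%C.
Proof.
  intros H. unfold T_w, Ctan. rewrite Csin_R, Ccos_R. unfold tan.
  rewrite RtoC_mult, RtoC_div by auto. ring.
Qed.

Lemma T_w_Ci_R (t s : R) : T_w (RtoC t) (Ci * RtoC s)%C = RtoC (- t * tanh s).
Proof.
  unfold T_w, Ctan. rewrite Csin_Ci_R, Ccos_Ci_R. unfold tanh.
  pose proof (cosh_pos s). rewrite RtoC_mult, RtoC_div, RtoC_opp by lra.
  replace (Ci * RtoC t * (Ci * RtoC (sinh s) / RtoC (cosh s)))%C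
    with ((Ci * Ci) * (RtoC t * (RtoC (sinh s) / RtoC (cosh s))))%C
    by (unfold Cdiv; ring).
  rewrite Ci_sqr. ring.
Qed.

Lemma orb_real (t : R) (n : nat) : (forall k, (k < n)%nat -> cos (rorb k t) <> 0) ->
  orb (RtoC t) (2 * n) = RtoC (rorb n t).
Proof.
  induction n; intros H; auto.
  replace (2 * S n)%nat with (S (S (2 * n))) by lia.
  change (T_w (RtoC t) (T_w (RtoC t) (orb (RtoC t) (2 * n))) = RtoC (rorb (S n) t)).
  rewrite IHn by (intros; apply H; lia). rewrite T_w_R by (apply H; lia). now rewrite T_w_Ci_R.
Qed.

Lemma orb_real_odd (t : R) (n : nat) : (forall k, (k <= n)%nat -> cos (rorb k t) <> 0) ->
  orb (RtoC t) (2 * n + 1) = (Ci * RtoC (t * tan (rorb n t)))%C.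
Proof.
  intros H. rewrite Nat.add_1_r.
  change (T_w (RtoC t) (orb (RtoC t) (2 * n)) = (Ci * RtoC (t * tan (rorb n t)))%C).
  rewrite orb_real by (intros; apply H; lia). apply T_w_R. apply H. lia.
Qed.

Lemma parity_cases (i : nat) : exists k, i = (2 * k)%nat \/ i = (2 * k + 1)%nat.
Proof. destruct (Nat.Even_or_Odd i) as [[k Hk]|[k Hk]]; exists k; auto. Qed.

(** Points of odd index are imaginary, and on the imaginary axis the cosine is [cosh > 0]; only the
    real points of even index can be poles. *)
Lemma orb_no_pole (t : R) (n : nat) : (forall k, (k < n)%nat -> cos (rorb k t) <> 0) ->
  forall i, (i < 2 * n)%nat -> (expi2 (orb (RtoC t) i) + 1)%C <> 0%C.
Proof.
  intros H i Hi. apply expi2_pole. destruct (parity_cases i) as [k [-> | ->]].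
  - rewrite orb_real by (intros; apply H; lia). rewrite Ccos_R. apply RtoC_neq_0, H. lia.
  - rewrite orb_real_odd by (intros; apply H; lia). rewrite Ccos_Ci_R.
    apply RtoC_neq_0. pose proof (cosh_pos (t * tan (rorb k t))). lra.
Qed.

Lemma rorb_no_pole (t : R) (n : nat) :
  (forall i, (i < 2 * n)%nat -> (expi2 (orb (RtoC t) i) + 1)%C <> 0%C) ->
  forall k, (k < n)%nat -> cos (rorb k t) <> 0.
Proof.
  induction n; intros H k Hk; [lia|].
  assert (IH : forall k, (k < n)%nat -> cos (rorb k t) <> 0) by (apply IHn; intros; apply H; lia).
  destruct (Nat.eq_dec k n) as [->|N]; [|apply IH; lia].
  specialize (H (2 * n)%nat ltac:(lia)). apply expi2_pole in H.
  rewrite orb_real, Ccos_R in H by auto. intros E. apply H. now rewrite E.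
Qed.

(** Absence of poles is an open condition for the complex orbit; [rorb_no_pole] carries it back to
    the real orbits of nearby parameters, which then coincide with the complex ones. *)
Lemma rorb_near (b : R) (n : nat) : (forall k, (k < n)%nat -> cos (rorb k b) <> 0) ->
  exists d, 0 < d /\ forall s, Rabs s < d ->
    (forall k, (k < n)%nat -> cos (rorb k (b + s)) <> 0) /\
    forall k, (k <= n)%nat -> orb (RtoC b + RtoC s)%C (2 * k) = RtoC (rorb k (b + s)).
Proof.
  intros H. destruct (orb_smooth (RtoC b) (2 * n) (orb_no_pole b n H)) as [d [Pd [_ Nd]]].
  exists d. split; auto. intros s Hs.
  assert (A : forall k, (k < n)%nat -> cos (rorb k (b + s)) <> 0).
  { apply rorb_no_pole. intros i Hi. rewrite RtoC_plus. apply Nd; auto. now rewrite Cmod_R. }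
  split; auto. intros k Hk. rewrite <- RtoC_plus. apply orb_real. intros j Hj. apply A. lia.
Qed.

Lemma rorb_continuous (b : R) (n : nat) : (forall k, (k < n)%nat -> cos (rorb k b) <> 0) ->
  forall e, 0 < e -> exists d, 0 < d /\ forall t, Rabs (t - b) < d -> Rabs (rorb n t - rorb n b) < e.
Proof.
  intros H e He. destruct (rorb_near b n H) as [d1 [P1 H1]].
  destruct (orb_smooth (RtoC b) (2 * n) (orb_no_pole b n H)) as [d [Pd [Sd _]]].
  assert (C0 : ccont (fun l => orb (RtoC b + l)%C (2 * n)) 0).
  { apply (Sd (2 * n)%nat (le_n _) O). now rewrite Cmod_0. }
  destruct (ccont_all _ _ C0 e He) as [d2 [P2 H2]].
  exists (Rmin d1 d2). split; [now apply Rmin_pos|]. intros t Ht.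
  Rmin_bounds.
  destruct (H1 (t - b) ltac:(lra)) as [_ E1].
  specialize (H2 (RtoC (t - b))). replace (RtoC (t - b) - 0)%C with (RtoC (t - b)) in H2 by ring.
  rewrite Cmod_R in H2. specialize (H2 ltac:(lra)). cbv beta in H2.
  rewrite E1 in H2 by lia. replace (RtoC b + 0)%C with (RtoC b) in H2 by ring.
  rewrite orb_real, <- RtoC_minus, Cmod_R in H2 by auto.
  now replace (b + (t - b)) with t in H2 by ring.
Qed.

Lemma tanh_bound (s : R) : -1 < tanh s < 1.
Proof.
  unfold tanh, sinh, cosh. pose proof (exp_pos s). pose proof (exp_pos (- s)).
  replace ((exp s - exp (- s)) / 2 / ((exp s + exp (- s)) / 2))
    with (1 - 2 * exp (- s) / (exp s + exp (- s))) by (field; lra).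
  assert (0 < 2 * exp (- s) / (exp s + exp (- s))) by (apply Rdiv_lt_0_compat; lra).
  assert (2 * exp (- s) / (exp s + exp (- s)) < 2).
  { apply Rmult_lt_reg_r with (exp s + exp (- s)); [lra|].
    unfold Rdiv. rewrite Rmult_assoc, Rinv_l by lra. lra. }
  lra.
Qed.

Lemma rorb_bound (t : R) (n : nat) : 0 < t -> Rabs (rorb n t) <= t.
Proof.
  intros Ht. destruct n.
  - unfold rorb; simpl. rewrite Rabs_pos_eq; lra.
  - change (Rabs (- t * tanh (t * tan (rorb n t))) <= t).
    pose proof (tanh_bound (t * tan (rorb n t))). apply Rabs_le. nra.
Qed.

(** Orbit points satisfy [|x| <= t < PI], so the only poles within reach are [PI / 2] and
    [- PI / 2], and [|x|] alone decides. *)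
Lemma cos_0_abs (x : R) : Rabs x < PI -> cos x = 0 <-> Rabs x = PI / 2.
Proof.
  intros H. split; intros E.
  - apply Rabs_def2 in H. assert (cos (Rabs x) = 0).
    { unfold Rabs. destruct (Rcase_abs x); [now rewrite cos_neg|auto]. }
    assert (R0 : 0 <= Rabs x < PI) by (split; [apply Rabs_pos|apply Rabs_def1; lra]).
    apply cos_eq_0_2PI_0 in H0; lra.
  - assert (cos (Rabs x) = 0) by (rewrite E; apply cos_PI2).
    unfold Rabs in H0. destruct (Rcase_abs x); [now rewrite cos_neg in H0|auto].
Qed.

(** * Non-degeneracy of the parameter equation *)

(** [f_t] is odd, so the absolute values of an orbit evolve by a map of their own. At the pole
    [PI / 2] the one-sided limits of [f_t] are [-t] and [t], whereas this map has the single limit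
    [t]. *)
Definition abs_map (t a : R) : R := t * tanh (t * Rabs (tan a)).

Lemma tanh_opp (s : R) : tanh (- s) = - tanh s.
Proof.
  unfold tanh, sinh, cosh. rewrite Ropp_involutive.
  pose proof (exp_pos s). pose proof (exp_pos (- s)). field. lra.
Qed.

Lemma abs_rorb_S (t : R) (n : nat) : 0 < t -> Rabs (rorb (S n) t) = abs_map t (Rabs (rorb n t)).
Proof.
  intros Ht. change (rorb (S n) t) with (- t * tanh (t * tan (rorb n t))). unfold abs_map.
  set (x := rorb n t).
  assert (E1 : Rabs (tan (Rabs x)) = Rabs (tan x)).
  { unfold Rabs at 2. destruct (Rcase_abs x); auto. now rewrite tan_neg, Rabs_Ropp. }
  rewrite E1.
  assert (E2 : tanh (t * Rabs (tan x)) = Rabs (tanh (t * tan x))).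
  { assert (P : forall s, 0 <= s -> 0 <= tanh s).
    { intros s Hs. unfold tanh. pose proof (cosh_pos s). apply Rmult_le_pos; [|left; now apply Rinv_0_lt_compat].
      unfold sinh. assert (exp (- s) <= exp s).
      { destruct (Req_dec s 0) as [->|N]; [rewrite Ropp_0; lra|]. left. apply exp_increasing. lra. }
      lra. }
    unfold Rabs at 1. destruct (Rcase_abs (tan x)) as [L|L].
    - replace (t * - tan x) with (- (t * tan x)) by ring. rewrite tanh_opp.
      specialize (P (- (t * tan x)) ltac:(nra)). rewrite tanh_opp in P. rewrite Rabs_left1; lra.
    - rewrite Rabs_pos_eq; auto. apply P. nra. }
  rewrite E2, Rabs_mult, Rabs_Ropp, (Rabs_pos_eq t) by lra. reflexivity.
Qed.

Lemma tanh_lipschitz (u v : R) : Rabs (tanh u - tanh v) <= Rabs (u - v).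
Proof.
  assert (G : forall u v, u < v -> Rabs (tanh v - tanh u) <= Rabs (v - u)).
  { clear. intros u v Huv.
    destruct (MVT_cor2 tanh (fun s => / (cosh s * cosh s)) u v Huv) as [c [Hc _]].
    - intros s _. apply is_derive_Reals. pose proof (cosh_pos s) as P.
      pose proof (exp_pos s). pose proof (exp_pos (- s)).
      pose proof (exp_opp_mult s) as Q.
      unfold tanh, sinh, cosh in *.
      auto_derive; [lra|].
      replace (/ ((exp s + exp (- s)) / 2 * ((exp s + exp (- s)) / 2)))
        with (exp s * exp (- s) / ((exp s + exp (- s)) / 2 * ((exp s + exp (- s)) / 2)))
        by (rewrite Q; field; lra).
      field. lra.
    - rewrite Hc, Rabs_mult.
      assert (C1 : 1 <= cosh c).
      { unfold cosh. pose proof (exp_pos c). pose proof (exp_pos (- c)).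
        pose proof (exp_opp_mult c) as Q.
        assert (0 <= (exp c - exp (- c)) * (exp c - exp (- c))) by apply Rle_0_sqr. nra. }
      assert (P1 : 0 < / (cosh c * cosh c)) by (apply Rinv_0_lt_compat; nra).
      rewrite (Rabs_pos_eq (/ _)) by lra.
      assert (/ (cosh c * cosh c) <= 1) by (rewrite <- Rinv_1; apply Rinv_le_contravar; nra).
      pose proof (Rabs_pos (v - u)). nra. }
  destruct (Rtotal_order u v) as [L|[->|L]].
  - rewrite (Rabs_minus_sym (tanh u)), (Rabs_minus_sym u). now apply G.
  - rewrite !Rminus_diag_eq by auto. lra.
  - now apply G.
Qed.

Lemma Rabs_sin_le (x : R) : Rabs (sin x) <= Rabs x.
Proof.
  assert (G : forall x, 0 < x -> Rabs (sin x) <= x).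
  { clear. intros x Hx. pose proof (SIN_bound x). pose proof (sin_lt_x x Hx). apply Rabs_le.
    split; [|lra]. destruct (Rle_dec 1 x); [lra|].
    assert (0 < sin x) by (apply sin_gt_0; [lra|]; pose proof PI2_1; lra). lra. }
  destruct (Rtotal_order x 0) as [L|[->|L]].
  - rewrite <- (Rabs_Ropp (sin x)), <- sin_neg, <- (Rabs_Ropp x), (Rabs_pos_eq (- x)) by lra. apply G. lra.
  - rewrite sin_0. lra.
  - rewrite (Rabs_pos_eq x) by lra. now apply G.
Qed.

(** Away from poles [tan] is Lipschitz and [tanh] is a contraction. The constants do not depend on
    [t], since one estimate must serve a whole interval of parameters; the 16 bounds [t^2] through
    [PI <= 4]. *)
Lemma abs_map_lipschitz (a0 : R) : cos a0 <> 0 ->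
  exists C d, 0 <= C /\ 0 < d /\ forall t a a', 0 < t < PI ->
    Rabs (a - a0) < d -> Rabs (a' - a0) < d ->
    Rabs (abs_map t a - abs_map t a') <= C * Rabs (a - a').
Proof.
  intros H0. set (m := Rabs (cos a0) / 2).
  assert (Pm : 0 < m) by (pose proof (Rabs_pos_lt _ H0); unfold m; lra).
  destruct (continuity_cos a0 m Pm) as [d [Pd Hd]].
  assert (Near : forall a, Rabs (a - a0) < d -> m <= Rabs (cos a)).
  { intros a Ha. assert (A : Rabs (cos a - cos a0) < m).
    { destruct (Req_dec a a0) as [->|N].
      - rewrite Rminus_diag_eq, Rabs_R0 by auto. auto.
      - apply Hd. split; auto. split; [exact I|auto]. }
    pose proof (Rabs_triang_inv (cos a0) (cos a)). rewrite Rabs_minus_sym in A. unfold m in *. lra. }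
  exists (16 / (m * m)), d. split; [|split; auto].
  { apply Rlt_le, Rdiv_lt_0_compat; nra. }
  intros t a a' Ht Ha Ha'.
  pose proof (Near a Ha) as N1. pose proof (Near a' Ha') as N2.
  assert (K1 : cos a <> 0) by (intros E; rewrite E, Rabs_R0 in N1; lra).
  assert (K2 : cos a' <> 0) by (intros E; rewrite E, Rabs_R0 in N2; lra).
  assert (T : Rabs (tan a - tan a') <= / (m * m) * Rabs (a - a')).
  { replace (tan a - tan a') with (sin (a - a') * / (cos a * cos a')).
    - rewrite Rabs_mult, Rabs_inv, Rabs_mult, Rmult_comm. apply Rmult_le_compat.
      + left. apply Rinv_0_lt_compat. nra.
      + apply Rabs_pos.
      + apply Rinv_le_contravar; nra.
      + apply Rabs_sin_le.
    - rewrite sin_minus. unfold tan. field. auto. }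
  unfold abs_map. rewrite <- Rmult_minus_distr_l, Rabs_mult, (Rabs_pos_eq t) by lra.
  pose proof (tanh_lipschitz (t * Rabs (tan a)) (t * Rabs (tan a'))) as L.
  rewrite <- Rmult_minus_distr_l, Rabs_mult, (Rabs_pos_eq t) in L by lra.
  pose proof (Rabs_triang_inv2 (tan a) (tan a')) as L2.
  pose proof PI_4.
  assert (L3 : Rabs (tanh (t * Rabs (tan a)) - tanh (t * Rabs (tan a'))) <= t * (/ (m * m) * Rabs (a - a'))).
  { eapply Rle_trans; [exact L|]. apply Rmult_le_compat_l; lra. }
  assert (Q : 0 <= / (m * m) * Rabs (a - a')).
  { apply Rmult_le_pos; [left; apply Rinv_0_lt_compat; nra|apply Rabs_pos]. }
  replace (16 / (m * m) * Rabs (a - a')) with (16 * (/ (m * m) * Rabs (a - a'))) by (field; lra).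
  apply Rle_trans with (t * (t * (/ (m * m) * Rabs (a - a')))); [apply Rmult_le_compat_l; lra|].
  set (q := / (m * m) * Rabs (a - a')) in *. rewrite <- Rmult_assoc. apply Rmult_le_compat_r; nra.
Qed.

(* The pole is a flat point of the absolute-value map; a quadratic bound suffices. *)
Lemma abs_map_flat (t a : R) : 0 < t -> Rabs (a - PI / 2) <= 1 / 2 -> cos a <> 0 ->
  Rabs (abs_map t a - t) <= 4 / t * (Rabs (a - PI / 2) * Rabs (a - PI / 2)).
Proof.
  intros Ht Ha Hc. set (x := Rabs (a - PI / 2)) in *.
  assert (Cx : cos a * cos a <= x * x).
  { assert (Rabs (cos a) <= x).
    { rewrite <- (Ropp_involutive a), cos_neg. replace (- a) with ((PI / 2 - a) - PI / 2) by field.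
      rewrite cos_minus, cos_PI2, sin_PI2.
      replace (cos (PI / 2 - a) * 0 + sin (PI / 2 - a) * 1) with (sin (PI / 2 - a)) by ring.
      unfold x. rewrite Rabs_minus_sym. apply Rabs_sin_le. }
    rewrite <- (Rabs_pos_eq (cos a * cos a)) by nra. rewrite Rabs_mult.
    apply Rmult_le_compat; auto using Rabs_pos. }
  pose proof (sin2_cos2 a) as SC. unfold Rsqr in SC.
  assert (Px : 0 <= x) by apply Rabs_pos.
  assert (S : 1 / 2 <= sin a * sin a) by nra.
  assert (Pc : 0 < cos a * cos a) by nra.
  set (s := t * Rabs (tan a)).
  assert (T2 : Rabs (tan a) * Rabs (tan a) = sin a * sin a / (cos a * cos a)).
  { rewrite <- Rabs_mult, Rabs_pos_eq by nra. unfold tan. field. auto. }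
  assert (Ps : 0 < s).
  { unfold s. apply Rmult_lt_0_compat; auto. apply Rabs_pos_lt. unfold tan. intros E.
    assert (sin a = 0) by (replace (sin a) with (sin a / cos a * cos a) by (field; auto); rewrite E; ring).
    rewrite H in S. lra. }
  unfold abs_map. fold s. pose proof (tanh_bound s) as TB.
  replace (t * tanh s - t) with (- (t * (1 - tanh s))) by ring.
  rewrite Rabs_Ropp, Rabs_pos_eq by nra.
  assert (E : 1 - tanh s <= 2 / (s * s)).
  { unfold tanh, sinh, cosh. pose proof (exp_pos s). pose proof (exp_pos (- s)).
    pose proof (exp_opp_mult s) as Q.
    replace (1 - (exp s - exp (- s)) / 2 / ((exp s + exp (- s)) / 2))
      with (2 * (exp s * exp (- s)) / (exp s * (exp s + exp (- s)))) by (field; lra).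
    rewrite Q, Rmult_1_r. unfold Rdiv. apply Rmult_le_compat_l; [lra|].
    apply Rinv_le_contravar; [nra|]. pose proof (exp_ineq1_le s). nra. }
  apply Rle_trans with (t * (2 / (s * s))); [apply Rmult_le_compat_l; lra|].
  assert (Ess : s * s = t * t * (sin a * sin a / (cos a * cos a))).
  { unfold s. replace (t * Rabs (tan a) * (t * Rabs (tan a))) with (t * t * (Rabs (tan a) * Rabs (tan a))) by ring.
    now rewrite T2. }
  assert (Ns : sin a <> 0) by (intros F; rewrite F in S; lra).
  rewrite Ess.
  replace (t * (2 / (t * t * (sin a * sin a / (cos a * cos a)))))
    with (2 / t * (cos a * cos a) * / (sin a * sin a)) by (field; repeat split; auto; lra).
  assert (I2 : / (sin a * sin a) <= 2).
  { replace 2 with (/ (1 / 2)) by field. apply Rinv_le_contravar; lra. }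
  assert (I3 : 0 < / t) by now apply Rinv_0_lt_compat.
  assert (I4 : 0 < / (sin a * sin a)) by (apply Rinv_0_lt_compat; lra).
  unfold Rdiv. apply Rle_trans with (2 * / t * (cos a * cos a) * 2).
  - apply Rmult_le_compat_l; auto. nra.
  - assert (/ t * (cos a * cos a) <= / t * (x * x)) by (apply Rmult_le_compat_l; lra). lra.
Qed.

(** For [t] slightly above [b] let [e t] be the distance of the i-th point from the pole. By
    flatness, passing near the pole restarts the orbit at [t] with an error of order [e^2], so every
    [a m t] lies within [C * e^2] of some [a j t] with [j <= i]. But [a N t] is the pole: for
    [j = i] this gives [e <= C * e^2] with [e] positive and small, and for [j < i] it contradicts
    the distance of [a j b] from the pole. *)
Lemma flat_return (b eps : R) (N i : nat) : 0 < b < PI -> (i < N)%nat ->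
  (forall k, (k < i)%nat -> cos (rorb k b) <> 0) -> cos (rorb i b) = 0 -> 0 < eps ->
  (forall t, b < t < b + eps -> t < PI /\ (forall k, (k < N)%nat -> cos (rorb k t) <> 0) /\ cos (rorb N t) = 0) ->
  False.
Proof.
  intros Hb Hi Hk Hc Heps HS.
  set (a := fun m t => Rabs (rorb m t)).
  assert (Cont : forall j, (j <= i)%nat -> forall e, 0 < e ->
    exists d, 0 < d /\ forall t, b < t < b + d -> Rabs (a j t - a j b) < e).
  { intros j Hj e He. destruct (rorb_continuous b j) with (e := e) as [d [Pd Hd]]; auto.
    { intros k Hk'. apply Hk. lia. }
    exists d. split; auto. intros t Ht. unfold a.
    eapply Rle_lt_trans; [apply Rabs_triang_inv2|]. apply Hd. rewrite Rabs_pos_eq; lra. }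
  assert (Bnd : forall m t, 0 < t < PI -> Rabs (rorb m t) < PI).
  { intros m t Ht. pose proof (rorb_bound t m ltac:(lra)). lra. }
  assert (Aib : a i b = PI / 2) by (apply cos_0_abs; auto).
  assert (Ajb : forall j, (j < i)%nat -> a j b <> PI / 2).
  { intros j Hj E. apply (Hk j Hj). apply cos_0_abs; auto. }
  assert (CosA : forall m t, cos (a m t) = cos (rorb m t)).
  { intros m t. unfold a, Rabs. destruct (Rcase_abs (rorb m t)); auto using cos_neg. }
  set (e := fun t => Rabs (a i t - PI / 2)).
  assert (Se : forall t, 0 <= e t) by (intros; apply Rabs_pos).
  assert (Small : forall C g, 0 <= C -> 0 < g -> exists d, 0 < d /\ forall t, b < t < b + d ->
    e t <= 1 /\ (1 + C) * e t < g /\ C * (e t * e t) < g).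
  { intros C g HC Hg. assert (Q : 0 < g / (1 + C)) by (apply Rdiv_lt_0_compat; lra).
    destruct (Cont i (le_n i) (Rmin 1 (g / (1 + C)))) as [d [Pd Hd]]; [apply Rmin_pos; lra|].
    exists d. split; auto. intros t Ht. specialize (Hd t Ht). rewrite Aib in Hd. fold (e t) in Hd.
    Rmin_bounds. specialize (Se t).
    assert (F : (1 + C) * e t < g).
    { apply Rlt_le_trans with ((1 + C) * (g / (1 + C))); [apply Rmult_lt_compat_l; lra|]. right. field. lra. }
    assert (C * (e t * e t) <= C * e t) by (apply Rmult_le_compat_l; nra). repeat split; lra. }
  assert (Cl : forall m, (m <= N)%nat -> exists j C d, (j <= i)%nat /\ 0 <= C /\ 0 < d /\
    forall t, b < t < b + d -> Rabs (a m t - a j t) <= C * (e t * e t)).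
  { induction m; intros Hm.
    - exists O, 0, 1. split; [lia|]. split; [lra|]. split; [lra|]. intros t _.
      rewrite Rminus_diag_eq, Rabs_R0 by auto. lra.
    - destruct IHm as [j [C [d [Hj [PC [Pd Hd]]]]]]; [lia|].
      destruct (Nat.eq_dec j i) as [->|Nj].
      (* The shadowed index returns to 0. The constant comes from [abs_map_flat], with [t >= b] and
         distance to the pole at most [(1 + C) * e t]. *)
      + exists O, (4 / b * ((1 + C) * (1 + C))).
        destruct (Small C (1 / 2) PC ltac:(lra)) as [d1 [P1 H1]].
        exists (Rmin d (Rmin d1 eps)). split; [lia|]. split.
        { apply Rmult_le_pos; [|nra]. apply Rlt_le, Rdiv_lt_0_compat; lra. }
        split; [repeat apply Rmin_pos; auto|]. intros t Ht.
        Rmin_bounds.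
        destruct (HS t ltac:(lra)) as [T1 [T2 _]]. specialize (Hd t ltac:(lra)).
        destruct (H1 t ltac:(lra)) as [E1 [E2 _]].
        assert (Dist : Rabs (a m t - PI / 2) <= (1 + C) * e t).
        { replace (a m t - PI / 2) with ((a m t - a i t) + (a i t - PI / 2)) by ring.
          eapply Rle_trans; [apply Rabs_triang|]. change (Rabs (a i t - PI / 2)) with (e t).
          specialize (Se t). assert (C * (e t * e t) <= C * e t) by (apply Rmult_le_compat_l; nra). lra. }
        unfold a at 1 2. rewrite abs_rorb_S by lra. change (Rabs (rorb 0 t)) with (Rabs t).
        rewrite (Rabs_pos_eq t) by lra. fold (a m t).
        eapply Rle_trans; [apply abs_map_flat; [lra|lra|]|].
        { rewrite CosA. apply T2. lia. }
        assert (I : 4 / t <= 4 / b).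
        { unfold Rdiv. apply Rmult_le_compat_l; [lra|]. apply Rinv_le_contravar; lra. }
        rewrite Rmult_assoc. pose proof (Rabs_pos (a m t - PI / 2)).
        apply Rmult_le_compat.
        * apply Rlt_le, Rdiv_lt_0_compat; lra.
        * nra.
        * exact I.
        * replace ((1 + C) * (1 + C) * (e t * e t)) with (((1 + C) * e t) * ((1 + C) * e t)) by ring.
          apply Rmult_le_compat; auto.
      + assert (Hji : (j < i)%nat) by lia.
        destruct (abs_map_lipschitz (a j b)) as [L [d0 [PL [Pd0 HL]]]].
        { rewrite CosA. now apply Hk. }
        destruct (Cont j ltac:(lia) (d0 / 2) ltac:(lra)) as [d1 [P1 H1]].
        destruct (Small C (d0 / 2) PC ltac:(lra)) as [d2 [P2 H2]].
        exists (S j), (L * C), (Rmin (Rmin d d1) (Rmin d2 eps)). split; [lia|]. split; [nra|].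
        split; [repeat apply Rmin_pos; auto|]. intros t Ht.
        Rmin_bounds.
        destruct (HS t ltac:(lra)) as [T1 _]. specialize (Hd t ltac:(lra)).
        specialize (H1 t ltac:(lra)). destruct (H2 t ltac:(lra)) as [_ [_ E2]].
        unfold a at 1 2. rewrite !abs_rorb_S by lra. fold (a m t) (a j t).
        eapply Rle_trans; [apply HL; [lra| |lra]|].
        * replace (a m t - a j b) with ((a m t - a j t) + (a j t - a j b)) by ring.
          eapply Rle_lt_trans; [apply Rabs_triang|]. lra.
        * rewrite Rmult_assoc. apply Rmult_le_compat_l; auto. }
  destruct (Cl N (le_n N)) as [j [C [d [Hj [PC [Pd Hd]]]]]].
  assert (AN : forall t, b < t < b + eps -> a N t = PI / 2).
  { intros t Ht. destruct (HS t Ht) as [T1 [_ T3]]. apply cos_0_abs; auto. apply Bnd. lra. }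
  assert (Mid : forall d, 0 < d -> exists t, b < t < b + d) by (intros d' Hd'; exists (b + d' / 2); lra).
  destruct (Nat.eq_dec j i) as [->|Nj].
  - destruct (Small C 1 PC Rlt_0_1) as [d1 [P1 H1]].
    destruct (Mid (Rmin (Rmin d d1) eps)) as [t Ht]; [repeat apply Rmin_pos; auto|].
    Rmin_bounds.
    specialize (Hd t ltac:(lra)). destruct (H1 t ltac:(lra)) as [_ [Fe _]]. rewrite AN in Hd by lra.
    rewrite Rabs_minus_sym in Hd. fold (e t) in Hd.
    destruct (HS t ltac:(lra)) as [T1 [T2 _]].
    (* For these [t] the orbit meets no pole before time [N], and [i < N]. *)
    assert (Ne : e t <> 0).
    { unfold e. apply Rabs_no_R0. intros F. apply (T2 i Hi). apply cos_0_abs; [apply Bnd; lra|].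
      unfold a in F. lra. }
    assert (Pe : 0 < e t) by (specialize (Se t); lra).
    nra.
  - assert (Hji : (j < i)%nat) by lia.
    set (g := Rabs (PI / 2 - a j b)).
    assert (Pg : 0 < g) by (apply Rabs_pos_lt; specialize (Ajb j Hji); lra).
    destruct (Cont j ltac:(lia) (g / 2) ltac:(lra)) as [d1 [P1 H1]].
    destruct (Small C (g / 2) PC ltac:(lra)) as [d2 [P2 H2]].
    destruct (Mid (Rmin (Rmin d d1) (Rmin d2 eps))) as [t Ht]; [repeat apply Rmin_pos; auto|].
    Rmin_bounds.
    specialize (Hd t ltac:(lra)). specialize (H1 t ltac:(lra)). destruct (H2 t ltac:(lra)) as [_ [_ E2]].
    rewrite AN in Hd by lra.
    assert (g <= Rabs (PI / 2 - a j t) + Rabs (a j t - a j b)).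
    { unfold g. replace (PI / 2 - a j b) with ((PI / 2 - a j t) + (a j t - a j b)) by ring. apply Rabs_triang. }
    lra.
Qed.

(** * Isolation of the parameters whose orbit ends at a pole *)

(** A virtual cycle parameter of order [N + 1] in [(0, PI)], with the choice between the poles
    [PI / 2] and [- PI / 2] left open. *)
Definition center_parameter (N : nat) (t : R) : Prop :=
  0 < t < PI /\ (forall k, (k < N)%nat -> cos (rorb k t) <> 0) /\ cos (rorb N t) = 0.

Lemma center_parameter_abs (N : nat) (t : R) : center_parameter N t -> Rabs (rorb N t) = PI / 2.
Proof.
  intros [Ht [_ H]]. apply cos_0_abs; auto. pose proof (rorb_bound t N ltac:(lra)). lra.
Qed.

Lemma center_parameter_pole (N : nat) (t : R) : center_parameter N t ->
  expi2 (RtoC (rorb N t)) = (- (1))%C /\ 1 <= Cmod (RtoC (rorb N t)) <= 2.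
Proof.
  intros Sc. split.
  - assert (F : ~ (expi2 (RtoC (rorb N t)) + 1)%C <> 0%C).
    { intros F. apply expi2_pole in F. apply F. destruct Sc as [_ [_ Hc]]. now rewrite Ccos_R, Hc. }
    apply NNPP in F. apply Cminus_eq_0. rewrite <- F. ring.
  - rewrite Cmod_R, center_parameter_abs by auto. pose proof PI2_1. pose proof PI_4. lra.
Qed.

Lemma center_parameter_near (N : nat) (b : R) : center_parameter N b ->
  (exists d, 0 < d /\ forall l, Cmod l < d -> orb (RtoC b + l)%C (2 * N) = RtoC (rorb N b)) ->
  exists d, 0 < d /\ forall t, Rabs (t - b) < d -> center_parameter N t.
Proof.
  intros [Hb [Hk Hc]] [d [Pd Hd]].
  destruct (rorb_near b N Hk) as [d1 [P1 H1]].
  exists (Rmin (Rmin d d1) (Rmin b (PI - b))). split; [repeat apply Rmin_pos; lra|]. intros t Ht.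
  Rmin_bounds.
  destruct (H1 (t - b) ltac:(lra)) as [A1 A2]. specialize (A2 N (le_n N)).
  rewrite Hd in A2 by (rewrite Cmod_R; lra). apply RtoC_inj in A2.
  replace (b + (t - b)) with t in * by ring.
  assert (Ht' : - Rmin b (PI - b) < t - b < Rmin b (PI - b)) by (apply Rabs_lt_between; lra).
  split; [lra|]. split; auto. now rewrite <- A2.
Qed.

Lemma center_equation_order (N : nat) (b : R) : center_parameter N b ->
  (exists p c, (1 <= p)%nat /\ c <> RtoC 0 /\
     clim (fun l => (orb (RtoC b + l) (2 * N) - RtoC (rorb N b)) / l ^ p)%C 0 c) \/
  (exists d, 0 < d /\ forall l, Cmod l < d -> orb (RtoC b + l)%C (2 * N) = RtoC (rorb N b)).
Proof.
  intros [Hb [Hk Hc]].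
  destruct (orb_smooth (RtoC b) (2 * N) (orb_no_pole b N Hk)) as [rad [Pr [So _]]].
  destruct (finite_order_or_zero rad (fun l => orb (RtoC b + l) (2 * N) - RtoC (rorb N b))%C Pr)
    as [H|[d [Pd Hd]]].
  - intros n. apply holo_minus; [apply (So (2 * N)%nat (le_n _))|apply holo_const].
  - replace (RtoC b + 0)%C with (RtoC b) by ring. rewrite orb_real by auto. ring.
  - left. exact H.
  - right. exists d. split; auto. intros l Hl. apply Cminus_eq_0. now apply Hd.
Qed.

(** A zero of finite order [p] would be isolated, against the solutions to the right of [b]. Hence
    the complex equation holds identically near [b], and so also to its left. *)
Lemma center_parameter_extend (N : nat) (b eps : R) : center_parameter N b -> 0 < eps ->
  (forall t, b < t < b + eps -> center_parameter N t) ->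
  exists d, 0 < d /\ forall t, Rabs (t - b) < d -> center_parameter N t.
Proof.
  intros Sb Heps HS. apply center_parameter_near; auto.
  destruct (center_equation_order N b Sb) as [[p [c [Hp [Hc L]]]]|?]; auto. exfalso.
  destruct (clim_neq_0_loc _ _ _ L Hc) as [d [Pd Hd]].
  pose proof Sb as [Hb [Hk _]].
  destruct (rorb_near b N Hk) as [d1 [P1 H1]].
  destruct (rorb_continuous b N Hk 1 Rlt_0_1) as [d2 [P2 H2]].
  set (s := Rmin (Rmin d d1) (Rmin d2 eps) / 2).
  assert (Q : 0 < Rmin (Rmin d d1) (Rmin d2 eps)) by (repeat apply Rmin_pos; auto).
  assert (Ps : 0 < s) by (unfold s; lra).
  assert (Ls : s < d /\ s < d1 /\ s < d2 /\ s < eps).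
  { Rmin_bounds.
    unfold s. lra. }
  apply (Hd (RtoC s)).
  - apply RtoC_neq_0. lra.
  - replace (RtoC s - 0)%C with (RtoC s) by ring. rewrite Cmod_R, Rabs_pos_eq; lra.
  - destruct (H1 s ltac:(rewrite Rabs_pos_eq; lra)) as [_ E]. rewrite (E N (le_n N)).
    (* Both values are [PI / 2] or [- PI / 2] and differ by less than 1, hence they have the same
       sign. *)
    assert (Eq : rorb N (b + s) = rorb N b).
    { pose proof (center_parameter_abs N b Sb) as A1.
      pose proof (center_parameter_abs N (b + s) (HS (b + s) ltac:(lra))) as A2.
      specialize (H2 (b + s)). replace (b + s - b) with s in H2 by ring.
      specialize (H2 ltac:(rewrite Rabs_pos_eq; lra)). apply Rabs_def2 in H2.
      pose proof PI2_1. unfold Rabs in A1, A2.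
      destruct (Rcase_abs (rorb N b)), (Rcase_abs (rorb N (b + s))); lra. }
    rewrite Eq. field. apply Cpow_nz, RtoC_neq_0. lra.
Qed.

Lemma first_pole (n : nat) (b : R) : (forall k, (k < n)%nat -> cos (rorb k b) <> 0) \/
  exists i, (i < n)%nat /\ (forall k, (k < i)%nat -> cos (rorb k b) <> 0) /\ cos (rorb i b) = 0.
Proof.
  induction n.
  - left. intros; lia.
  - destruct IHn as [H|[i [Hi H]]].
    + destruct (Req_dec (cos (rorb n b)) 0) as [E|E].
      * right. exists n. auto.
      * left. intros k Hk. destruct (Nat.eq_dec k n) as [->|N]; auto. apply H. lia.
    + right. exists i. split; [lia|auto].
Qed.

(* If the equation held near [t0] it would persist down to the left end of a maximal
   interval of parameters, where an earlier point of the orbit hits the pole; the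
   flatness of the map there then excludes the parameters just to the right. *)
Lemma center_isolated (N : nat) (t0 : R) : (1 <= N)%nat -> center_parameter N t0 ->
  ~ exists d, 0 < d /\ forall t, Rabs (t - t0) < d -> center_parameter N t.
Proof.
  intros HN S0 [d0 [Pd0 H0]].
  (* The sign of [u] is reversed so that the least upper bound yields the infimum [b = - m] of the
     left ends of intervals of solutions ending at [t0]. *)
  set (E := fun u => - u <= t0 /\ forall t, - u <= t <= t0 -> center_parameter N t).
  (* The orbit of [t] stays in [[-t, t]] and reaches modulus [PI / 2]; this keeps [b] away from
     0. *)
  assert (LB : forall t, center_parameter N t -> PI / 2 <= t).
  { intros t St. rewrite <- (center_parameter_abs N t St). destruct St. apply rorb_bound. lra. }
  destruct (completeness E) as [m [Ub Lub]].
  { exists (- (PI / 2)). intros u [Hu1 Hu2]. specialize (LB (- u) (Hu2 (- u) ltac:(lra))). lra. }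
  { exists (- t0). split; [lra|]. intros t Ht. replace t with t0 by lra. auto. }
  set (b := - m).
  assert (Bt : b <= t0 - d0 / 2).
  { assert (E (- (t0 - d0 / 2))).
    { split; [lra|]. intros t Ht. apply H0. apply Rabs_def1; lra. }
    specialize (Ub _ H). unfold b. lra. }
  assert (Bp : PI / 2 <= b).
  { unfold b. assert (m <= - (PI / 2)); [|lra]. apply Lub. intros u [Hu1 Hu2].
    specialize (LB (- u) (Hu2 (- u) ltac:(lra))). lra. }
  assert (Right : forall t, b < t <= t0 -> center_parameter N t).
  { intros t Ht. apply NNPP. intros NS. assert (m <= - t); [|unfold b in Ht; lra].
    apply Lub. intros u [Hu1 Hu2]. apply Rnot_lt_le. intros L. apply NS, Hu2. lra. }
  assert (Hb : 0 < b < PI) by (destruct S0; pose proof PI_RGT_0; lra).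
  destruct (classic (center_parameter N b)) as [Sb|NSb].
  - destruct (center_parameter_extend N b (t0 - b) Sb) as [d [Pd Hd]]; [lra| |].
    { intros t Ht. apply Right. lra. }
    assert (E (- (b - d / 2))).
    { split; [lra|]. intros t Ht. destruct (Rle_dec t b) as [L|L].
      - apply Hd. apply Rabs_def1; lra.
      - apply Right. lra. }
    specialize (Ub _ H). unfold b in *. lra.
  - destruct (first_pole N b) as [Hk|[i [Hi [Hk Hc]]]].
    (* Without an earlier pole at [b] the N-th point depends continuously on the parameter, so its
       modulus at [b] is the limit [PI / 2] and [b] would itself be a solution. *)
    + apply NSb. split; auto. split; auto.
      apply cos_0_abs; [pose proof (rorb_bound b N ltac:(lra)); lra|].
      apply cond_eq. intros e He.
      destruct (rorb_continuous b N Hk e He) as [d [Pd Hd]].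
      set (s := Rmin d (t0 - b) / 2).
      assert (Q : 0 < Rmin d (t0 - b)) by (apply Rmin_pos; lra).
      Rmin_bounds.
      rewrite <- (center_parameter_abs N (b + s)) by (apply Right; unfold s; lra).
      eapply Rle_lt_trans; [apply Rabs_triang_inv2|]. rewrite Rabs_minus_sym.
      apply Hd. rewrite Rabs_pos_eq; unfold s; lra.
    + apply (flat_return b (t0 - b) N i); auto; [lra|].
      intros t Ht. destruct (Right t ltac:(lra)) as [A [B C]]. split; [lra|]. auto.
Qed.

(** * Derivatives along the orbit *)

(** The partial derivatives of [T_w w x] are [T / w] in the parameter and [i (w^2 - T^2) / w] in the
    variable; both are read off the Moebius form. *)
Lemma cderiv_T_w (W f : C -> C) (l dW df : C) :
  W l <> 0%C -> (expi2 (f l) + 1)%C <> 0%C -> cderiv W l dW -> cderiv f l df ->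
  let T := T_w (W l) (f l) in
  cderiv (fun u => T_w (W u) (f u)) l (T / W l * dW + Ci * (W l * W l - T * T) / W l * df)%C.
Proof.
  intros HW Hf DW Df T.
  assert (De : cderiv (fun u => expi2 (f u)) l (2 * Ci * expi2 (f l) * df)%C).
  { apply (cderiv_comp f expi2); auto. apply cderiv_expi2. }
  assert (Cn : ccont (fun u => expi2 (f u) + 1)%C l).
  { apply clim_plus; [exact (cderiv_cont _ _ _ De)|apply clim_const]. }
  destruct (ccont_neq_0_loc _ _ Cn Hf) as [d [Pd Hd]].
  apply cderiv_ext_loc with (fun u => W u * (expi2 (f u) - 1) * / (expi2 (f u) + 1))%C d; auto.
  { intros u Hu. symmetry. apply T_w_mobius. now apply Hd. }
  unfold T. rewrite T_w_mobius by auto.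
  set (e := expi2 (f l)) in *.
  replace (W l * (e - 1) / (e + 1) / W l * dW
    + Ci * (W l * W l - W l * (e - 1) / (e + 1) * (W l * (e - 1) / (e + 1))) / W l * df)%C
    with ((dW * (e - 1) + W l * (2 * Ci * e * df - 0)) * / (e + 1)
      + W l * (e - 1) * (- (2 * Ci * e * df + 0) * (/ (e + 1) * / (e + 1))))%C by (field; split; auto).
  apply (cderiv_mult (fun u => W u * (expi2 (f u) - 1))%C (fun u => / (expi2 (f u) + 1))%C).
  - apply (cderiv_mult W (fun u => expi2 (f u) - 1)%C); auto.
    apply cderiv_minus; auto. apply cderiv_const.
  - apply (cderiv_inv (fun u => expi2 (f u) + 1)%C); auto.
    apply cderiv_plus; auto. apply cderiv_const.
Qed.

Lemma cderiv_iter_T_w (t : C) (n : nat) : t <> 0%C ->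
  (forall i, (i < n)%nat -> (expi2 (orb t i) + 1)%C <> 0%C) ->
  cderiv (Nat.iter n (T_w t)) t (multiplier t n).
Proof.
  intros Ht. induction n; intros H; [apply cderiv_id|].
  change (cderiv (fun x => T_w t (Nat.iter n (T_w t) x)) t (multiplier t n * tau t n)%C).
  replace (multiplier t n * tau t n)%C
    with (T_w t (orb t n) / t * 0 + Ci * (t * t - T_w t (orb t n) * T_w t (orb t n)) / t * multiplier t n)%C.
  - apply (cderiv_T_w (fun _ => t) (Nat.iter n (T_w t))); auto.
    + apply (H n). lia.
    + apply cderiv_const.
  - unfold tau. change (orb t 0) with t. change (orb t (S n)) with (T_w t (orb t n)). field. auto.
Qed.

(** Variation of constants: the derivatives [d_n] in the parameter satisfy
    [d_(n+1) = z_(n+1) / t + tau_n d_n], and dividing by the multiplier turns this recursion into a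
    sum. *)
Lemma cderiv_orb (t : C) (n : nat) : t <> 0%C ->
  (forall i, (i < n)%nat -> (expi2 (orb t i) + 1)%C <> 0%C) ->
  (forall i, (i <= n)%nat -> multiplier t i <> 0%C) ->
  cderiv (fun l => orb (t + l)%C n) 0
    (multiplier t n * csum (fun i => / multiplier t i * (orb t i / t)) (S n))%C.
Proof.
  intros Ht. induction n; intros H HM.
  - replace (multiplier t 0 * csum (fun i => / multiplier t i * (orb t i / t)) 1)%C with (0 + 1)%C.
    + apply (cderiv_plus (fun _ => t) (fun l => l)); [apply cderiv_const|apply cderiv_id].
    + simpl. change (orb t 0) with t. field. auto.
  - specialize (IHn (fun i Hi => H i (Nat.lt_lt_succ_r _ _ Hi)) (fun i Hi => HM i (Nat.le_le_succ_r _ _ Hi))).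
    change (cderiv (fun l => T_w (t + l)%C (orb (t + l)%C n)) 0
      (multiplier t n * tau t n * (csum (fun i => / multiplier t i * (orb t i / t)) (S n)
        + / multiplier t (S n) * (orb t (S n) / t)))%C).
    set (A := csum _ _) in *.
    pose proof (cderiv_T_w (fun l => t + l)%C (fun l => orb (t + l)%C n) 0 (0 + 1)%C _
      ltac:(cbv beta; replace (t + 0)%C with t by ring; exact Ht)
      ltac:(cbv beta; replace (t + 0)%C with t by ring; apply H; lia)
      (cderiv_plus _ _ _ _ _ (cderiv_const t 0) (cderiv_id 0)) IHn) as D.
    cbv beta zeta in D. replace (t + 0)%C with t in D by ring.
    change (T_w t (orb t n)) with (orb t (S n)) in D.
    assert (Eq : (multiplier t n * tau t n * (A + / multiplier t (S n) * (orb t (S n) / t)) =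
      orb t (S n) / t * (0 + 1) + Ci * (t * t - orb t (S n) * orb t (S n)) / t * (multiplier t n * A))%C).
    { assert (Hm : (multiplier t n * tau t n)%C <> 0%C) by (apply (HM (S n)); lia).
      change (multiplier t (S n)) with (multiplier t n * tau t n)%C.
      transitivity (multiplier t n * tau t n * A
        + (multiplier t n * tau t n) * / (multiplier t n * tau t n) * (orb t (S n) / t))%C; [ring|].
      rewrite Cinv_r by auto. unfold tau. change (orb t 0) with t. field. auto. }
    rewrite Eq. exact D.
Qed.

Lemma multiplier_nonzero (t : R) (N : nat) : center_parameter N t ->
  forall i, (i <= 2 * N)%nat -> multiplier (RtoC t) i <> 0%C.
Proof.
  intros Sc i Hi. destruct N as [|N].
  - replace i with O by lia. apply RtoC_neq_0. lra.
  - destruct (center_parameter_pole _ _ Sc) as [A1 A2]. destruct Sc as [Ht [Hk Hc]].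
    apply (multiplier_neq_0 (RtoC t) (RtoC (rorb (S N) t)) (2 * S N)); auto; try lia.
    + now apply orb_no_pole.
    + now apply orb_real.
Qed.

(** Orbit points alternate between the two axes, and each factor [tau] is imaginary because the
    squares of the points are real. So orbit and multiplier lie on the same line [Ci ^ i * R], and
    their quotient is real. *)
Lemma real_ratio (t : R) (N : nat) : center_parameter N t ->
  forall i, (i <= 2 * N)%nat -> exists a b : R,
    orb (RtoC t) i = (Ci ^ i * RtoC a)%C /\ multiplier (RtoC t) i = (Ci ^ i * RtoC b)%C.
Proof.
  intros [Ht [Hk _]].
  assert (Ev : forall k, exists e : R, (Ci ^ (2 * k))%C = RtoC e /\ e * e = 1).
  { induction k.
    - exists 1. split; [reflexivity|ring].
    - destruct IHk as [e [E1 E2]]. exists (- e). split; [|lra].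
      replace (2 * S k)%nat with (S (S (2 * k))) by lia.
      change (Ci * (Ci * Ci ^ (2 * k)) = RtoC (- e))%C. rewrite Cmult_assoc, Ci_sqr, E1, RtoC_opp. ring. }
  assert (Orb : forall i, (i <= 2 * N)%nat -> exists a : R, orb (RtoC t) i = (Ci ^ i * RtoC a)%C).
  { intros i Hi. destruct (parity_cases i) as [k [-> | ->]]; destruct (Ev k) as [e [E1 E2]].
    - exists (e * rorb k t). rewrite orb_real by (intros; apply Hk; lia).
      rewrite E1, <- RtoC_mult. f_equal. transitivity (e * e * rorb k t); [rewrite E2; ring|ring].
    - exists (e * (t * tan (rorb k t))). rewrite orb_real_odd by (intros; apply Hk; lia).
      rewrite Cpow_add_r, E1, Cpow_1_r, (RtoC_mult e).
      replace (RtoC e * Ci * (RtoC e * RtoC (t * tan (rorb k t))))%C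
        with (RtoC e * RtoC e * (Ci * RtoC (t * tan (rorb k t))))%C by ring.
      rewrite <- (RtoC_mult e e), E2. ring. }
  assert (Sq : forall i, exists e : R, (Ci ^ i * Ci ^ i)%C = RtoC e).
  { intros i. destruct (Ev i) as [e [E1 _]]. exists e. rewrite <- Cpow_add_r, <- E1. f_equal. lia. }
  intros i Hi. destruct (Orb i Hi) as [a Ha].
  assert (Mu : exists b : R, multiplier (RtoC t) i = (Ci ^ i * RtoC b)%C).
  { clear a Ha. induction i.
    - exists 1. simpl. ring.
    - destruct IHi as [b Hb]; [lia|]. destruct (Orb (S i) Hi) as [a Ha]. destruct (Sq (S i)) as [e He].
      exists (b * ((t * t - e * (a * a)) / t)). simpl multiplier. unfold tau.
      rewrite Hb, Ha. change (orb (RtoC t) 0) with (RtoC t).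
      replace (Ci ^ S i * RtoC a * (Ci ^ S i * RtoC a))%C with (Ci ^ S i * Ci ^ S i * (RtoC a * RtoC a))%C by ring.
      rewrite He. simpl (Ci ^ S i)%C.
      rewrite RtoC_mult, RtoC_div, RtoC_minus, !RtoC_mult by lra. field. apply RtoC_neq_0. lra. }
  destruct Mu as [b Hb]. exists a, b. auto.
Qed.

(** The number [r] is [P 1], where [P] is the polynomial [D]. Since [P 0 = 1], a value [P 1 <= 0]
    would give a root in [(0, 1]] by the intermediate value theorem, which [no_small_root] excludes
    once the order of vanishing is finite. *)
Lemma center_transversality (N : nat) (t0 : R) : center_parameter N t0 ->
  exists M r : R, 0 < r /\ multiplier (RtoC t0) (2 * N) = RtoC M /\ M <> 0 /\
    cderiv (fun l => orb (RtoC t0 + l)%C (2 * N)) 0 (RtoC (M * r)).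
Proof.
  intros Sc. pose proof Sc as [Ht [Hk Hc]]. set (t := RtoC t0). set (K := (2 * N)%nat).
  assert (Nt : t <> 0%C) by (apply RtoC_neq_0; lra).
  pose proof (multiplier_nonzero t0 N Sc) as NM. fold t K in NM.
  set (d := fun i => Re (/ multiplier t i * (orb t i / t))%C).
  assert (Ed : forall i, (i <= K)%nat -> (/ multiplier t i * (orb t i / t))%C = RtoC (d i)).
  { intros i Hi. destruct (real_ratio t0 N Sc i Hi) as [a [b [Ea Eb]]]. fold t in Ea, Eb.
    assert (Nc : (Ci ^ i)%C <> 0%C) by (apply Cpow_nz, Ci_neq_0).
    assert (Nb : b <> 0).
    { intros F. apply (NM i Hi). rewrite Eb, F. ring. }
    assert (E : (/ multiplier t i * (orb t i / t))%C = RtoC (a / (b * t0))).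
    { rewrite Ea, Eb, RtoC_div, RtoC_mult by (apply Rmult_integral_contrapositive; lra).
      unfold t. field. repeat split; auto; apply RtoC_neq_0; lra. }
    unfold d. rewrite E. reflexivity. }
  set (P := fun rho => sum_f_R0 (fun i => d i * rho ^ i) K).
  assert (EP : forall rho, csum (fun i => RtoC rho ^ i / multiplier t i * (orb t i / t))%C (S K) = RtoC (P rho)).
  { intros rho. unfold P.
    assert (G : forall n, (n <= K)%nat -> csum (fun i => RtoC rho ^ i / multiplier t i * (orb t i / t))%C (S n)
       = RtoC (sum_f_R0 (fun i => d i * rho ^ i) n)).
    { assert (T : forall i, (i <= K)%nat -> (RtoC rho ^ i / multiplier t i * (orb t i / t))%C = RtoC (d i * rho ^ i)).
      { intros i Hi. rewrite RtoC_mult, <- Ed, RtoC_pow by auto. unfold Cdiv. ring. }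
      induction n; intros Hn.
      - cbn [csum sum_f_R0]. rewrite T by lia. ring.
      - change (csum (fun i => RtoC rho ^ i / multiplier t i * (orb t i / t))%C (S n)
          + RtoC rho ^ S n / multiplier t (S n) * (orb t (S n) / t) = RtoC (sum_f_R0 (fun i => d i * rho ^ i)%R (S n)))%C.
        rewrite IHn, T by lia. cbn [sum_f_R0]. now rewrite RtoC_plus. }
    apply G. lia. }
  assert (d0 : d O = 1).
  { unfold d. simpl multiplier. change (orb t 0) with t.
    replace (/ 1 * (t / t))%C with (RtoC 1) by (field; auto). reflexivity. }
  assert (P0 : P 0 = 1).
  { unfold P. generalize K. intros n. induction n as [|n IH].
    - simpl. rewrite d0. ring.
    - cbn [sum_f_R0]. rewrite IH, pow_ne_zero by auto with arith. ring. }
  assert (PC : continuity P).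
  { unfold P. generalize K. intros n. induction n as [|n IH].
    - intros x. apply continuity_pt_const. intros u v. reflexivity.
    - intros x.
      apply (continuity_pt_plus (fun rho => sum_f_R0 (fun i => d i * rho ^ i) n) (fun rho => d (S n) * rho ^ S n)).
      + apply IH.
      + apply continuity_pt_mult; [apply continuity_pt_const; intros u v; reflexivity|].
        apply derivable_continuous_pt, derivable_pt_pow. }
  assert (Pos : 0 < P 1).
  { apply Rnot_le_lt. intros L.
    destruct (IVT_cor P 0 1 PC) as [rho [Hrho Prho]]; [lra|rewrite P0; lra|].
    assert (Nrho : rho <> 0) by (intros F; rewrite F, P0 in Prho; lra).
    (* For [N = 0] no point is moved and [P] is the constant 1; [no_small_root] asks for
       [K >= 1]. *)
    destruct N as [|N'].
    { unfold P in L. simpl in L. rewrite d0 in L. lra. }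
    destruct (center_equation_order (S N') t0 Sc) as [[p [c [Hp [Hc0 Lim]]]]|Z].
    - destruct (center_parameter_pole _ _ Sc) as [A1 A2].
      apply (no_small_root t (RtoC (rorb (S N') t0)) K) with (rho := rho) (p := p) (c := c); auto.
      + unfold K. lia.
      + now apply orb_no_pole.
      + now apply orb_real.
      + lra.
      + change (csum (fun i => RtoC rho ^ i / multiplier t i * (orb t i / t))%C (S K) = 0%C).
        rewrite EP, Prho. reflexivity.
    - apply (center_isolated (S N') t0); auto; [lia|]. now apply center_parameter_near. }
  destruct (real_ratio t0 N Sc K (le_n K)) as [a [b [_ Eb]]]. fold t in Eb.
  (* [K = 2 N] is even, so [Ci ^ K] is real and the multiplier with it. *)
  assert (EM : multiplier t K = RtoC (Re (multiplier t K))).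
  { rewrite Eb. unfold K. rewrite Cpow_mult_r. replace (Ci ^ 2)%C with (RtoC (-1)).
    - rewrite <- RtoC_pow, <- RtoC_mult. reflexivity.
    - simpl. rewrite Cmult_1_r, Ci_sqr, <- RtoC_opp. reflexivity. }
  exists (Re (multiplier t K)), (P 1). split; [auto|split; [auto|split]].
  - intros F. apply (NM K (le_n K)). rewrite EM, F. reflexivity.
  - rewrite RtoC_mult, <- EM, <- EP.
    rewrite (csum_ext _ (fun i => / multiplier t i * (orb t i / t))%C).
    + apply cderiv_orb; auto. now apply orb_no_pole.
    + intros i _. rewrite Cpow_1_l. unfold Cdiv. ring.
Qed.

(** * Return to the iterates of [F] and to [Phi] *)

Lemma iter_F_w (w x : C) (n : nat) : Nat.iter n (F_w w) x = Nat.iter (2 * n) (T_w w) x.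
Proof.
  induction n; auto. replace (2 * S n)%nat with (S (S (2 * n))) by lia. simpl Nat.iter at 1.
  rewrite IHn. reflexivity.
Qed.

Lemma is_derive_of_cderiv (f : C -> C) (x l : C) : cderiv f x l ->
  is_derive (K := C_AbsRing) (V := C_NormedModule) f x l.
Proof.
  intros H. split; [apply is_linear_scal_l|].
  intros y Hy. apply (is_filter_lim_locally_unique (V := AbsRing_NormedModule C_AbsRing)) in Hy. subst y.
  intros eps. destruct (H eps (cond_pos eps)) as [d [Pd Hd]].
  exists (mkposreal _ Pd). intros y Hy.
  change (Cmod (y - x) < d) in Hy.
  change (Cmod ((f y - f x) - (y - x) * l)%C <= eps * Cmod (y - x)%C).
  destruct (Ceq_dec y x) as [->|N].
  - replace (f x - f x - (x - x) * l)%C with (RtoC 0) by ring. rewrite Cmod_0.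
    apply Rmult_le_pos; [left; apply cond_pos|apply Cmod_ge_0].
  - specialize (Hd y N Hy). pose proof (Cminus_neq_0 _ _ N) as N'.
    replace (f y - f x - (y - x) * l)%C with (((f y - f x) / (y - x) - l) * (y - x))%C by (field; auto).
    rewrite Cmod_mult. apply Rmult_le_compat_r; [apply Cmod_ge_0|lra].
Qed.

Theorem corollary10p1 (t0 : R) (m : nat) (c0 : R)
    (ht0 : 0 < t0 < PI)
    (hvc : virtual_cycle_parameter m t0 c0) :
  let c1 := t0 in
  exists (dPhi : R) (dF : C),
    is_derive (Phi m c0) t0 dPhi /\
    is_derive (K := C_AbsRing) (V := C_NormedModule)
      (Nat.iter (m - 1) (F_w (RtoC t0))) (RtoC c1) dF /\
    dF <> RtoC 0 /\
    exists r : R, (RtoC dPhi / dF)%C = RtoC r /\ 0 < r.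
Proof.
  intros c1. destruct hvc as [Hm [Hc0 [Horb Hpole]]]. set (N := (m - 1)%nat) in *.
  assert (Hk : forall k, (k < N)%nat -> cos (rorb k t0) <> 0).
  { intros k Hk E. apply (Hpole k Hk). now apply cos_eq_0_0. }
  assert (Sc : center_parameter N t0).
  { split; auto. split; auto. change (rorb N t0 = c0) in Horb. rewrite Horb.
    destruct Hc0 as [-> | ->]; [apply cos_PI2|]. rewrite cos_neg. apply cos_PI2. }
  destruct (center_transversality N t0 Sc) as [M [r [Pr [EM [NM D]]]]].
  (* [M] is the multiplier of [T^(2N) = F^N] at [t0], and [r] is [D(1)]. *)
  exists (M * r), (RtoC M). split; [|split; [|split]].
  - destruct (rorb_near t0 N Hk) as [d [Pd Hd]].
    (* The complex derivative in [l] is taken at [l = 0]; the real parameter [s] enters as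
       [l = s - t0], written as a line so that [Re_deriv_line] applies. *)
    assert (D1 : is_derive (fun s : R => Re (orb (RtoC t0 + (RtoC (- t0) + RtoC s * 1))%C (2 * N))) t0 (M * r)).
    { replace (M * r) with (Re (RtoC (M * r) * 1)%C) by (simpl; ring).
      apply (Re_deriv_line (fun l => orb (RtoC t0 + l)%C (2 * N))).
      replace (RtoC (- t0) + RtoC t0 * 1)%C with (RtoC 0); auto. rewrite RtoC_opp. ring. }
    apply is_derive_ext_loc with (fun s => Re (orb (RtoC t0 + (RtoC (- t0) + RtoC s * 1))%C (2 * N)) - c0).
    + exists (mkposreal _ Pd). intros s Hs. change (Rabs (s - t0) < d) in Hs.
      destruct (Hd (s - t0) Hs) as [_ E]. specialize (E N (le_n N)).
      replace (RtoC (- t0) + RtoC s * 1)%C with (RtoC (s - t0))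
        by (rewrite (RtoC_minus s t0), RtoC_opp; ring).
      rewrite E, Rplus_minus. reflexivity.
    + replace (M * r) with (minus (M * r) 0) by (unfold minus, plus, opp; simpl; ring).
      apply (is_derive_minus (K := R_AbsRing) (V := R_NormedModule)); auto.
      apply (is_derive_const (K := R_AbsRing) (V := R_NormedModule)).
  - apply is_derive_of_cderiv. unfold c1. rewrite <- EM.
    apply cderiv_ext_loc with (Nat.iter (2 * N) (T_w (RtoC t0))) 1; [lra| |].
    + intros w _. symmetry. apply iter_F_w.
    + apply cderiv_iter_T_w; [apply RtoC_neq_0; lra|now apply orb_no_pole].
  - now apply RtoC_neq_0.
  - exists r. split; auto. rewrite RtoC_mult. field. now apply RtoC_neq_0.
Qed.
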